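(* Let $X$ be an infinite dimensional complex Banach space with a normalized Schauder basis. Then the Cluster Value Theorem holds for $\mathcal{H}^\infty (\mathbb{D}_X)$; that is, for every $f \in \mathcal{H}^\infty(\mathbb{D}_X)$ and every $z \in \overline{\mathbb{D}}_X^{\sigma}$, $$Cl_{\mathbb{D}_X}(f,z) = \widehat{f}\,\big(\mathcal{M}_z(\mathcal{H}^\infty(\mathbb{D}_X))\big).$$
   Context: Let $(e_j)$ be the normalized Schauder basis of $X$ ($\|e_j\|=1$) with coefficient functionals $(e_j^* )$, and let $\mathbb{D}_X = \{x \in X : |e_j^*(x)|<1 \text{ for every } j\in\mathbb{N}\}$, an open subset of $X$. $\mathcal{H}^\infty(\mathbb{D}_X)$ is the Banach algebra of bounded holomorphic functions $\mathbb{D}_X\to\mathbb{C}$ with supremum norm $\|\cdot\|_{\mathbb{D}_X}$. $\mathcal{M}(\mathcal{A})$ denotes the spectrum of a Banach algebra $\mathcal{A}$, i.e. the set of nonzero continuous algebra homomorphisms $\mathcal{A}\to\mathbb{C}$ with the weak-star topology, and $\widehat{f}(\phi)=\phi(f)$ is the Gelfand transform. Let $X^\sharp = \mathcal{H}^\infty(\mathbb{D}_X)\cap X^*$ (the functionals in $X^*$ that are bounded on $\mathbb{D}_X$), endowed with the norm $\|\cdot\|_{\mathbb{D}_X}$; it is a Banach space. Let $\sigma$ denote the topology $w((X^\sharp)^*,X^\sharp)$ on the dual $(X^\sharp)^*$. Each $x\in\mathbb{D}_X$ is regarded as the element $x^*\mapsto x^*(x)$ of $(X^\sharp)^*$, and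 $\overline{\mathbb{D}}_X^{\sigma}$ is the $\sigma$-closure of $\mathbb{D}_X$ in $(X^\sharp)^*$ (it equals the closed unit ball $\overline{B}_{(X^\sharp)^*}$). Let $\pi:\mathcal{M}(\mathcal{H}^\infty(\mathbb{D}_X))\to\overline{B}_{(X^\sharp)^*}$ be $\pi(\phi)=\phi|_{X^\sharp}$ (a surjective map). The fiber at $z$ is $\mathcal{M}_z(\mathcal{H}^\infty(\mathbb{D}_X))=\pi^{-1}(z)$. The cluster set $Cl_{\mathbb{D}_X}(f,z)$ is the set of all $\lambda\in\mathbb{C}$ for which there exists a net $(x_\alpha)\subset\mathbb{D}_X$ such that $x_\alpha\to z$ in the topology $\sigma$ and $f(x_\alpha)\to\lambda$. *)

(* Defs.v *)
From HB Require Import structures.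
From mathcomp Require Import all_boot all_order all_algebra.
From mathcomp Require Import all_classical all_reals all_analysis.
From mathcomp Require Import complex.

Set Implicit Arguments.
Unset Strict Implicit.
Unset Printing Implicit Defensive.

Import Order.TTheory GRing.Theory Num.Theory.
Import numFieldNormedType.Exports.

Local Open Scope classical_set_scope.
Local Open Scope ring_scope.

(* Naming the numFieldType structure of R[i] gives the complex numbers their
   standard topology, through the instances on Num.NumField.sort. *)
Definition CC (R : realType) : numFieldType := R[i].

Section nets.
Context {I : Type}.

Definition directed (le : I -> I -> Prop) : Prop :=
  [/\ inhabited I,
      forall i, le i i,
      forall i j k, le i j -> le j k -> le i k &
      forall i j, exists k, le i k /\ le j k].

(* A net (x_i) converges to l iff x @ tails le --> l. *)
Definition tails (le : I -> I -> Prop) : set_system I :=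
  [set A | exists i, forall j, le i j -> A j].

End nets.

Section topological_dual.
Context {K : numFieldType} (V : normedModType K).

Record dual := Dual {
  dual_fun :> {linear V -> K};
  dual_continuous : continuous dual_fun }.

HB.instance Definition _ := gen_eqMixin dual.
HB.instance Definition _ := gen_choiceMixin dual.

(* The topology carried by [dual] is the weak-star topology w(V^*, V). *)
HB.instance Definition _ := Topological.copy dual
  (initial_topology (fun z : dual => (z : V -> K) : {ptws V -> K})).

End topological_dual.

Definition infinite_dimensional {K : numFieldType} (V : lmodType K) : Prop :=
  forall n : nat, exists v : 'I_n -> V,
    forall a : 'I_n -> K, \sum_(i < n) a i *: v i = 0 -> forall i, a i = 0.

Section schauder_bases.
Context {K : numFieldType} {X : normedModType K} (e : nat -> X).

Definition expansion (x : X) (a : nat -> K) : Prop :=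
  series (fun j => a j *: e j) @ \oo --> x.

Definition schauder_basis : Prop := forall x, exists! a, expansion x a.

Definition normalized : Prop := forall j, `|e j| = 1.

(* The coefficient functional e_j^*; meaningful when e is a Schauder basis. *)
Definition coef (j : nat) (x : X) : K := get (expansion x) j.

Definition polydisc : set X := [set x | forall j, `|coef j x| < 1].

End schauder_bases.

Section bounded_holomorphic.
Context {R : realType} {X : normedModType (CC R)} (e : nat -> X).

Local Notation C := (CC R).
Local Notation D := (polydisc e).

(* The functions f : D -> C that extend to some F : X -> C which is complex
   Frechet differentiable at every point of D. As D is open for a Schauder
   basis e, the values of F off D play no role. *)
Definition holomorphic (f : D -> C) : Prop :=
  exists2 F : X -> C, (forall x : D, f x = F (val x)) &
    forall x : X, D x -> differentiable F x.

Definition bounded_holo : {pred (D -> C)} :=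
  fun f => `[< holomorphic f /\ exists M : C, forall x, `|f x| <= M >].

Lemma bounded_holoP f :
  reflect (holomorphic f /\ exists M : C, forall x, `|f x| <= M)
          (f \in bounded_holo).
Proof. exact: asboolP. Qed.

Lemma bounded_holo_subring : subring_closed bounded_holo.
Proof.
split=> [|f g /bounded_holoP[[F fF dF] [M fM]] /bounded_holoP[[G gG dG] [N gN]]
  |f g /bounded_holoP[[F fF dF] [M fM]] /bounded_holoP[[G gG dG] [N gN]]].
- apply/bounded_holoP; split; last by exists 1 => x; rewrite normr1.
  by exists (cst 1) => // x _; exact: differentiable_cst.
- apply/bounded_holoP; split.
    exists (F - G) => [x|x Dx]; first by rewrite !fctE fF gG.
    by apply: differentiableB; [exact: dF|exact: dG].
  exists (M + N) => x; apply: (le_trans (ler_normB _ _)).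
  exact: lerD.
- apply/bounded_holoP; split.
    exists (F * G) => [x|x Dx]; first by rewrite !fctE fF gG.
    by apply: differentiableM; [exact: dF|exact: dG].
  by exists (M * N) => x; rewrite !fctE normrM ler_pM.
Qed.

Lemma bounded_holo_scale : GRing.scaler_closed bounded_holo.
Proof.
move=> c f /bounded_holoP[[F fF dF] [M fM]].
apply/bounded_holoP; split.
  exists (c *: F) => [x|x Dx]; first by rewrite !fctE fF.
  by apply: differentiableZ; exact: dF.
exists (`|c| * M) => x; rewrite !fctE normrZ.
exact: ler_wpM2l.
Qed.

HB.instance Definition _ := GRing.isSubringClosed.Build (D -> C) bounded_holo
  bounded_holo_subring.
HB.instance Definition _ := GRing.isScaleClosed.Build C (D -> C) bounded_holo
  bounded_holo_scale.

Record Hinf := MkHinf {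
  hinf_fun :> D -> C;
  hinf_subproof : hinf_fun \in bounded_holo }.

HB.instance Definition _ := [isSub for hinf_fun].
HB.instance Definition _ := [Choice of Hinf by <:].
HB.instance Definition _ := 
  GRing.SubChoice_isSubComPzRing.Build _ _ Hinf (subringClosedP _).
HB.instance Definition _ := [SubZmodule_isSubLmodule of Hinf by <:].

Definition sup_norm (f : Hinf) : R :=
  sup [set complex.Re `|f x| | x in [set: D]].

Lemma ReK (a : C) : (complex.Re `|a|)%:C%C = `|a|.
Proof. by apply: RRe_real; exact: normr_real. Qed.

Lemma ler_sup_norm (f : Hinf) x : `|f x| <= (sup_norm f)%:C%C :> C.
Proof.
have /bounded_holoP[_ [M fM]] := hinf_subproof f.
rewrite -ReK lecR; apply: ub_le_sup; last by exists x.
exists (complex.Re M) => _ [y _ <-]; have := fM y.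
by rewrite lecE => /andP[].
Qed.

Lemma sup_norm_le (f : Hinf) (M : C) :
  0 <= M -> (forall x, `|f x| <= M) -> (sup_norm f)%:C%C <= M.
Proof.
move=> M0 fM.
have MR : M = (complex.Re M)%:C%C by rewrite RRe_real // ger0_real.
rewrite MR lecR.
have [Sn0|/set0P/negP/negPn/eqP S0] :=
  pselect ([set complex.Re `|f x| | x in [set: D]] !=set0).
  by apply: ge_sup => // _ [y _ <-]; have := fM y; rewrite lecE => /andP[].
by rewrite /sup_norm S0 sup0 -lecR -MR.
Qed.

Let norm (f : Hinf) : C := (sup_norm f)%:C%C.

Let norm_ge0 f : 0 <= norm f.
Proof.
rewrite /norm lecR.
have [[_ [x _ _]]|/set0P/negP/negPn/eqP S0] :=
  pselect ([set complex.Re `|f x| | x in [set: D]] !=set0).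
  by rewrite -lecR; exact: le_trans (normr_ge0 (f x)) (ler_sup_norm f x).
by rewrite /sup_norm S0 sup0.
Qed.

Let ler_normD f g : norm (f + g) <= norm f + norm g.
Proof.
apply: sup_norm_le => [|x]; first by rewrite addr_ge0.
by apply: (le_trans (ler_normD _ _)); apply: lerD; exact: ler_sup_norm.
Qed.

Let normZ_le (c : C) f : norm (c *: f) <= `|c| * norm f.
Proof.
apply: sup_norm_le => [|x]; first by rewrite mulr_ge0.
by rewrite [leLHS]normrM ler_wpM2l // ler_sup_norm.
Qed.

Let normZ (c : C) f : norm (c *: f) = `|c| * norm f.
Proof.
apply/eqP; rewrite eq_le normZ_le /=.
have [->|c0] := eqVneq c 0; first by rewrite normr0 mul0r.
rewrite -ler_pdivlMl ?normr_gt0 // -normfV.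
by apply: le_trans (normZ_le _ _); rewrite scalerA mulVf // scale1r.
Qed.

Let norm0_eq0 f : norm f = 0 -> f = 0.
Proof.
move=> f0; apply: val_inj; apply/funext => x.
apply/eqP; rewrite -normr_le0 -[leRHS]f0.
exact: ler_sup_norm.
Qed.

(* The norm of Hinf is the supremum norm on the polydisc. *)
HB.instance Definition _ :=
  Lmodule_isNormed.Build C Hinf ler_normD normZ norm0_eq0.

Lemma hinf_normE (f : Hinf) : `|f| = (sup_norm f)%:C%C.
Proof. by []. Qed.

End bounded_holomorphic.

Section sharp_space.
Context {R : realType} {X : normedModType (CC R)} (e : nat -> X).

Local Notation C := (CC R).
Local Notation D := (polydisc e).

(* X^# as a subspace of Hinf: the bounded holomorphic functions on D that are
   restrictions of elements of X^*. *)
Definition sharp : {pred Hinf e} :=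
  fun f => `[< exists xs : dual X, forall x : D, f x = xs (val x) >].

Lemma sharp_submod : GRing.subsemimod_closed sharp.
Proof.
split; first split.
- apply/asboolP.
  have c0 : continuous (\0 : {linear X -> C}) by move=> x; exact: cvg_cst.
  by exists (Dual c0).
- move=> f g /asboolP[u fu] /asboolP[v gv]; apply/asboolP.
  have cuv : continuous ((u : {linear X -> C}) \+ (v : {linear X -> C})
      : {linear X -> C}).
    by move=> x; apply: cvgD; [exact: dual_continuous u x
                              |exact: dual_continuous v x].
  by exists (Dual cuv) => x; rewrite /= -fu -gv.
- move=> c f /asboolP[u fu]; apply/asboolP.
  have cu : continuous (c \*: (u : {linear X -> C}) : {linear X -> C}).
    by move=> x; apply: cvgZr; exact: dual_continuous u x.
  by exists (Dual cu) => x; rewrite /= -fu.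
Qed.

HB.instance Definition _ := GRing.isSubSemiModClosed.Build C (Hinf e) sharp
  sharp_submod.

Record Xsharp := MkXsharp {
  sharp_fun :> Hinf e;
  sharp_subproof : sharp_fun \in sharp }.

HB.instance Definition _ := [isSub for sharp_fun].
HB.instance Definition _ := [Choice of Xsharp by <:].
HB.instance Definition _ := [SubChoice_isSubLmodule of Xsharp by <:].

Let norm (f : Xsharp) : C := `|val f|.

Let ler_normD f g : norm (f + g) <= norm f + norm g.
Proof. exact: ler_normD. Qed.

Let normZ (c : C) f : norm (c *: f) = `|c| * norm f.
Proof. exact: normrZ. Qed.

Let norm0_eq0 f : norm f = 0 -> f = 0.
Proof. by move=> /normr0_eq0 f0; exact: val_inj. Qed.

HB.instance Definition _ :=
  Lmodule_isNormed.Build C Xsharp ler_normD normZ norm0_eq0.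

Let evaluation_fun (x : D) (f : Xsharp) : C := f x.

Let evaluation_linear x : linear (evaluation_fun x).
Proof. by []. Qed.

HB.instance Definition _ x := GRing.isLinear.Build C Xsharp C *:%R
  (evaluation_fun x) (evaluation_linear x).

Let evaluation_continuous x : continuous (evaluation_fun x).
Proof.
apply/linear_bounded_continuous/linear_boundedP.
exists 1; split=> [|r r1 f]; first exact: real1.
have fx : `|f x| <= `|f| by exact: ler_sup_norm.
by apply: (le_trans fx); apply: ler_peMl (ltW r1); exact: normr_ge0.
Qed.

(* The point x of the polydisc seen in (X^#)^*. *)
Definition evaluation (x : D) : dual Xsharp := Dual (@evaluation_continuous x).

End sharp_space.

Section cluster_values.
Context {R : realType} {X : normedModType (CC R)} (e : nat -> X).

Local Notation C := (CC R).
Local Notation D := (polydisc e).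

(* The spectrum M(Hinf): nonzero continuous multiplicative linear functionals. *)
Record spectrum := Character {
  character :> dual (Hinf e);
  characterM : {morph character : f g / f * g};
  character_neq0 : exists f, character f != 0 }.

HB.instance Definition _ := gen_eqMixin spectrum.
HB.instance Definition _ := gen_choiceMixin spectrum.
HB.instance Definition _ :=
  Topological.copy spectrum (initial_topology character).

Definition gelfand (f : Hinf e) (phi : spectrum) : C := phi f.

Let restrict_fun (phi : spectrum) (f : Xsharp e) : C := phi (val f).

Let restrict_linear phi : linear (restrict_fun phi).
Proof. by move=> c f g; rewrite /restrict_fun linearP. Qed.

HB.instance Definition _ phi := GRing.isLinear.Build C (Xsharp e) C *:%R
  (restrict_fun phi) (restrict_linear phi).

Let restrict_continuous phi : continuous (restrict_fun phi).
Proof.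
apply/linear_bounded_continuous/linear_boundedP.
have /linear_bounded_continuous/linear_boundedP phib :=
  @dual_continuous _ _ phi.
by near=> r => f; apply: (near phib r).
Unshelve. all: by end_near. Qed.

(* The projection pi : M(Hinf) -> (X^#)^*. *)
Definition restriction (phi : spectrum) : dual (Xsharp e) :=
  Dual (@restrict_continuous phi).

Definition fiber (z : dual (Xsharp e)) : set spectrum :=
  [set phi | restriction phi = z].

Definition polydisc_closure : set (dual (Xsharp e)) :=
  closure (range (@evaluation _ _ e)).

Definition cluster_set (f : Hinf e) (z : dual (Xsharp e)) : set C :=
  [set l | exists (I : Type) (le : I -> I -> Prop) (x : I -> D),
    [/\ directed le,
        (evaluation (x i) @[i --> tails le]) --> z &
        (f (x i) @[i --> tails le]) --> l]].

End cluster_values.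

Arguments polydisc_closure {R X} e _.

(* Main.v *)
(* One inclusion is soft: along a net in the cluster set, ultralimits of point
   evaluations form a character in the fiber.

   For the other one let phi lie over z and put z_k = phi(x_k), where x_k is the
   k-th coordinate. As X^# is essentially l_1, weak-star convergence to z of points
   of the polydisc D is coordinatewise convergence to (z_k), so it suffices that
   phi(f) <> 0 whenever |f| is bounded below on
   U_n = {x in D : |x_j - z_j| < eps for j < n}. There 1/f is extended to D, one
   coordinate at a time, to a bounded holomorphic G with
   |1 - f G| <= C * sum_(j<n) |x_j - z_j|. If |z_k| < 1, one freezes x_k = z_k. If
   |z_k| = 1, a Moebius map turns the disc of x_k into a half-plane in which the
   part belonging to U_(k+1) contains a sector; Cauchy's formula in the sector
   writes F as a difference of integrals over its two bounding rays, and each of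
   them extends to the rest of the half-plane (this takes the place of solving a
   d-bar problem). Finally the bound on 1 - f G forces phi(1 - f G) = 0:
   coordinates with |z_k| < 1 are removed by dividing by x_k - z_k, those with
   |z_k| = 1 by multiplying by powers of the peak function (1 + x_k / z_k) / 2. *)
From HB Require Import structures.
From mathcomp Require Import all_boot all_order all_algebra.
From mathcomp Require Import all_classical all_reals all_analysis.
From mathcomp Require Import complex ring lra.
Require Import Defs.

Set Implicit Arguments.
Unset Strict Implicit.
Unset Printing Implicit Defensive.

Import Order.TTheory GRing.Theory Num.Theory.
Import numFieldNormedType.Exports.

Local Open Scope classical_set_scope.
Local Open Scope ring_scope.

(** * The norm as a real number *)

(** The delicate point is an extension across one coordinate that stays bounded up to a boundary
    value z_k with |z_k| = 1. In the half-plane picture everything is made invariant under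
    dilations: an integrand along a ray is dominated by a multiple of a / (a^2 + |w|^2), whose
    integral over the ray has a bound free of the scale a. The constants therefore do not depend on
    where x_k lies.

    Integrals are ultralimits of trapezoidal means. A bounded sequence always has an ultralimit, and
    holomorphic functions with a common bound satisfy a Taylor estimate with a common constant, so
    their ultralimit is again holomorphic. This one fact replaces differentiation under the integral
    sign, for the moving pole and for the infinitely many other coordinates alike, and it also
    yields the quotient by x_k - z_k. The Taylor estimate is itself drawn from Cauchy's formula in
    the sector.

    G meets 1/f only where x_j = z_j, a set that may miss D altogether; hence the error is measured
    by the distances |x_j - z_j|, which is exactly the kind of bound that a character over z
    annihilates. *)

Section real_norm.
Context {R : realType}.
Implicit Types V W : normedModType (CC R).

(** The norm over [CC R] is itself a complex number; its real part lives in an ordered field, where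
    linear and polynomial arithmetic applies. *)
Definition nrm V (x : V) : R := complex.Re `|x|.

Lemma nrmE V (x : V) : `|x| = (nrm x)%:C%C :> R[i].
Proof. by rewrite /nrm RRe_real //; exact: normr_real. Qed.

Lemma le_normC V W (x : V) (k : R) (y : W) :
  (`|x| <= (k%:C%C : CC R) * `|y|) = (nrm x <= k * nrm y).
Proof. by rewrite !nrmE -rmorphM; exact: lecR. Qed.

Lemma nrm_ge0 V (x : V) : 0 <= nrm x.
Proof. by have := normr_ge0 x; rewrite nrmE lecR. Qed.

Lemma nrm0 V : nrm (0 : V) = 0.
Proof. by rewrite /nrm normr0. Qed.

Lemma nrm_eq0 V (x : V) : nrm x = 0 -> x = 0.
Proof. by move=> x0; apply: normr0_eq0; rewrite nrmE x0. Qed.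

Lemma nrmN V (x : V) : nrm (- x) = nrm x.
Proof. by rewrite /nrm normrN. Qed.

Lemma nrmD V (x y : V) : nrm (x + y) <= nrm x + nrm y.
Proof. by have := ler_normD x y; rewrite !nrmE -rmorphD lecR. Qed.

Lemma nrmB V (x y : V) : nrm (x - y) <= nrm x + nrm y.
Proof. by rewrite (le_trans (nrmD _ _)) ?nrmN. Qed.

Lemma nrmBC V (x y : V) : nrm (x - y) = nrm (y - x).
Proof. by rewrite -nrmN opprB. Qed.

Lemma nrm_tri V (z x y : V) : nrm (x - y) <= nrm (x - z) + nrm (z - y).
Proof. by rewrite (le_trans _ (nrmD _ _))// addrA subrK. Qed.

Lemma nrm_rev V (x y : V) : nrm x - nrm y <= nrm (x - y).
Proof. by rewrite lerBlDr (le_trans _ (nrmD _ _))// subrK. Qed.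

Lemma nrmZ V (c : CC R) (x : V) : nrm (c *: x) = nrm c * nrm x.
Proof. by rewrite {1}/nrm normrZ !nrmE -rmorphM. Qed.

Lemma nrmM (a b : CC R) : nrm (a * b) = nrm a * nrm b.
Proof. exact: nrmZ. Qed.

Lemma nrm1 : nrm (1 : CC R) = 1.
Proof. by rewrite /nrm normr1. Qed.

Lemma nrmV (a : CC R) : nrm a^-1 = (nrm a)^-1.
Proof. by rewrite {1}/nrm normfV nrmE -fmorphV. Qed.

Lemma nrmX (a : CC R) n : nrm (a ^+ n) = nrm a ^+ n.
Proof.
by elim: n => [|n IH]; [rewrite !expr0 nrm1|rewrite !exprS nrmM IH].
Qed.

Lemma nrmR (a : R) : nrm (a%:C%C : CC R) = `|a|.
Proof. by rewrite /nrm normc_def /= expr0n /= addr0 sqrtr_sqr. Qed.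

Lemma nrm_nat n : nrm (n%:R : CC R) = n%:R.
Proof. by rewrite -[X in nrm X](rmorph_nat (real_complex R)) nrmR ger0_norm. Qed.

Lemma nrm_gt0 V (x : V) : x != 0 -> 0 < nrm x.
Proof.
by move=> x0; rewrite lt_def nrm_ge0 andbT; apply: contra_neq x0 => /nrm_eq0.
Qed.

Lemma nrm_sqr (a : CC R) : nrm a ^+ 2 = complex.Re a ^+ 2 + complex.Im a ^+ 2.
Proof.
rewrite /nrm normc_def /= sqr_sqrtr //.
by rewrite addr_ge0 ?sqr_ge0.
Qed.

Lemma Re_le_nrm (a : CC R) : `|complex.Re a| <= nrm a.
Proof.
rewrite -ler_sqr ?nnegrE ?nrm_ge0// nrm_sqr -normrX ger0_norm ?sqr_ge0//.
by rewrite lerDl sqr_ge0.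
Qed.

Lemma Im_le_nrm (a : CC R) : `|complex.Im a| <= nrm a.
Proof.
rewrite -ler_sqr ?nnegrE ?nrm_ge0// nrm_sqr -normrX ger0_norm ?sqr_ge0//.
by rewrite lerDr sqr_ge0.
Qed.

Lemma nrm_le_ReIm (a : CC R) : nrm a <= `|complex.Re a| + `|complex.Im a|.
Proof.
rewrite -ler_sqr ?nnegrE ?nrm_ge0 ?addr_ge0// nrm_sqr sqrrD !real_normK ?num_real//.
by rewrite -addrA lerD2l lerDr mulrn_wge0 ?mulr_ge0.
Qed.

Lemma posC (e : CC R) : 0 < e -> exists2 d : R, 0 < d & e = d%:C%C.
Proof.
move=> e0; exists (complex.Re e); last by rewrite RRe_real // gtr0_real.
by move: e0; rewrite ltcE => /andP[].
Qed.

Lemma nbhs_nrm V (x : V) (A : set V) :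
  nbhs x A <-> exists2 d : R, 0 < d & forall y, nrm (y - x) < d -> A y.
Proof.
split.
  move=> /nbhs_ballP[e /posC[d d0 ->] dA]; exists d => // y yd; apply: dA.
  by rewrite -ball_normE /= distrC nrmE ltcR.
move=> [d d0 dA]; apply/nbhs_ballP; exists (d%:C%C : CC R); rewrite /= ?ltcR//.
by move=> y; rewrite -ball_normE /= distrC nrmE ltcR; exact: dA.
Qed.

(** The bound on [L] belongs to the criterion: in infinite dimension a linear map need not be
    continuous. *)
Lemma diff_nrmP V W (F : V -> W) (x : V) :
  differentiable F x <-> exists L : {linear V -> W},
    (exists k : R, forall h, nrm (L h) <= k * nrm h) /\
    forall e : R, 0 < e -> exists2 d : R, 0 < d & forall h, nrm h < d ->
      nrm (F (x + h) - F x - L h) <= e * nrm h.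
Proof.
split=> [dF|[L [[k Lk] Lo]]].
  exists ('d F x); split.
    have [k k0 kP] := linear_lipschitz (diff_continuous dF).
    have [k' k'0 kE] := posC k0; exists k' => h.
    by rewrite -le_normC -kE.
  move=> e e0; have /eqaddoP := diff_locally dF.
  move=> /(_ (e%:C%C : CC R)); rewrite ltcR => /(_ e0) /nbhs_nrm[d d0 dP].
  exists d => // h hd; have := dP h; rewrite subr0 => /(_ hd) /=.
  rewrite -le_normC; congr (`|_| <= _); rewrite !fctE /=.
  by rewrite opprD addrA [h + x]addrC.
have Lc : continuous L.
  apply/linear_bounded_continuous/linear_boundedP.
  exists ((Num.max 0 k)%:C%C : CC R); split=> [|r kr h].
    by apply: ger0_real; rewrite lecR le_max lexx.
  have k0 : 0 <= ((Num.max 0 k)%:C%C : CC R) by rewrite lecR le_max lexx.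
  have [r' r'0 rE] := posC (le_lt_trans k0 kr).
  rewrite rE le_normC; apply: (le_trans (Lk h)).
  rewrite ler_wpM2r ?nrm_ge0//; move: kr; rewrite rE ltcR.
  by rewrite gt_max => /andP[_ /ltW].
have Le : F \o shift x = cst (F x) + (L : V -> W) +o_ (0 : V) id.
  apply/eqaddoP => e e0; have [e' e'0 eE] := posC e0.
  have [d d0 dP] := Lo e' e'0; apply/nbhs_nrm; exists d => // h.
  rewrite subr0 => /dP; rewrite -le_normC -eE; congr (`|_| <= _).
  by rewrite !fctE /= opprD addrA [h + x]addrC.
by apply/diff_locallyP; rewrite (diff_unique Lc Le).
Qed.

End real_norm.

(** * Ultralimits and integration along segments *)

Section ultralimits.
Context {R : realType}.
Local Notation C := (CC R).

Lemma cont_nrmP {V W : normedModType C} (F : V -> W) x :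
  {for x, continuous F} <-> forall e : R, 0 < e -> exists2 d : R, 0 < d &
    forall y, nrm (y - x) < d -> nrm (F y - F x) < e.
Proof.
split=> [Fx e e0|H A /nbhs_nrm[e e0 eA]].
  have /Fx/nbhs_nrm[d d0 dP] : nbhs (F x) [set y | nrm (y - F x) < e].
    by apply/nbhs_nrm; exists e.
  by exists d.
have [d d0 dP] := H e e0; apply/nbhs_nrm; exists d => // y yd.
by apply: eA; exact: dP.
Qed.

(** The default value 0 is taken when no limit exists; for bounded [u] it never is. *)
Definition ulim {I : Type} (U : set_system I) (u : I -> C) : C :=
  xget 0 [set l | forall e : R, 0 < e -> U [set i | nrm (u i - l) < e]].

Section ulim_theory.
Context {I : Type} (U : set_system I) {UU : UltraFilter U}.

(** The limit is the supremum of the levels that [r] reaches on a set of [U]. A level above it is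
    not reached on such a set, so by the ultrafilter property [r] stays below it on one. *)
Lemma ultra_bounded_cvg (r : I -> R) (M : R) : (forall i, `|r i| <= M) ->
  exists l, forall e, 0 < e -> U [set i | `|r i - l| < e].
Proof.
move=> rM; pose S := [set a | U [set i | a <= r i]].
have SM : S (- M).
  by apply: filterE => i /=; have := rM i; rewrite ler_norml => /andP[].
have Sub : has_ubound S.
  exists M => a Sa; have [i /= ai] := filter_ex Sa; rewrite (le_trans ai)//.
  by rewrite (le_trans (ler_norm _)).
have Ssup : has_sup S by split=> //; exists (- M).
exists (sup S) => e e0.
have [a Sa aS] := sup_adherent e0 Ssup.
have nS : ~ S (sup S + e).
  by move=> Se; have := ub_le_sup Sub Se; lra.
have [//|Un] := @in_ultra_setVsetC _ U [set i | sup S + e <= r i] UU.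
apply: filterS (filterI Sa Un) => i [/= ai /negP]; rewrite -ltNge => si.
rewrite ltr_norml; apply/andP; split; lra.
Qed.

Lemma ulimP (u : I -> C) (M : R) : (forall i, nrm (u i) <= M) ->
  forall e : R, 0 < e -> U [set i | nrm (u i - ulim U u) < e].
Proof.
move=> uM.
have [a aP] : exists l, forall e, 0 < e -> U [set i | `|complex.Re (u i) - l| < e].
  apply: (@ultra_bounded_cvg _ M) => i.
  exact: le_trans (Re_le_nrm _) (uM i).
have [b bP] : exists l, forall e, 0 < e -> U [set i | `|complex.Im (u i) - l| < e].
  apply: (@ultra_bounded_cvg _ M) => i.
  exact: le_trans (Im_le_nrm _) (uM i).
rewrite /ulim; case: xgetP => [l _ //|/(_ (Complex a b)) []] e e0.
have e2 : 0 < e / 2 by rewrite divr_gt0.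
apply: filterS (filterI (aP _ e2) (bP _ e2)) => i [/= ai bi].
rewrite (le_lt_trans (nrm_le_ReIm _))//.
have -> : complex.Re (u i - Complex a b) = complex.Re (u i) - a.
  by case: (u i).
have -> : complex.Im (u i - Complex a b) = complex.Im (u i) - b.
  by case: (u i).
lra.
Qed.

Lemma ulim_unique (u : I -> C) (l : C) :
  (forall e : R, 0 < e -> U [set i | nrm (u i - l) < e]) -> ulim U u = l.
Proof.
move=> ul; rewrite /ulim; case: xgetP => [l' _ l'P|/(_ l)//].
apply/eqP; rewrite -subr_eq0; apply/eqP/nrm_eq0/eqP.
rewrite eq_le nrm_ge0 andbT; apply/ler_addgt0Pl => e e0; rewrite addr0.
have e2 : 0 < e / 2 by rewrite divr_gt0.
have [i [/= il il']] := filter_ex (filterI (ul _ e2) (l'P _ e2)).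
have := nrm_tri (u i) l' l; rewrite (nrmBC l' (u i)); lra.
Qed.

Lemma ulim_le (u : I -> C) (M B : R) (l : C) : (forall i, nrm (u i) <= M) ->
  U [set i | nrm (u i - l) <= B] -> nrm (ulim U u - l) <= B.
Proof.
move=> uM uB; apply/ler_addgt0Pl => e e0.
have [i [/= il il']] := filter_ex (filterI (ulimP uM e0) uB).
have := nrm_tri (u i) (ulim U u) l; rewrite (nrmBC (ulim U u) (u i)); lra.
Qed.

Lemma ulim_nrm (u : I -> C) (M : R) : (forall i, nrm (u i) <= M) ->
  nrm (ulim U u) <= M.
Proof.
move=> uM; rewrite -[ulim U u]subr0; apply: (ulim_le uM).
by apply: filterE => i /=; rewrite subr0.
Qed.

Lemma ulimL (a : C) (u v : I -> C) (M N : R) : (forall i, nrm (u i) <= M) ->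
  (forall i, nrm (v i) <= N) ->
  ulim U (fun i => a * u i + v i) = a * ulim U u + ulim U v.
Proof.
move=> uM vN; apply: ulim_unique => e e0.
have a1 : 0 < 2 * (nrm a + 1) by have := nrm_ge0 a; lra.
have e1 : 0 < e / (2 * (nrm a + 1)) by rewrite divr_gt0.
have e2 : 0 < e / 2 by rewrite divr_gt0.
apply: filterS (filterI (ulimP uM e1) (ulimP vN e2)) => i [/= ui vi].
rewrite (_ : _ - _ = a * (u i - ulim U u) + (v i - ulim U v)); last by ring.
rewrite (le_lt_trans (nrmD _ _))// nrmM.
have := nrm_ge0 a; have := nrm_ge0 (u i - ulim U u).
move: ui; rewrite ltr_pdivlMr//; nra.
Qed.

Lemma ulim_cst (a : C) : ulim U (fun=> a) = a.
Proof.
by apply: ulim_unique => e e0; apply: filterE => i /=; rewrite subrr nrm0.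
Qed.

Lemma ulimZ (a : C) (u : I -> C) (M : R) : (forall i, nrm (u i) <= M) ->
  ulim U (fun i => a * u i) = a * ulim U u.
Proof.
move=> uM; have := ulimL a uM (fun i => lexx (nrm (0 : C))).
by rewrite ulim_cst addr0 => <-; congr ulim; apply/funext => i; rewrite addr0.
Qed.

Lemma ulimM (u v : I -> C) (M N : R) : (forall i, nrm (u i) <= M) ->
  (forall i, nrm (v i) <= N) ->
  ulim U (fun i => u i * v i) = ulim U u * ulim U v.
Proof.
move=> uM vN; apply: ulim_unique => e e0.
have M0 : 0 <= nrm (ulim U u) by exact: nrm_ge0.
have N0 : 0 <= Num.max N 0 by rewrite le_max lexx orbT.
have u1 : 0 < 2 * (Num.max N 0 + 1) by lra.
have v1 : 0 < 2 * (nrm (ulim U u) + 1) by lra.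
apply: filterS (filterI (ulimP uM (divr_gt0 e0 u1))
  (ulimP vN (divr_gt0 e0 v1))) => i [/= ui vi].
rewrite (_ : _ - _ = (u i - ulim U u) * v i + ulim U u * (v i - ulim U v));
  last by ring.
rewrite (le_lt_trans (nrmD _ _))// !nrmM.
have vN' : nrm (v i) <= Num.max N 0 by rewrite le_max vN.
have := nrm_ge0 (u i - ulim U u); have := nrm_ge0 (v i - ulim U v).
have := nrm_ge0 (v i).
move: ui vi; rewrite !ltr_pdivlMr//; nra.
Qed.

Lemma ulim_eq (u v : I -> C) (N : R) : (forall i, nrm (v i) <= N) ->
  (forall e : R, 0 < e -> U [set i | nrm (u i - v i) < e]) ->
  ulim U u = ulim U v.
Proof.
move=> vN uv; apply: ulim_unique => e e0.
have e2 : 0 < e / 2 by rewrite divr_gt0.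
apply: filterS (filterI (uv _ e2) (ulimP vN e2)) => i [/= uvi vi].
have := nrm_tri (v i) (u i) (ulim U v); lra.
Qed.

Lemma ulim_Re_le (u : I -> C) (M b : R) : (forall i, nrm (u i) <= M) ->
  U [set i | complex.Re (u i) <= b] -> complex.Re (ulim U u) <= b.
Proof.
move=> uM ub; apply/ler_addgt0Pl => e e0.
have [i /= [il]] := filter_ex (filterI (ulimP uM e0) ub).
have := Re_le_nrm (u i - ulim U u).
have -> : complex.Re (u i - ulim U u) = complex.Re (u i) - complex.Re (ulim U u).
  by case: (u i); case: (ulim U u).
by rewrite ler_norml => /andP[? ?] ?; lra.
Qed.

End ulim_theory.

(** A fixed ultrafilter finer than [\oo], along which all limits of sequences are taken. *)
Definition Uoo : set_system nat :=
  sval (cid (ultraFilterLemma (F := \oo) eventually_filter)).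

Global Instance Uoo_ultra : UltraFilter Uoo.
Proof. by rewrite /Uoo; case: cid => U []. Qed.

Lemma Uoo_ge (N : nat) (A : set nat) : (forall n, (N <= n)%N -> A n) -> Uoo A.
Proof.
move=> NA; rewrite /Uoo; case: cid => U /= [_ sU]; apply: sU.
by exists N => // n /= /NA.
Qed.

(* The limit c is taken along an ultrafilter, so no completeness is needed. *)
Lemma bisection (T : Type) (bad : T -> Prop) (sz : T -> R) (pt : T -> C) :
  (forall t, 0 <= sz t) ->
  (forall t, bad t -> exists t', [/\ bad t', sz t' <= sz t / 2 &
     nrm (pt t' - pt t) <= sz t]) ->
  forall t0, bad t0 -> exists c, forall d : R, 0 < d ->
    exists t, [/\ bad t, sz t < d & nrm (pt t - c) <= 2 * sz t].
Proof.
move=> sz0 step t0 bad0.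
have [f fP] : {f : {t | bad t} -> {t | bad t} & forall t,
    sz (sval (f t)) <= sz (sval t) / 2 /\
    nrm (pt (sval (f t)) - pt (sval t)) <= sz (sval t)}.
  apply: (@choice _ _ (fun t t' : {t | bad t} => sz (sval t') <= sz (sval t) / 2
    /\ nrm (pt (sval t') - pt (sval t)) <= sz (sval t))) => -[t bt].
  by have [t' [bt' st' pt']] := step _ bt; exists (exist _ t' bt').
pose t n := sval (iter n f (exist _ t0 bad0)).
have bt n : bad (t n) by rewrite /t; case: (iter _ _ _).
have tS n : sz (t n.+1) <= sz (t n) / 2 by rewrite /t /=; exact: (fP _).1.
have pS n : nrm (pt (t n.+1) - pt (t n)) <= sz (t n).
  by rewrite /t /=; exact: (fP _).2.
(* Subtracting the remaining [2 * sz] closes the induction: a step moves [pt] by at most [sz], and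
   halving [sz] releases that amount. *)
have ptk n k : nrm (pt (t (n + k)%N) - pt (t n)) <= 2 * sz (t n) - 2 * sz (t (n + k)%N).
  elim: k => [|k IH]; first by rewrite addn0 !subrr nrm0.
  rewrite addnS; have := nrm_tri (pt (t (n + k)%N)) (pt (t (n + k).+1)) (pt (t n)).
  have := tS (n + k)%N; have := pS (n + k)%N; lra.
have tb n : nrm (pt (t n)) <= nrm (pt (t 0%N)) + 2 * sz (t 0%N).
  have := ptk 0%N n; rewrite add0n; have := nrm_rev (pt (t n)) (pt (t 0%N)).
  have := sz0 (t n); lra.
exists (ulim Uoo (pt \o t)) => d d0.
have sn n : sz (t n) * 2 ^+ n <= sz (t 0%N).
  elim: n => [|n IH]; first by rewrite expr0 mulr1.
  apply: le_trans IH; rewrite exprS mulrA ler_wpM2r ?exprn_ge0//.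
  by rewrite -ler_pdivlMr.
have [n nP] : exists n, sz (t n) < d.
  exists (Num.truncn (sz (t 0%N) / d)).+1; set n := _.+1.
  have nd : sz (t 0%N) / d < n%:R by rewrite /n truncnS_gt.
  rewrite -(ltr_pM2r (exprn_gt0 n (ltr0n R 2))) (le_lt_trans (sn n))//.
  move: nd; rewrite ltr_pdivrMr// => /lt_le_trans; apply; rewrite mulrC.
  by rewrite ler_pM2l// -natrX ler_nat ltnW// ltn_expl.
exists (t n); split=> //; rewrite nrmBC.
apply: (ulim_le tb); apply: (@Uoo_ge n) => m nm /=.
have := ptk n (m - n)%N; rewrite subnKC//; have := sz0 (t m); lra.
Qed.

End ultralimits.

(** * Averages and integrals over segments *)

Section dyadic_integral.
Context {R : realType}.
Local Notation C := (CC R).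
Implicit Types (g h : C -> C) (p q r w : C) (K : set C).

Definition mid p q : C := (p + q) / 2.

(** Midpoints suffice, since a segment is sampled only at its dyadic points. *)
Definition midconvex K := forall p q, K p -> K q -> K (mid p q).

(** Closedness in the form that keeps the limit point of a bisection inside [K]. *)
Definition seqclosed K :=
  forall c, (forall d : R, 0 < d -> exists2 w, K w & nrm (w - c) < d) -> K c.

Lemma midC p q : mid p q = mid q p.
Proof. by rewrite /mid addrC. Qed.

Lemma midconvexI K L : midconvex K -> midconvex L -> midconvex (K `&` L).
Proof. by move=> Kc Lc p q [Kp Lp] [Kq Lq]; split; [exact: Kc|exact: Lc]. Qed.

Lemma seqclosedI K L : seqclosed K -> seqclosed L -> seqclosed (K `&` L).
Proof.
move=> Kc Lc c cP; split; [apply: Kc|apply: Lc] => d d0;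
by have [w [Kw Lw]] := cP d d0; exists w.
Qed.

Lemma mid_ball c (d : R) : midconvex [set w | nrm (w - c) <= d].
Proof.
move=> p q /= pd qd.
rewrite (_ : _ - _ = 2^-1 * (p - c) + 2^-1 * (q - c)); last by rewrite /mid; field.
rewrite (le_trans (nrmD _ _))// !nrmM nrmV nrm_nat; lra.
Qed.

Lemma nrm_midl p q : nrm (mid p q - p) = nrm (q - p) / 2.
Proof.
rewrite (_ : mid p q - p = 2^-1 * (q - p)); last by rewrite /mid; field.
by rewrite nrmM nrmV nrm_nat mulrC.
Qed.

Lemma nrm_midr p q : nrm (q - mid p q) = nrm (q - p) / 2.
Proof. by rewrite nrmBC midC nrm_midl nrmBC. Qed.

(** The trapezoidal rule on [2 ^ n] equal pieces, normalised to an average; the recursion follows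
    the halving of the segment. *)
Fixpoint mean n g p q : C := if n is n'.+1 then
  mid (mean n' g p (mid p q)) (mean n' g (mid p q) q) else mid (g p) (g q).

Lemma mean_bound K n g p q c (B : R) : midconvex K -> K p -> K q ->
  (forall w, K w -> nrm (g w - c) <= B) -> nrm (mean n g p q - c) <= B.
Proof.
move=> Kc Kp Kq gB; elim: n p q Kp Kq => [|n IH] p q Kp Kq /=;
apply: mid_ball => /=; do ?exact: gB; apply: IH => //; exact: Kc.
Qed.

Lemma mean_sym n g p q : mean n g p q = mean n g q p.
Proof.
elim: n p q => [|n IH] p q /=; first by rewrite midC.
by rewrite midC (IH p) (IH _ q) (midC p).
Qed.

Lemma meanL n (a : C) g h p q : mean n (fun w => a * g w + h w) p q =
  a * mean n g p q + mean n h p q.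
Proof.
by elim: n p q => [|n IH] p q /=; rewrite ?IH /mid; field.
Qed.

Lemma mean_affine n (a b : C) p q : mean n (fun w => a + b * w) p q = a + b * mid p q.
Proof.
by elim: n p q => [|n IH] p q /=; rewrite ?IH /mid; field.
Qed.

Lemma mean_scale n g (c : C) p q : mean n g (c * p) (c * q) = mean n (fun w => g (c * w)) p q.
Proof.
elim: n p q => [|n IH] p q //=.
by rewrite (_ : mid (c * p) (c * q) = c * mid p q) ?IH// /mid; field.
Qed.

Lemma eq_mean K n g h p q : midconvex K -> K p -> K q ->
  (forall w, K w -> g w = h w) -> mean n g p q = mean n h p q.
Proof.
move=> Kc Kp Kq gh; elim: n p q Kp Kq => [|n IH] p q Kp Kq /=;
by rewrite ?gh// !IH//; exact: Kc.
Qed.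

Lemma Re_mid p q : complex.Re (mid p q) = (complex.Re p + complex.Re q) / 2.
Proof.
have -> : mid p q = ((2^-1 : R)%:C%C : C) * (p + q).
  by rewrite /mid mulrC fmorphV rmorph_nat.
by case: p => a b; case: q => c d /=; field.
Qed.

Lemma Im_mid p q : complex.Im (mid p q) = (complex.Im p + complex.Im q) / 2.
Proof.
have -> : mid p q = ((2^-1 : R)%:C%C : C) * (p + q).
  by rewrite /mid mulrC fmorphV rmorph_nat.
by case: p => a b; case: q => c d /=; field.
Qed.

Lemma mean_Re_le K n g p q (b : R) : midconvex K -> K p -> K q ->
  (forall w, K w -> complex.Re (g w) <= b) -> complex.Re (mean n g p q) <= b.
Proof.
move=> Kc Kp Kq gb; elim: n p q Kp Kq => [|n IH] p q Kp Kq /=; rewrite Re_mid.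
  by have := gb _ Kp; have := gb _ Kq; lra.
have := IH _ _ Kp (Kc _ _ Kp Kq); have := IH _ _ (Kc _ _ Kp Kq) Kq; lra.
Qed.

(* The ultralimit of the trapezoidal means exists for every g with bounded means;
   for continuous g it is the average over the segment [p, q]. *)
Definition av g p q := ulim Uoo (fun n => mean n g p q).

Definition int g p q := (q - p) * av g p q.

Definition bdd_means g p q := exists M : R, forall n, nrm (mean n g p q) <= M.

(** Compactness of a segment in bisection form: if [P] failed, halving would give failing segments
    shrinking to a point [c] of [K], near which [P] holds. *)
Lemma segment_induction K (P : C -> C -> Prop) : midconvex K -> seqclosed K ->
  (forall p q, P p (mid p q) -> P (mid p q) q -> P p q) ->
  (forall c, K c -> exists2 d : R, 0 < d & forall p q,
    nrm (p - c) < d -> nrm (q - c) < d -> P p q) ->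
  forall p q, K p -> K q -> P p q.
Proof.
move=> Kc Kcl Pmid Ploc p q Kp Kq; apply: contrapT => nP.
pose bad (t : C * C) := [/\ K t.1, K t.2 & ~ P t.1 t.2].
have [||c cP] := @bisection R _ bad (fun t => nrm (t.2 - t.1)) fst _ _ (p, q) (And3 Kp Kq nP).
- by move=> t; exact: nrm_ge0.
- move=> [a b] [/= Ka Kb nab].
  have [Pl|nPl] := pselect (P a (mid a b)); last first.
    by exists (a, mid a b); split=> /=;
      [split=> //; exact: Kc|rewrite nrm_midl|rewrite subrr nrm0 nrm_ge0].
  exists (mid a b, b); split=> /=.
  - by split=> //; [exact: Kc|move=> Pr; exact: nab (Pmid _ _ Pl Pr)].
  - by rewrite nrm_midr.
  - rewrite nrm_midl; have := nrm_ge0 (b - a); lra.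
have Kc0 : K c.
  apply: Kcl => d d0; have d4 : 0 < d / 2 by lra.
  have [[a b] [[/= Ka Kb _] /= sd ac]] := cP _ d4; exists a => //; lra.
have [d d0 dP] := Ploc c Kc0; have d4 : 0 < d / 3 by lra.
have [[a b] [[/= Ka Kb nab] /= sd ac]] := cP _ d4; apply: nab; apply: dP.
  by have := nrm_ge0 (b - a); lra.
have := nrm_tri a b c; have := nrm_ge0 (b - a); lra.
Qed.

Lemma cont_bdd_means K g p q : midconvex K -> seqclosed K ->
  (forall w, K w -> {for w, continuous g}) -> K p -> K q -> bdd_means g p q.
Proof.
move=> Kc Kcl gc; move: p q; apply: (segment_induction Kc Kcl) => [p q [M MP] [N NP]|c Kcc].
  exists (Num.max (nrm (mean 0 g p q)) (Num.max M N)) => -[|n] /=.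
    by rewrite le_max lexx.
  rewrite le_max; apply/orP; right; rewrite -[mid (mean _ _ _ _) _]subr0.
  by apply: mid_ball; rewrite /= subr0 le_max ?MP ?NP ?orbT.
have [d d0 dP] := (cont_nrmP g c).1 (gc c Kcc) 1 ltr01.
exists (d / 2) => [|a b ad bd]; first by lra.
exists (1 + nrm (g c)) => n.
have := nrm_rev (mean n g a b) (g c).
suff : nrm (mean n g a b - g c) <= 1 by lra.
have dP' w : nrm (w - c) <= d / 2 -> nrm (g w - g c) <= 1.
  by move=> wd; apply/ltW/dP; lra.
exact: (mean_bound n (@mid_ball c (d / 2)) (ltW ad) (ltW bd) dP').
Qed.

(** The recursion of [mean] gives this identity for means of level [n.+1]. An ultralimit is not
    invariant under a shift of the index, so consecutive means are shown to approach each other, by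
    segment induction from the continuity of [g]. *)
Lemma int_split K g p q : midconvex K -> seqclosed K ->
  (forall w, K w -> {for w, continuous g}) -> K p -> K q ->
  int g p q = int g p (mid p q) + int g (mid p q) q.
Proof.
move=> Kc Kcl gc Kp Kq; have Km := Kc _ _ Kp Kq.
have [M MP] := cont_bdd_means Kc Kcl gc Kp Kq.
have [M1 MP1] := cont_bdd_means Kc Kcl gc Kp Km.
have [M2 MP2] := cont_bdd_means Kc Kcl gc Km Kq.
suff E : av g p q = mid (av g p (mid p q)) (av g (mid p q) q).
  by rewrite /int E /mid; field.
transitivity (ulim Uoo (fun n => mean n.+1 g p q)); last first.
  have -> : (fun n => mean n.+1 g p q) = (fun n => 2^-1 * mean n g p (mid p q)
      + (fun n => 2^-1 * mean n g (mid p q) q) n).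
    by apply/funext => n /=; rewrite /mid; field.
  rewrite (@ulimL _ _ _ _ _ _ _ M1 (nrm (2^-1 : C) * M2))//.
    by rewrite (ulimZ _ MP2) /mid /av; field.
  by move=> n; rewrite nrmM ler_wpM2l ?nrm_ge0.
apply: (ulim_eq (N := M)) => // e e0.
suff [N NP] : exists N, forall n, (N <= n)%N ->
    nrm (mean n.+1 g p q - mean n g p q) <= e / 2.
  apply: (@Uoo_ge N) => n /NP /=; rewrite nrmBC; lra.
move: p q Kp Kq {Km M MP M1 MP1 M2 MP2}.
apply: (segment_induction Kc Kcl) => [p q [N1 N1P] [N2 N2P]|c Kcc].
  exists (maxn N1 N2).+1 => -[//|n].
  rewrite ltnS geq_max => /andP[n1 n2] /=.
  have := N1P n n1; have := N2P n n2 => /=.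
  set a := mid (mean n g (mid p q) _) _; set b := mid (mean n g p _) _ => ba bb.
  set a' := mean n g p _ in bb *; set b' := mean n g _ q in ba *.
  rewrite (_ : _ - _ = 2^-1 * (b - a') + 2^-1 * (a - b')); last first.
    by rewrite /mid; field.
  rewrite (le_trans (nrmD _ _))// !nrmM nrmV nrm_nat; lra.
have e4 : 0 < e / 4 by lra.
have [d d0 dP] := (cont_nrmP g c).1 (gc c Kcc) _ e4.
exists (d / 2) => [|a b ad bd]; first by lra.
exists 0%N => n _.
have dP' w : nrm (w - c) <= d / 2 -> nrm (g w - g c) <= e / 4.
  by move=> wd; apply/ltW/dP; lra.
have mn k : nrm (mean k g a b - g c) <= e / 4.
  exact: (mean_bound k (@mid_ball c (d / 2)) (ltW ad) (ltW bd) dP').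
have := mn n; have := mn n.+1.
have := nrm_tri (g c) (mean n.+1 g a b) (mean n g a b); rewrite (nrmBC (g c)); lra.
Qed.

End dyadic_integral.

(** * Goursat's theorem *)

Section goursat.
Context {R : realType}.
Local Notation C := (CC R).
Implicit Types (g h : C -> C) (p q r w : C) (K : set C).

Lemma int_sym g p q : int g q p = - int g p q.
Proof.
rewrite /int /av (_ : (fun n => mean n g q p) = (fun n => mean n g p q)).
  by ring.
by apply/funext => n; rewrite mean_sym.
Qed.

Lemma int_bound K g p q (B : R) : midconvex K -> K p -> K q ->
  (forall w, K w -> nrm (g w) <= B) -> nrm (int g p q) <= nrm (q - p) * B.
Proof.
move=> Kc Kp Kq gB; rewrite nrmM ler_wpM2l ?nrm_ge0//.
apply: ulim_nrm => n; rewrite -[mean _ _ _ _]subr0.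
by apply: (mean_bound n Kc Kp Kq) => w Kw; rewrite subr0 gB.
Qed.

Lemma intL (a : C) g h p q : bdd_means g p q -> bdd_means h p q ->
  int (fun w => a * g w + h w) p q = a * int g p q + int h p q.
Proof.
move=> [M gM] [N hN]; rewrite /int /av.
rewrite (_ : (fun n => _) = (fun n => a * mean n g p q + mean n h p q)).
  by rewrite (ulimL _ gM hN); ring.
by apply/funext => n; rewrite meanL.
Qed.

Lemma int_affine (a b : C) p q : int (fun w => a + b * w) p q = (q - p) * (a + b * mid p q).
Proof.
rewrite /int /av (_ : (fun n => _) = fun=> a + b * mid p q) ?ulim_cst//.
by apply/funext => n; rewrite mean_affine.
Qed.

Lemma int_scale g (c : C) p q :
  int g (c * p) (c * q) = c * int (fun w => g (c * w)) p q.
Proof.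
rewrite /int /av mulrA -mulrBr; congr (_ * ulim Uoo _).
by apply/funext => n; rewrite mean_scale.
Qed.

Lemma eq_int K g h p q : midconvex K -> K p -> K q ->
  (forall w, K w -> g w = h w) -> int g p q = int h p q.
Proof.
move=> Kc Kp Kq gh; rewrite /int /av; congr (_ * ulim Uoo _).
by apply/funext => n; exact: (eq_mean n Kc Kp Kq).
Qed.

Lemma bdd_means_affine (a b : C) p q : bdd_means (fun w => a + b * w) p q.
Proof. by exists (nrm (a + b * mid p q)) => n; rewrite mean_affine. Qed.

Definition tri g p q r := int g p q + int g q r + int g r p.

Definition perim p q r := nrm (q - p) + nrm (r - q) + nrm (p - r).

Lemma perim_ge0 p q r : 0 <= perim p q r.
Proof. by rewrite !addr_ge0 ?nrm_ge0. Qed.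

Lemma tri_split K g p q r : midconvex K -> seqclosed K ->
  (forall w, K w -> {for w, continuous g}) -> K p -> K q -> K r ->
  tri g p q r = tri g p (mid p q) (mid r p) + tri g (mid p q) q (mid q r) +
    tri g (mid r p) (mid q r) r + tri g (mid p q) (mid q r) (mid r p).
Proof.
move=> Kc Kcl gc Kp Kq Kr; rewrite /tri.
rewrite (int_split Kc Kcl gc Kp Kq) (int_split Kc Kcl gc Kq Kr).
rewrite (int_split Kc Kcl gc Kr Kp).
rewrite (int_sym g (mid p q) (mid r p)) (int_sym g (mid p q) (mid q r)).
by rewrite (int_sym g (mid r p) (mid q r)); ring.
Qed.

Lemma perim_half p q r : 
  [/\ perim p (mid p q) (mid r p) = perim p q r / 2,
      perim (mid p q) q (mid q r) = perim p q r / 2,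
      perim (mid r p) (mid q r) r = perim p q r / 2 &
      perim (mid p q) (mid q r) (mid r p) = perim p q r / 2].
Proof.
have H a b : nrm (2^-1 * (a - b) : C) = nrm (a - b) / 2.
  by rewrite nrmM nrmV nrm_nat mulrC.
have E1 : mid p q - p = 2^-1 * (q - p) by rewrite /mid; field.
have E2 : q - mid p q = 2^-1 * (q - p) by rewrite /mid; field.
have E3 : mid r p - mid p q = 2^-1 * (r - q) by rewrite /mid; field.
have E4 : p - mid r p = 2^-1 * (p - r) by rewrite /mid; field.
have E5 : mid q r - q = 2^-1 * (r - q) by rewrite /mid; field.
have E6 : mid p q - mid q r = 2^-1 * (p - r) by rewrite /mid; field.
have E7 : mid q r - mid r p = 2^-1 * (q - p) by rewrite /mid; field.
have E8 : r - mid q r = 2^-1 * (r - q) by rewrite /mid; field.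
have E9 : mid r p - r = 2^-1 * (p - r) by rewrite /mid; field.
have E10 : mid q r - mid p q = 2^-1 * (r - p) by rewrite /mid; field.
have E11 : mid r p - mid q r = 2^-1 * (p - q) by rewrite /mid; field.
have E12 : mid p q - mid r p = 2^-1 * (q - r) by rewrite /mid; field.
split; rewrite /perim ?E1 ?E2 ?E3 ?E4 ?E5 ?E6 ?E7 ?E8 ?E9 ?E10 ?E11 ?E12 !H
  ?(nrmBC p q) ?(nrmBC r p) ?(nrmBC q r); lra.
Qed.

Lemma tri_bound K g p q r (B : R) : midconvex K -> K p -> K q -> K r ->
  (forall w, K w -> nrm (g w) <= B) -> nrm (tri g p q r) <= perim p q r * B.
Proof.
move=> Kc Kp Kq Kr gB; rewrite /tri /perim.
have := int_bound Kc Kp Kq gB; have := int_bound Kc Kq Kr gB.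
have := int_bound Kc Kr Kp gB.
have := nrmD (int g p q + int g q r) (int g r p).
have := nrmD (int g p q) (int g q r); lra.
Qed.

Lemma diff_C g w : differentiable g w -> exists a : C,
  forall e : R, 0 < e -> exists2 d : R, 0 < d & forall v, nrm (v - w) < d ->
    nrm (g v - (g w + a * (v - w))) <= e * nrm (v - w).
Proof.
move=> /diff_nrmP[L [_ Lo]]; exists (L 1) => e e0; have [d d0 dP] := Lo e e0.
exists d => // v vd; have := dP _ vd; rewrite [w + _]addrC subrK.
have -> : L (v - w) = L 1 * (v - w).
  have LZ : L ((v - w) *: (1 : C)) = (v - w) *: L 1 by rewrite linearZ.
  by move: LZ; rewrite /GRing.scale /= mulr1 mulrC.
by rewrite opprD addrA.
Qed.

Lemma goursat K g p q r : midconvex K -> seqclosed K ->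
  (forall w, K w -> differentiable g w) -> K p -> K q -> K r ->
  tri g p q r = 0.
Proof.
move=> Kc Kcl gd Kp Kq Kr.
have gc w : K w -> {for w, continuous g}.
  by move=> /gd /differentiable_continuous.
apply/nrm_eq0/eqP; rewrite eq_le nrm_ge0 andbT leNgt; apply/negP => T0.
have P1 : 0 < perim p q r ^+ 2 + 1 by have := sqr_ge0 (perim p q r); lra.
(* The constant makes [e] times the squared perimeter smaller than the integral, and quartering
   preserves this; the summand 1 allows a perimeter 0. *)
have e0 : 0 < nrm (tri g p q r) / (perim p q r ^+ 2 + 1) by rewrite divr_gt0.
set e := _ / _ in e0.
pose pe (t : C * C * C) := perim t.1.1 t.1.2 t.2.
pose bad (t : C * C * C) := [/\ K t.1.1, K t.1.2, K t.2 &
  e * pe t ^+ 2 < nrm (tri g t.1.1 t.1.2 t.2)].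
have bad0 : bad (p, q, r).
  split=> //=; rewrite /pe /= /e mulrAC ltr_pdivrMr//; nra.
have [||c cP] := @bisection R _ bad pe (fun t => t.1.1) _ _ _ bad0.
- by move=> t; exact: perim_ge0.
- move=> [[a b] c] [/= Ka Kb Kd]; rewrite /pe /= => abc.
  have [P2 P3 P4 P5] := perim_half a b c.
  have Kab := Kc _ _ Ka Kb; have Kbc := Kc _ _ Kb Kd; have Kca := Kc _ _ Kd Ka.
  apply: contrapT => nex.
  have nb t : K t.1.1 -> K t.1.2 -> K t.2 -> pe t = perim a b c / 2 ->
      nrm (t.1.1 - a) <= perim a b c ->
      nrm (tri g t.1.1 t.1.2 t.2) <= e * (perim a b c / 2) ^+ 2.
    move=> K1 K2 K3 pt ta; rewrite leNgt; apply/negP => tl; apply: nex.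
    exists t; split=> //; first by split=> //; rewrite pt.
    by rewrite -/(pe t) pt.
  have sa : nrm (mid a b - a) <= perim a b c.
    rewrite nrm_midl /perim; have := nrm_ge0 (b - a); have := nrm_ge0 (c - b).
    by have := nrm_ge0 (a - c); lra.
  have sc : nrm (mid c a - a) <= perim a b c.
    rewrite nrmBC nrm_midr /perim; have := nrm_ge0 (b - a).
    by have := nrm_ge0 (c - b); have := nrm_ge0 (a - c); lra.
  have n1 := nb (a, mid a b, mid c a) Ka Kab Kca P2.
  have n2 := nb (mid a b, b, mid b c) Kab Kb Kbc P3 sa.
  have n3 := nb (mid c a, mid b c, c) Kca Kbc Kd P4 sc.
  have n4 := nb (mid a b, mid b c, mid c a) Kab Kbc Kca P5 sa.
  rewrite /= subrr nrm0 perim_ge0 in n1; have {n1}n1 := n1 isT.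
  move: abc; rewrite (tri_split Kc Kcl gc Ka Kb Kd).
  move: n1 n2 n3 n4 => /=.
  set t1 := tri _ _ _ _; set t2 := tri _ _ _ _; set t3 := tri _ _ _ _.
  set t4 := tri _ _ _ _; rewrite expr_div_n.
  have := nrmD (t1 + t2 + t3) t4; have := nrmD (t1 + t2) t3; have := nrmD t1 t2.
  set s := perim _ _ _ ^+ 2; rewrite (_ : e * (s / 2 ^+ 2) = e * s / 4).
    by set es := e * s; lra.
  by rewrite mulrA -natrX.
have Kcc : K c.
  apply: Kcl => d d0; have d4 : 0 < d / 2 by lra.
  have [[[a b] f] [[/= Ka Kb _ _] /= sd ac]] := cP _ d4; exists a => //.
  by move: sd ac; rewrite /pe /=; lra.
(* All vertices lie within 3 perimeters of [c], so the Taylor remainder contributes at most 3/4 of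
   [e] times the squared perimeter, against the lower bound. *)
have [a aP] := diff_C (gd c Kcc); have e4 : 0 < e / 4 by lra.
have [d d0 dP] := aP _ e4; have d4 : 0 < d / 4 by lra.
have [[[a1 a2] a3] [[/= K1 K2 K3]]] := cP _ d4.
rewrite /pe /= => tb pd ac.
pose B := [set w | nrm (w - c) <= 3 * perim a1 a2 a3].
have [p0 p1 p2] : [/\ 0 <= nrm (a2 - a1), 0 <= nrm (a3 - a2) & 0 <= nrm (a1 - a3)].
  by split; exact: nrm_ge0.
have B1 : B a1 by rewrite /B /= (le_trans ac)// ler_wpM2r ?perim_ge0// ler_nat.
have B2 : B a2.
  by rewrite /B /=; have := nrm_tri a1 a2 c; move: ac; rewrite /perim; lra.
have B3 : B a3.
  rewrite /B /=; have := nrm_tri a1 a3 c; move: ac; rewrite (nrmBC a3 a1) /perim; lra.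
have : nrm (tri (fun w => g w - (g c + a * (w - c))) a1 a2 a3)
    <= perim a1 a2 a3 * (e / 4 * (3 * perim a1 a2 a3)).
  apply: (tri_bound _ B1 B2 B3); first exact: mid_ball.
  move=> w wB; apply: le_trans (dP w _) _; last by rewrite ler_wpM2l// ltW.
  by move: wB; rewrite /B /=; lra.
(* Trapezoidal means are exact on affine functions, and the three side integrals of the affine part
   add up to 0. *)
have -> : tri (fun w => g w - (g c + a * (w - c))) a1 a2 a3 = tri g a1 a2 a3.
  have H u v : K u -> K v -> int (fun w => g w - (g c + a * (w - c))) u v =
      int g u v - (v - u) * ((g c - a * c) + a * mid u v).
    move=> Ku Kv; rewrite (_ : (fun w => _) = (fun w => (-1) * ((g c - a * c) + a * w) + g w)).
      rewrite intL ?int_affine; first by ring.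
        exact: bdd_means_affine.
      exact: (cont_bdd_means Kc Kcl gc).
    by apply/funext => w; ring.
  by rewrite /tri !H// /mid; field.
move: tb; set s := perim _ _ _; have := mulr_ge0 (ltW e0) (sqr_ge0 s); nra.
Qed.

(* The triangle may have z as a vertex although g need not be differentiable
   there: cutting off the corner at z repeatedly leaves ever smaller triangles. *)
Lemma goursat_vertex K g (z q r u : C) : midconvex K -> seqclosed K ->
  {for z, continuous g} ->
  (forall w, K w -> w != z -> differentiable g w) -> K z -> K q -> K r ->
  0 < complex.Re (u * (q - z)) -> 0 < complex.Re (u * (r - z)) ->
  tri g z q r = 0.
Proof.
move=> Kc Kcl gz gd Kz; pose l w := complex.Re (u * (w - z)); rewrite -!/(l _).
have gc w : K w -> {for w, continuous g}.
  by move=> Kw; have [->//|/(gd w Kw) /differentiable_continuous] := eqVneq w z.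
have lz : l z = 0 by rewrite /l subrr mulr0.
have lm p s : l (mid p s) = (l p + l s) / 2.
  by rewrite /l -Re_mid; congr complex.Re; rewrite /mid; field.
have lc (h : R) : midconvex [set w | h <= l w].
  by move=> p s /=; rewrite lm; lra.
have lcl (h : R) : seqclosed [set w | h <= l w].
  move=> c cP /=; apply/ler_addgt0Pl => e e0.
  have u1 : 0 < nrm u + 1 by have := nrm_ge0 u; lra.
  have [w /= lw wc] := cP _ (divr_gt0 e0 u1).
  have : l w - l c <= nrm (u * (w - c)).
    apply: le_trans (Re_le_nrm _); apply: le_trans (ler_norm _).
    have -> : u * (w - c) = u * (w - z) - u * (c - z) by ring.
    by rewrite /l; case: (u * (w - z)); case: (u * (c - z)).
  rewrite nrmM; move: wc; rewrite ltr_pdivlMr//.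
  have := nrm_ge0 (w - c); have := nrm_ge0 u; nra.
(* Three of the four subtriangles lie in the half-plane [h <= l w], which misses [z], so [goursat]
   kills them; only the one at [z] is left. *)
have step q' r' : K q' -> K r' -> 0 < l q' -> 0 < l r' ->
    tri g z q' r' = tri g z (mid z q') (mid r' z).
  move=> Kq Kr lq lr; rewrite (tri_split Kc Kcl gc Kz Kq Kr).
  pose h := Num.min (l q') (l r') / 2.
  have hq : h <= l q' / 2 by rewrite ler_pM2r// ge_min lexx.
  have hr : h <= l r' / 2 by rewrite ler_pM2r// ge_min lexx orbT.
  have h0 : 0 < h by rewrite divr_gt0// lt_min lq lr.
  have G := @goursat (K `&` [set w | h <= l w]) g _ _ _
    (midconvexI Kc (@lc h)) (seqclosedI Kcl (@lcl h)).
  have {}G a b c : K a -> K b -> K c -> h <= l a -> h <= l b -> h <= l c ->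
      tri g a b c = 0.
    move=> Ka Kb Kc' ha hb hc.
    have gd' w : (K `&` [set w | h <= l w]) w -> differentiable g w.
      move=> [Kw /= hw]; apply: gd; first exact: Kw.
      by apply: contraTneq hw => ->; rewrite lz -ltNge.
    exact: G gd' (conj Ka ha) (conj Kb hb) (conj Kc' hc).
  have K1 := Kc _ _ Kz Kq; have K2 := Kc _ _ Kq Kr; have K3 := Kc _ _ Kr Kz.
  have hm a b : K a -> K b -> h * 2 <= l a + l b -> K (mid a b) /\ h <= l (mid a b).
    by move=> Ka Kb ab; split; [exact: Kc|rewrite lm; lra].
  have [_ h1] : K (mid z q') /\ h <= l (mid z q') by apply: hm => //; rewrite lz; lra.
  have [_ h2] : K (mid q' r') /\ h <= l (mid q' r') by apply: hm => //; lra.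
  have [_ h3] : K (mid r' z) /\ h <= l (mid r' z) by apply: hm => //; rewrite lz; lra.
  rewrite (G (mid z q') q' (mid q' r'))//; last by lra.
  rewrite (G (mid r' z) (mid q' r') r')//; last by lra.
  by rewrite (G (mid z q') (mid q' r') (mid r' z))// !addr0.
have [d d0 dP] := (cont_nrmP g z).1 gz 1 ltr01.
pose B := nrm (g z) + 1.
have small q' r' : K q' -> K r' -> 0 < l q' -> 0 < l r' ->
    nrm (q' - z) < d -> nrm (r' - z) < d -> tri g z q' r' = 0.
  move=> Kq Kr lq lr qd rd.
  (* Each cut leaves the integral unchanged and halves the perimeter, while [g] stays bounded near
     [z]. *)
  have H m : nrm (tri g z q' r') * 2 ^+ m <= perim z q' r' * B.
    elim: m q' r' Kq Kr lq lr qd rd => [|m IH] q' r' Kq Kr lq lr qd rd.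
      rewrite expr0 mulr1.
      pose D := Num.max (nrm (q' - z)) (nrm (r' - z)).
      apply: (@tri_bound [set w | nrm (w - z) <= D]).
      - exact: mid_ball.
      - by rewrite /= subrr nrm0 /D le_max nrm_ge0.
      - by rewrite /= le_max lexx.
      - by rewrite /= le_max lexx orbT.
      move=> w /= wD; have /dP : nrm (w - z) < d by rewrite (le_lt_trans wD)// gt_max qd rd.
      have := nrm_rev (g w) (g z); rewrite /B; lra.
    rewrite step// exprSr.
    have K1 := Kc _ _ Kz Kq; have K3 := Kc _ _ Kr Kz.
    have q0 := nrm_ge0 (q' - z); have r0 := nrm_ge0 (r' - z).
    have := IH _ _ K1 K3; rewrite !lm lz nrm_midl [nrm (mid r' z - z)]nrmBC nrm_midr (nrmBC z r').
    have [-> _ _ _] := perim_half z q' r'.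
    move=> /(_ _ _ _ _)/[dup] _ H; rewrite mulrA.
    have {}H := H ltac:(lra) ltac:(lra) ltac:(lra) ltac:(lra).
    by move: H; set x := _ * 2 ^+ m; lra.
  apply/nrm_eq0/eqP; rewrite eq_le nrm_ge0 andbT leNgt; apply/negP => T0.
  have := truncnS_gt (perim z q' r' * B / nrm (tri g z q' r')).
  set n := _.+1; rewrite ltr_pdivrMr// => nl.
  have := H n; apply/negP; rewrite -ltNge (lt_trans nl)// mulrC ltr_pM2l//.
  by rewrite -natrX ltr_nat ltn_expl.
(* After [n] halvings the triangle lies in the ball of radius [d] around [z], where [small]
   applies. *)
suff main n q' r' : K q' -> K r' -> 0 < l q' -> 0 < l r' ->
    nrm (q' - z) < d * 2 ^+ n -> nrm (r' - z) < d * 2 ^+ n -> tri g z q' r' = 0.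
  move=> Kq Kr lq lr.
  pose D := (nrm (q - z) + nrm (r - z)) / d.
  have := truncnS_gt D; set n := _.+1; rewrite /D ltr_pdivrMr// => nl.
  have n2 : n%:R <= 2 ^+ n :> R by rewrite -natrX ler_nat ltnW// ltn_expl.
  have q0 := nrm_ge0 (q - z); have r0 := nrm_ge0 (r - z).
  by apply: (main n) => //; nra.
elim: n q' r' => [|n IH] q' r' Kq Kr lq lr qd rd.
  by apply: small => //; move: qd rd; rewrite expr0 mulr1.
rewrite step//; apply: IH; rewrite ?lm ?lz.
- exact: Kc.
- exact: Kc.
- lra.
- lra.
- by move: qd; rewrite nrm_midl exprSr; lra.
- by move: rd; rewrite [nrm (mid r' z - z)]nrmBC nrm_midr (nrmBC z r') exprSr; lra.
Qed.

End goursat.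

(** * Integration along rays and Cauchy's formula in a sector *)

Section rays.
Context {R : realType}.
Local Notation C := (CC R).
Local Notation Re := complex.Re.
Local Notation Im := complex.Im.
Implicit Types (g h : C -> C) (p q r w : C) (K : set C).

Definition rc (t : R) : C := t%:C%C.

Lemma ReD w v : Re (w + v) = Re w + Re v. Proof. by case: w; case: v. Qed.
Lemma ImD w v : Im (w + v) = Im w + Im v. Proof. by case: w; case: v. Qed.
Lemma ReB w v : Re (w - v) = Re w - Re v. Proof. by case: w; case: v. Qed.
Lemma ImB w v : Im (w - v) = Im w - Im v. Proof. by case: w; case: v. Qed.
Lemma Re_mul w v : Re (w * v) = Re w * Re v - Im w * Im v.
Proof. by case: w; case: v. Qed.
Lemma Im_mul w v : Im (w * v) = Re w * Im v + Im w * Re v.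
Proof. by case: w; case: v => a b c d /=; ring. Qed.
Lemma Rerc t : Re (rc t) = t. Proof. by []. Qed.
Lemma Imrc t : Im (rc t) = 0. Proof. by []. Qed.
Definition ReImE := (ReB, ImB, ReD, ImD, Re_mul, Im_mul, Rerc, Imrc).

Lemma rcM (s t : R) : rc (s * t) = rc s * rc t. Proof. exact: rmorphM. Qed.
Lemma rcD (s t : R) : rc (s + t) = rc s + rc t. Proof. exact: rmorphD. Qed.

Lemma nrm_rcM (t : R) w : 0 <= t -> nrm (rc t * w) = t * nrm w.
Proof. by move=> t0; rewrite nrmM nrmR ger0_norm. Qed.

(** For [k] from 0 to [n.*2] these numbers run from 2^-n to 2^n by doubling, a subdivision adapted
    to dilation-invariant integrands. *)
Definition dy n k : R := 2 ^+ k / 2 ^+ n.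

Lemma dy_gt0 n k : 0 < dy n k.
Proof. by rewrite divr_gt0 ?exprn_gt0. Qed.

Lemma dyS n k : dy n k.+1 = 2 * dy n k.
Proof. by rewrite /dy exprS mulrA. Qed.

Lemma dy0 n : dy n 0 = (2 ^+ n)^-1.
Proof. by rewrite /dy expr0 div1r. Qed.

Lemma dyn n : dy n n.*2 = 2 ^+ n.
Proof. by rewrite /dy -addnn exprD mulfK// expf_neq0. Qed.

(** The integral truncated to the part of the ray between [p / 2^n] and [2^n * p]. *)
Definition ray n g p : C :=
  \sum_(k < n.*2) int g (rc (dy n k) * p) (rc (dy n k.+1) * p).

(* The integral of g along the ray from 0 through p. *)
Definition raylim g p : C := ulim Uoo (fun n => ray n g p).

Definition quad g a b c d := int g a b + int g b c + int g c d + int g d a.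

(** A fan of triangles with an arbitrary apex [z]: the integrals over the spokes cancel in pairs. *)
Lemma quad_tri g z a b c d :
  quad g a b c d = tri g z a b + tri g z b c + tri g z c d + tri g z d a.
Proof.
rewrite /quad /tri (int_sym g z a) (int_sym g z b) (int_sym g z c).
by rewrite (int_sym g z d); ring.
Qed.

(** Adding up the vanishing quadrilaterals leaves only the two segments that join the truncated rays
    at their ends, and these are of order 2^-n. *)
Lemma raylim_quads g p q (N B : R) (n0 : nat) :
  (forall n k, quad g (rc (dy n k) * p) (rc (dy n k.+1) * p)
                  (rc (dy n k.+1) * q) (rc (dy n k) * q) = 0) ->
  (forall n, nrm (ray n g q) <= N) ->
  (forall n, (n0 <= n)%N ->
     nrm (int g (rc (2 ^+ n)^-1 * p) (rc (2 ^+ n)^-1 * q)) <= B / 2 ^+ n /\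
     nrm (int g (rc (2 ^+ n) * p) (rc (2 ^+ n) * q)) <= B / 2 ^+ n) ->
  raylim g p = raylim g q.
Proof.
move=> Hq HN HB; apply: (ulim_eq HN) => e e0.
apply: (@Uoo_ge (maxn n0 (Num.truncn (2 * B / e)).+1)) => n.
rewrite geq_max => /andP[n0n nB] /=.
have -> : ray n g p - ray n g q = int g (rc (dy n 0) * p) (rc (dy n 0) * q)
    - int g (rc (dy n n.*2) * p) (rc (dy n n.*2) * q).
  rewrite /ray -sumrB; elim: n.*2 => [|m IH]; first by rewrite big_ord0 subrr.
  rewrite big_ord_recr /= IH; have := Hq n m; rewrite /quad.
  rewrite (int_sym g (rc (dy n m) * q)) (int_sym g (rc (dy n m) * p) (rc (dy n m) * q)).
  set a := int _ _ _; set b := int _ _ _; set c := int _ _ _; set d := int _ _ _.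
  set f := int _ _ _ => H; apply/eqP; rewrite -subr_eq0 -[X in _ == X]H; apply/eqP.
  ring.
rewrite dy0 dyn; have [H1 H2] := HB n n0n.
rewrite (le_lt_trans (nrmB _ _))// (le_lt_trans (lerD H1 H2))//.
have nB' : 2 * B / e < n%:R.
  by rewrite (lt_le_trans (truncnS_gt _))// ler_nat.
have n2 : (n%:R : R) < 2 ^+ n by rewrite -natrX ltr_nat ltn_expl.
have := lt_trans nB' n2; rewrite ltr_pdivrMr// => H.
rewrite -mulrDl ltr_pdivrMr ?exprn_gt0//; lra.
Qed.

(** On a dyadic shell the majorant contributes at most [4 * B] times the increment of y / (a + y),
    where y = |w|. These increments telescope to at most 1, whatever the scale [a]. *)
Lemma ray_bound g p (a B : R) n : 0 < a -> 0 <= B ->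
  (forall t : R, 0 < t -> nrm (g (rc t * p)) <= B * (a / (a ^+ 2 + nrm (rc t * p) ^+ 2))) ->
  nrm (ray n g p) <= 4 * B.
Proof.
move=> a0 B0 gB; pose psi k := dy n k * nrm p / (a + dy n k * nrm p).
have p0 := nrm_ge0 p.
suff H m : nrm (\sum_(k < m) int g (rc (dy n k) * p) (rc (dy n k.+1) * p))
    <= 4 * B * (psi m - psi 0%N).
  apply: (le_trans (H _)); rewrite -[leRHS]mulr1 ler_wpM2l ?mulr_ge0//.
  have psi1 : psi n.*2 <= 1.
    have d0 : 0 <= dy n n.*2 * nrm p by rewrite mulr_ge0// ltW// dy_gt0.
    by rewrite /psi ler_pdivrMr; lra.
  have psi0 : 0 <= psi 0%N.
    have d0 : 0 <= dy n 0 * nrm p by rewrite mulr_ge0// ltW// dy_gt0.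
    by rewrite /psi divr_ge0//; lra.
  lra.
elim: m => [|m IH]; first by rewrite big_ord0 nrm0 subrr mulr0.
rewrite big_ord_recr /= (le_trans (nrmD _ _))//.
suff : nrm (int g (rc (dy n m) * p) (rc (dy n m.+1) * p)) <= 4 * B * (psi m.+1 - psi m).
  move: IH; nra.
have s0 := dy_gt0 n m; rewrite /psi dyS; set s := dy n m in s0 *.
pose K := [set w | exists2 t : R, s <= t & w = rc t * p].
have Kc : midconvex K.
  move=> _ _ [t ts ->] [t' ts' ->]; exists ((t + t') / 2); first by lra.
  rewrite /mid -mulrDl -rcD mulrAC; congr (_ * _).
  by rewrite /rc rmorphM fmorphV rmorph_nat.
have gK w : K w -> nrm (g w) <= B * (a / (a ^+ 2 + (s * nrm p) ^+ 2)).
  move=> [t ts ->]; have t0 : 0 < t by lra.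
  apply: (le_trans (gB t t0)); rewrite ler_wpM2l// ler_wpM2l ?(ltW a0)//.
  have sa : 0 < a ^+ 2 by rewrite exprn_gt0.
  rewrite lef_pV2 ?posrE ?ltr_wpDr ?sqr_ge0//.
  rewrite lerD2l ler_sqr ?nnegrE ?nrm_ge0 ?mulr_ge0 ?(ltW s0)//.
  by rewrite nrm_rcM ?(ltW t0)// ler_wpM2r.
have K1 : K (rc s * p) by exists s.
have K2 : K (rc (2 * s) * p) by exists (2 * s) => //; lra.
apply: (le_trans (int_bound Kc K1 K2 gK)).
have -> : rc (2 * s) * p - rc s * p = rc s * p.
  by rewrite (_ : 2 * s = s + s) ?rcD; [ring|lra].
rewrite nrm_rcM ?(ltW s0)//; have sp : 0 <= s * nrm p by rewrite mulr_ge0// ltW.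
rewrite -[2 * s * _]mulrA -[4 * B * _]mulrA; set y := s * nrm p in sp *.
(* After clearing denominators this is (a + 2y)(a + y) <= 4(a^2 + y^2). *)
have H : y * (a / (a ^+ 2 + y ^+ 2)) <= 4 * (2 * y / (a + 2 * y) - y / (a + y)).
  have d1 : 0 < a ^+ 2 + y ^+ 2 by nra.
  have d2 : 0 < (a + 2 * y) * (a + y) by nra.
  rewrite [X in _ <= _ * X](_ : _ = a * y / ((a + 2 * y) * (a + y))); last first.
    by field; lra.
  have ay : 0 <= a * y by nra.
  rewrite (_ : y * _ = a * y * (a ^+ 2 + y ^+ 2)^-1); last by ring.
  rewrite (_ : 4 * _ = a * y * (4 / ((a + 2 * y) * (a + y)))); last by ring.
  rewrite ler_wpM2l// ler_pdivlMr// mulrC ler_pdivrMr//; nra.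
by rewrite mulrCA [leRHS]mulrCA ler_wpM2l.
Qed.

End rays.

(** * Differentiability of elementary combinations *)

Section diff_helpers.
Context {R : realType}.
Local Notation C := (CC R).
Context {V : normedModType C}.
Implicit Types (F G : V -> C) (x : V).

Lemma near_diff {W : normedModType C} (F G : V -> W) x :
  (exists2 d : R, 0 < d & forall y, nrm (y - x) < d -> F y = G y) ->
  differentiable G x -> differentiable F x.
Proof.
move=> [d d0 FG] /diff_nrmP[L [Lk Lo]]; apply/diff_nrmP; exists L; split=> // e e0.
have [d' d'0 dP] := Lo e e0; exists (Num.min d d') => [|h]; first by rewrite lt_min d0.
rewrite lt_min => /andP[hd hd']; rewrite !FG ?subrr ?nrm0//; first exact: dP.
by rewrite addrC addKr.
Qed.

Lemma dif_cst (c : C) x : differentiable (fun _ : V => c) x.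
Proof. exact: differentiable_cst. Qed.

Lemma difD F G x : differentiable F x -> differentiable G x ->
  differentiable (fun y => F y + G y) x.
Proof. exact: differentiableD. Qed.

Lemma difB F G x : differentiable F x -> differentiable G x ->
  differentiable (fun y => F y - G y) x.
Proof. exact: differentiableB. Qed.

Lemma difM F G x : differentiable F x -> differentiable G x ->
  differentiable (fun y => F y * G y) x.
Proof. exact: differentiableM. Qed.

Lemma difV F x : differentiable F x -> F x != 0 ->
  differentiable (fun y => (F y)^-1) x.
Proof. exact: differentiableV. Qed.

Lemma dif_div F G x : differentiable F x -> differentiable G x -> G x != 0 ->
  differentiable (fun y => F y / G y) x.
Proof. by move=> dF dG G0; apply: difM => //; exact: difV. Qed.

End diff_helpers.

(** * Cones, and turning a ray inside a cone *)

Section kernel.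
Context {R : realType}.
Local Notation C := (CC R).
Local Notation Re := complex.Re.
Local Notation Im := complex.Im.
Implicit Types (g F : C -> C) (p q r w z s : C) (K : set C).

Lemma dif_id w : differentiable (fun v : C => v) w.
Proof. exact: ex_diff. Qed.

Definition halfplane (a b c : R) : set C := [set w | c <= a * Re w + b * Im w].

Lemma halfplane_mid a b c : midconvex (halfplane a b c).
Proof. by move=> p q; rewrite /halfplane /= Re_mid Im_mid; lra. Qed.

Lemma halfplane_closed a b c : seqclosed (halfplane a b c).
Proof.
move=> w wP; rewrite /halfplane /=; apply/ler_addgt0Pl => e e0.
have ab : 0 < `|a| + `|b| + 1 by have := normr_ge0 a; have := normr_ge0 b; lra.
have [v vP] := wP _ (divr_gt0 e0 ab); rewrite ltr_pdivlMr// => vw.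
have := Re_le_nrm (v - w); have := Im_le_nrm (v - w); rewrite ReB ImB => hI hR.
have := ler_norm (a * (Re v - Re w)); rewrite normrM => hR'.
have := ler_norm (b * (Im v - Im w)); rewrite normrM => hI'.
have := ler_wpM2l (normr_ge0 a) hR; have := ler_wpM2l (normr_ge0 b) hI.
have := nrm_ge0 (v - w); move: vP; rewrite /halfplane /=; lra.
Qed.

(** A sector cut off below height [h], written with half-planes so that midpoint convexity and
    closedness are inherited. For [al = be] it degenerates to part of a ray. *)
Definition cone (al be h : R) : set C :=
  halfplane 0 1 h `&` (halfplane 1 (- al) 0 `&` halfplane (-1) be 0).

Lemma coneE al be h w : cone al be h w <->
  [/\ h <= Im w, al * Im w <= Re w & Re w <= be * Im w].
Proof.
rewrite /cone /halfplane; split=> [[/= a [b c]]|[a b c]]; [split|split; [|split]] => /=; lra.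
Qed.

Lemma cone_mid al be h : midconvex (cone al be h).
Proof. by do 2?apply: midconvexI; exact: halfplane_mid. Qed.

Lemma cone_closed al be h : seqclosed (cone al be h).
Proof. by do 2?apply: seqclosedI; exact: halfplane_closed. Qed.

Lemma cone_rc al be h (t : R) w : 0 <= t -> cone al be h w -> cone al be (t * h) (rc t * w).
Proof.
move=> t0 /coneE[a b c]; apply/coneE; rewrite !ReImE !mul0r subr0 addr0.
have := ler_wpM2l t0 a; have := ler_wpM2l t0 b; have := ler_wpM2l t0 c; split; lra.
Qed.

Lemma cone_le al be h h' w : h' <= h -> cone al be h w -> cone al be h' w.
Proof. by move=> hh /coneE[a b c]; apply/coneE; split=> //; lra. Qed.

(* The truncated ray integrals differ by the integrals over the two segments
   joining the rays, and these vanish in the limit. *)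
Lemma raylim_ends g p q (al be m N B rho : R) : 0 < m -> 0 <= B -> 0 < rho ->
  cone al be m p -> cone al be m q ->
  (forall n k, quad g (rc (dy n k) * p) (rc (dy n k.+1) * p)
                  (rc (dy n k.+1) * q) (rc (dy n k) * q) = 0) ->
  (forall n, nrm (ray n g q) <= N) ->
  (forall w, 0 < Im w -> cone al be 0 w -> nrm w <= rho -> nrm (g w) <= B) ->
  (forall w, 0 < Im w -> cone al be 0 w -> rho^-1 <= nrm w ->
     nrm (g w) * nrm w ^+ 2 <= B) ->
  raylim g p = raylim g q.
Proof.
move=> m0 B0 r0 cp cq Hq HN Hs Hl.
have qp0 := nrm_ge0 (q - p).
pose D := nrm p + nrm q.
have p0 := nrm_ge0 p; have q0 := nrm_ge0 q.
(* From [n0] on, the inner segment lies in |w| <= rho and the outer one in |w| >= 1/rho. *)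
pose n0 := (Num.truncn (D / rho + (rho * m)^-1)).+1.
apply: (@raylim_quads _ _ _ _ N (nrm (q - p) * B * (1 + m ^- 2)) n0) => // n n0n.
have n2 : D / rho + (rho * m)^-1 < 2 ^+ n.
  rewrite (lt_le_trans (truncnS_gt _))//.
  by rewrite (@le_trans _ _ n%:R) ?ler_nat// -natrX ler_nat ltnW// ltn_expl.
have t0 : 0 < (2 : R) ^+ n by rewrite exprn_gt0.
set t := 2 ^+ n in n2 t0 *.
have rm0 : 0 < (rho * m)^-1 by rewrite invr_gt0 mulr_gt0.
have Dr0 : 0 <= D / rho by rewrite divr_ge0 ?(ltW r0)// addr_ge0.
have m2 : 0 < m ^- 2 by rewrite invr_gt0 exprn_gt0.
have E (u : R) : rc u * q - rc u * p = rc u * (q - p) by rewrite mulrBr.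
split.
  have t1 : 0 < t^-1 by rewrite invr_gt0.
  pose K := [set w : C | nrm w <= D / t] `&` cone al be (t^-1 * m).
  have Kp : K (rc t^-1 * p).
    split; last exact: cone_rc (ltW t1) cp.
    by rewrite /= nrm_rcM ?(ltW t1)// mulrC ler_wpM2r ?(ltW t1)// lerDl.
  have Kq : K (rc t^-1 * q).
    split; last exact: cone_rc (ltW t1) cq.
    by rewrite /= nrm_rcM ?(ltW t1)// mulrC ler_wpM2r ?(ltW t1)// lerDr.
  have Kc : midconvex K.
    apply: midconvexI; last exact: cone_mid.
    by move=> a b; have := @mid_ball R 0 (D / t) a b; rewrite /= !subr0.
  have gK w : K w -> nrm (g w) <= B.
    move=> [/= wD wc]; have tm : 0 < t^-1 * m by rewrite mulr_gt0.
    have /coneE[wm _ _] := wc.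
    apply: Hs; [lra|exact: cone_le (ltW tm) wc|apply: (le_trans wD)].
    rewrite ler_pdivrMr// mulrC -ler_pdivrMr//; lra.
  apply: (le_trans (int_bound Kc Kp Kq gK)).
  rewrite E nrm_rcM ?(ltW t1)// [leRHS]mulrC -mulrA ler_wpM2l ?(ltW t1)//.
  by rewrite ler_peMr ?mulr_ge0//; lra.
have Kp := cone_rc (ltW t0) cp; have Kq := cone_rc (ltW t0) cq.
have gK w : cone al be (t * m) w -> nrm (g w) <= B / (t * m) ^+ 2.
  move=> wc; have /coneE[wm _ _] := wc; have tm0 : 0 < t * m by rewrite mulr_gt0.
  have wn : t * m <= nrm w.
    by rewrite (le_trans wm)// (le_trans (ler_norm _))// Im_le_nrm.
  have wr : rho^-1 <= nrm w.
    apply: le_trans wn; rewrite -ler_pdivrMr//.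
    by move: n2; rewrite invfM; lra.
  rewrite ler_pdivlMr ?exprn_gt0//; apply: le_trans (Hl w _ (cone_le (ltW tm0) wc) wr); last by lra.
  by rewrite ler_wpM2l ?nrm_ge0// ler_sqr ?nnegrE ?nrm_ge0 ?(ltW tm0).
apply: (le_trans (int_bound (@cone_mid _ _ _) Kp Kq gK)).
rewrite E nrm_rcM ?(ltW t0)//.
rewrite (_ : _ * (B / _) = nrm (q - p) * B * m ^- 2 / t); last by field; lra.
rewrite ler_wpM2r ?invr_ge0 ?(ltW t0)// ler_wpM2l ?mulr_ge0//; lra.
Qed.

(** Goursat's theorem annihilates the quadrilaterals between the two rays, and the majorant controls
    both ends: it is at most B/a everywhere, and at most B a / |w|^2. *)
Lemma raylim_cone g p q (al be a B m : R) : 0 < m -> 0 < a -> 0 <= B ->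
  cone al be m p -> cone al be m q ->
  (forall w, 0 < Im w -> cone al be 0 w -> differentiable g w) ->
  (forall w, 0 < Im w -> cone al be 0 w ->
     nrm (g w) <= B * (a / (a ^+ 2 + nrm w ^+ 2))) ->
  raylim g p = raylim g q.
Proof.
move=> m0 a0 B0 cp cq gd gb.
have a2 : 0 < a ^+ 2 by rewrite exprn_gt0.
have cones w (t : R) : 0 < t -> cone al be m w ->
    0 < Im (rc t * w) /\ cone al be 0 (rc t * w).
  move=> t0 cw; have := cone_rc (ltW t0) cw; have tm : 0 < t * m by rewrite mulr_gt0.
  move=> cw'; split; last exact: cone_le (ltW tm) cw'.
  by have /coneE[? _ _] := cw'; lra.
apply: (@raylim_ends g p q al be m (4 * B) (B * (a + a^-1)) 1) => //.
- by rewrite mulr_ge0// addr_ge0// ?invr_ge0 ltW.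
- move=> n k; have s0 := @dy_gt0 R n k; rewrite dyS; set s := dy n k in s0 *.
  have K1 := cone_rc (ltW s0) cp; have K4 := cone_rc (ltW s0) cq.
  have s20 : 0 <= 2 * s by lra.
  have sm : s * m <= 2 * s * m by rewrite ler_wpM2r ?(ltW m0)//; lra.
  have K2 := cone_le sm (cone_rc s20 cp); have K3 := cone_le sm (cone_rc s20 cq).
  have gd' w : cone al be (s * m) w -> differentiable g w.
    have sm0 : 0 < s * m by rewrite mulr_gt0.
    move=> wc; have /coneE[? _ _] := wc; apply: gd; first by lra.
    exact: cone_le (ltW sm0) wc.
  have G := goursat (@cone_mid al be (s * m)) (@cone_closed _ _ _) gd'.
  by rewrite (quad_tri g (rc s * p)) !(G (rc s * p))// !addr0.
- move=> n; apply: (ray_bound _ a0 B0) => t t0; have [? ?] := cones _ _ t0 cq.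
  exact: gb.
- move=> w w0 wc _; apply: (le_trans (gb w w0 wc)); rewrite ler_wpM2l//.
  have ai : 0 < a^-1 by rewrite invr_gt0.
  have aa : a^-1 * a ^+ 2 = a by rewrite expr2 mulKf ?gt_eqF.
  have x2 := sqr_ge0 (nrm w).
  rewrite ler_pdivrMr; last by lra.
  have := mulr_ge0 (ltW a0) x2; have := mulr_ge0 (ltW ai) x2.
  have := mulr_ge0 (ltW a0) (ltW a2); lra.
- move=> w w0 wc _; have x2 := sqr_ge0 (nrm w).
  apply: (le_trans (ler_wpM2r x2 (gb w w0 wc))).
  rewrite -mulrA ler_wpM2l//; have ai : 0 < a^-1 by rewrite invr_gt0.
  rewrite mulrAC ler_pdivrMr; last by lra.
  have := mulr_ge0 (ltW a0) x2; have := mulr_ge0 (ltW ai) x2.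
  have := mulr_ge0 (ltW a0) (ltW a2); have := mulr_ge0 (ltW ai) (ltW a2); lra.
Qed.

End kernel.

(** * A dilation-invariant Cauchy kernel *)

Section ker_bounds.
Context {R : realType}.
Local Notation C := (CC R).
Local Notation Re := complex.Re.
Local Notation Im := complex.Im.
Implicit Types (g F : C -> C) (p q r w z s : C) (K : set C).

(* 2s/(w^2 - s^2) dw is invariant under dilations, has residue 1 at s and is
   integrable along rays, so Cauchy's formula needs no decay of F. *)
Definition ker w s : C := 2 * s / (w ^+ 2 - s ^+ 2).

Definition J p s F := raylim (fun w => F w * ker w s) p.

(** Directions of the two rays bounding the cone |Re w| <= Im w. *)
Definition dirR : C := Complex 1 1.
Definition dirL : C := Complex (-1) 1.

Lemma Re_dirR : Re dirR = 1. Proof. by []. Qed.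
Lemma Im_dirR : Im dirR = 1. Proof. by []. Qed.
Lemma Re_dirL : Re dirL = -1. Proof. by []. Qed.
Lemma Im_dirL : Im dirL = 1. Proof. by []. Qed.
Definition dirE := (Re_dirR, Im_dirR, Re_dirL, Im_dirL, @ReImE R).

Lemma nrm2E w : nrm w ^+ 2 = Re w ^+ 2 + Im w ^+ 2.
Proof. exact: nrm_sqr. Qed.

Lemma ker_bound (k : R) w s : 0 < k -> s != 0 ->
  k * (nrm w ^+ 2 + nrm s ^+ 2) <= nrm (w ^+ 2 - s ^+ 2) ->
  nrm (ker w s) <= 2 / k * (nrm s / (nrm s ^+ 2 + nrm w ^+ 2)).
Proof.
move=> k0 s0 H; have s1 := nrm_gt0 s0.
have sw : 0 < nrm s ^+ 2 + nrm w ^+ 2 by rewrite ltr_wpDr ?sqr_ge0 ?exprn_gt0.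
rewrite /ker nrmM nrmV nrmM nrm_nat.
rewrite (_ : 2 / k * _ = 2 * nrm s / (k * (nrm s ^+ 2 + nrm w ^+ 2))); last first.
  by field; rewrite (gt_eqF sw) gt_eqF.
rewrite ler_wpM2l ?mulr_ge0 ?(ltW s1)// lef_pV2 ?posrE ?mulr_gt0//.
  by rewrite addrC.
by apply: lt_le_trans H; rewrite mulr_gt0// addrC.
Qed.

(** For w = t(1 + i) and r = |s|, |w^2 - s^2|^2 = (2t^2 - r^2)^2 + 4t^2 (Im s - Re s)^2, while
    (|w|^2 + r^2)^2 = (2t^2 - r^2)^2 + 8t^2 r^2. Hence an angular gap of 1/50 matches the factor
    1/10, as 4/50 = 8/100. *)
Lemma sep_dirR (t : R) s : 1/50 * nrm s ^+ 2 <= (Im s - Re s) ^+ 2 ->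
  1/10 * (nrm (rc t * dirR) ^+ 2 + nrm s ^+ 2) <= nrm ((rc t * dirR) ^+ 2 - s ^+ 2).
Proof.
move=> H; have p0 : 0 <= 1/10 * (nrm (rc t * dirR) ^+ 2 + nrm s ^+ 2).
  by have := sqr_ge0 (nrm (rc t * dirR)); have := sqr_ge0 (nrm s); lra.
rewrite -ler_sqr ?nnegrE ?nrm_ge0// [leRHS]nrm2E !nrm2E.
move: H {p0}; rewrite nrm2E !expr2 !dirE.
move: (Re s) (Im s) => a b H.
have h1 : 0 <= t * t * ((b - a) * (b - a) - 1/50 * (a * a + b * b)).
  by rewrite mulr_ge0 ?subr_ge0// -expr2 sqr_ge0.
have h2 := sqr_ge0 (2 * t * t - a * a - b * b).
nra.
Qed.

Lemma sep_dirL (t : R) s : 1/50 * nrm s ^+ 2 <= (Im s + Re s) ^+ 2 ->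
  1/10 * (nrm (rc t * dirL) ^+ 2 + nrm s ^+ 2) <= nrm ((rc t * dirL) ^+ 2 - s ^+ 2).
Proof.
move=> H; have p0 : 0 <= 1/10 * (nrm (rc t * dirL) ^+ 2 + nrm s ^+ 2).
  by have := sqr_ge0 (nrm (rc t * dirL)); have := sqr_ge0 (nrm s); lra.
rewrite -ler_sqr ?nnegrE ?nrm_ge0// [leRHS]nrm2E !nrm2E.
move: H {p0}; rewrite nrm2E !expr2 !dirE.
move: (Re s) (Im s) => a b H.
have h1 : 0 <= t * t * ((b + a) * (b + a) - 1/50 * (a * a + b * b)).
  by rewrite mulr_ge0 ?subr_ge0// -expr2 sqr_ge0.
have h2 := sqr_ge0 (2 * t * t - a * a - b * b).
nra.
Qed.

Definition onray p : set C := [set w | exists2 t : R, 0 < t & w = rc t * p].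

Lemma onray_mid p : midconvex (onray p).
Proof.
move=> _ _ [t t0 ->] [u u0 ->]; exists ((t + u) / 2); first by lra.
rewrite /mid -mulrDl -rcD mulrAC; congr (_ * _).
by rewrite /rc rmorphM fmorphV rmorph_nat.
Qed.

Lemma onray_dy p n k : onray p (rc (dy n k) * p).
Proof. by exists (dy n k) => //; exact: dy_gt0. Qed.

Lemma eq_ray g h p n : (forall w, onray p w -> g w = h w) -> ray n g p = ray n h p.
Proof.
move=> gh; apply: eq_bigr => k _.
exact: (eq_int (@onray_mid p) (onray_dy _ _ _) (onray_dy _ _ _) gh).
Qed.

Lemma bdd_means_le K g p q (B : R) : midconvex K -> K p -> K q ->
  (forall w, K w -> nrm (g w) <= B) -> bdd_means g p q.
Proof.
move=> Kc Kp Kq gB; exists B => n; rewrite -[mean _ _ _ _]subr0.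
by apply: (mean_bound n Kc Kp Kq) => w Kw; rewrite subr0 gB.
Qed.

(** An integrable majorant of Poisson type; by [ray_bound] it bounds the integral by [4 * B]
    whatever the scale [a]. *)
Definition rbound g p (a B : R) :=
  forall w, onray p w -> nrm (g w) <= B * (a / (a ^+ 2 + nrm w ^+ 2)).

Lemma rbound_le g p (a B : R) w : 0 < a -> 0 <= B -> rbound g p a B ->
  onray p w -> nrm (g w) <= B * (a / a ^+ 2).
Proof.
move=> a0 B0 gB pw; apply: (le_trans (gB w pw)); rewrite ler_wpM2l// ler_wpM2l ?(ltW a0)//.
have a2 : 0 < a ^+ 2 by rewrite exprn_gt0.
by rewrite lef_pV2 ?posrE ?ltr_wpDr ?sqr_ge0// lerDl sqr_ge0.
Qed.

Lemma rbound_ray g p (a B : R) n : 0 < a -> 0 <= B -> rbound g p a B ->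
  nrm (ray n g p) <= 4 * B.
Proof. by move=> a0 B0 gB; apply: (ray_bound _ a0 B0) => t t0; apply: gB; exists t. Qed.

Lemma rbound_raylim g p (a B : R) : 0 < a -> 0 <= B -> rbound g p a B ->
  nrm (raylim g p) <= 4 * B.
Proof. by move=> a0 B0 gB; apply: ulim_nrm => n; exact: rbound_ray gB. Qed.

Lemma raylimL (c : C) g h p (a B a' B' : R) : 0 < a -> 0 <= B -> 0 < a' -> 0 <= B' ->
  rbound g p a B -> rbound h p a' B' ->
  raylim (fun w => c * g w + h w) p = c * raylim g p + raylim h p.
Proof.
move=> a0 B0 a'0 B'0 gB hB; rewrite /raylim -(ulimL _ (M := 4 * B) (N := 4 * B')); last 2 first.
- by move=> n; exact: rbound_ray gB.
- by move=> n; exact: rbound_ray hB.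
congr ulim; apply/funext => n; rewrite /ray mulr_sumr -big_split /=.
apply: eq_bigr => k _; apply: intL.
  apply: (bdd_means_le (@onray_mid p) (onray_dy _ _ _) (onray_dy _ _ _)).
  by move=> w; exact: rbound_le gB.
apply: (bdd_means_le (@onray_mid p) (onray_dy _ _ _) (onray_dy _ _ _)).
by move=> w; exact: rbound_le hB.
Qed.

Lemma eq_raylim g h p : (forall w, onray p w -> g w = h w) -> raylim g p = raylim h p.
Proof. by move=> gh; congr ulim; apply/funext => n; exact: eq_ray. Qed.

Lemma rbound_ker p s (k M : R) F : 0 < k -> s != 0 ->
  (forall w, onray p w -> k * (nrm w ^+ 2 + nrm s ^+ 2) <= nrm (w ^+ 2 - s ^+ 2)) ->
  (forall w, onray p w -> nrm (F w) <= M) ->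
  rbound (fun w => F w * ker w s) p (nrm s) (2 / k * M).
Proof.
move=> k0 s0 H FM w pw; rewrite nrmM mulrAC [leRHS]mulrC.
by apply: ler_pM; rewrite ?nrm_ge0 ?FM//; exact: ker_bound (H w pw).
Qed.

(* Plays the role of i * pi up to sign; only Jcst <> 0 matters. *)
Definition Jcst := raylim (fun w => ker w 1) (Complex 0 1 : C).

(* On the imaginary axis the kernel is real and negative, so nothing cancels. *)
Lemma Jcst_neq0 : Jcst != 0.
Proof.
set i := Complex 0 1 : C.
have i2 : i ^+ 2 = -1 by exact: sqr_i.
have [Ri Ii] : Re i = 0 /\ Im i = 1 by [].
have Ji : Jcst = raylim (ker^~ 1) i by [].
clearbody i.
have ni (t : R) : nrm (rc t * i) ^+ 2 = t ^+ 2.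
  by rewrite nrm2E !ReImE Ri Ii; ring.
have kv t : ker (rc t * i) 1 = rc (- (2 / (1 + t ^+ 2))) :> C.
  have t2 : (rc t ^+ 2 + 1 : C) = rc (1 + t ^+ 2).
    by rewrite /rc rmorphD rmorph1 rmorphXn addrC.
  rewrite /ker exprMn i2 expr1n mulr1 mulrN1 -opprD t2.
  by rewrite invrN mulrN /rc rmorphN rmorphM fmorphV rmorph_nat.
have t2 (t : R) : 0 < 1 + t ^+ 2 by rewrite ltr_wpDr ?sqr_ge0.
have kb : rbound (ker^~ 1) i 1 2.
  move=> _ [t t0 ->]; rewrite kv nrmR normrN ger0_norm ?divr_ge0 ?(ltW (t2 t))//.
  by rewrite ni expr1n mul1r.
have piece n k (b : R) : (forall t, dy n k <= t <= 2 * dy n k -> - (2 / (1 + t ^+ 2)) <= b) ->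
    Im (int (ker^~ 1) (rc (dy n k) * i) (rc (dy n k.+1) * i)) <= dy n k * b.
  move=> tb; have s0 := @dy_gt0 R n k; rewrite dyS; set s := dy n k in s0 tb *.
  pose K := [set w | exists2 t : R, s <= t <= 2 * s & w = rc t * i].
  have Kc : midconvex K.
    move=> _ _ [u us ->] [v vs ->]; exists ((u + v) / 2); first by lra.
    rewrite /mid -mulrDl -rcD mulrAC; congr (_ * _).
    by rewrite /rc rmorphM fmorphV rmorph_nat.
  have K1 : K (rc s * i) by exists s => //; lra.
  have K2 : K (rc (2 * s) * i) by exists (2 * s) => //; lra.
  have gK w : K w -> Re (ker w 1) <= b by move=> [t /tb tb' ->]; rewrite kv.
  have oK w : K w -> onray i w by move=> [t ts ->]; exists t => //; lra.
  have [M MP] := bdd_means_le Kc K1 K2 (fun w Kw => rbound_le ltr01 (ler0n _ 2) kb (oK w Kw)).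
  have : Re (av (ker^~ 1) (rc s * i) (rc (2 * s) * i)) <= b.
    by apply: (ulim_Re_le MP); apply: filterE => n' /=; exact: (mean_Re_le n' Kc K1 K2 gK).
  rewrite /int; set A := av _ _ _ => Ab.
  have -> : rc (2 * s) * i - rc s * i = rc s * i.
    by rewrite (_ : 2 * s = s + s) ?rcD; [ring|lra].
  rewrite !ReImE Ri Ii (_ : _ + _ = s * Re A); [nra|ring].
(* The piece from i to 2i alone contributes at most -2/5, because 2 / (1 + t^2) >= 2/5 for 1 <= t <=
   2; no other piece is positive. *)
have nn : Re ((- i) * Jcst) <= - (2 / 5).
  have Mb n : nrm (ray n (ker^~ 1) i) <= 4 * 2 by exact: (rbound_ray _ ltr01 (ler0n _ 2) kb).
  rewrite Ji /raylim -(ulimZ _ Mb).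
  apply: (@ulim_Re_le _ _ _ _ _ (nrm i * (4 * 2))).
    by move=> n; rewrite nrmM nrmN ler_wpM2l ?nrm_ge0.
  apply: (@Uoo_ge 1%N) => n n1 /=.
  have -> : Re (- i * ray n (ker^~ 1) i) = Im (ray n (ker^~ 1) i).
    by rewrite -[- i]sub0r !ReImE Ri Ii /=; ring.
  have -> : Im (ray n (ker^~ 1) i) = \sum_(k < n.*2)
      Im (int (ker^~ 1) (rc (dy n k) * i) (rc (dy n k.+1) * i)).
    rewrite /ray; elim: n.*2 => [|m IH]; first by rewrite !big_ord0.
    by rewrite !big_ord_recr /= ImD IH.
  have nn : (n < n.*2)%N by rewrite -addnn -[X in (X < _)%N]addn0 ltn_add2l.
  rewrite (bigD1 (Ordinal nn)) //=.
  have H1 : Im (int (ker^~ 1) (rc (dy n n) * i) (rc (dy n n.+1) * i)) <= dy n n * - (2 / 5).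
    apply: piece => t; rewrite (_ : dy n n = 1) ?mulr1; last by rewrite /dy divff ?expf_neq0.
    move=> /andP[t1 tt]; rewrite lerN2 ler_wpM2l// lef_pV2 ?posrE//; nra.
  have H2 : \sum_(j < n.*2 | j != Ordinal nn)
      Im (int (ker^~ 1) (rc (dy n j) * i) (rc (dy n j.+1) * i)) <= 0.
    apply: sumr_le0 => k _; rewrite -(mulr0 (dy n k)); apply: piece => t _.
    by rewrite oppr_le0 divr_ge0 ?(ltW (t2 t)).
  have : dy n n = 1 :> R by rewrite /dy divff ?expf_neq0.
  by move=> d1; move: H1; rewrite d1; lra.
apply/negP => /eqP J0; move: nn; rewrite J0 mulr0 /=; lra.
Qed.

End ker_bounds.

(** * Integrals of the kernel along rays *)

Section ker_along_rays.
Context {R : realType}.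
Local Notation C := (CC R).
Local Notation Re := complex.Re.
Local Notation Im := complex.Im.
Implicit Types (g F : C -> C) (p q r w z s : C) (K : set C).

(** With A = |w|^2 + 1 one has |w^2 - 1|^2 = A^2 - 4 (Re w)^2, and the cone condition together with
    4|w|^2 <= A^2 keeps this above A^2 / (1 + b^2). *)
Lemma ker_sep_cone (b : R) w : 0 < Im w -> cone (- b) b 0 w ->
  (1 + b ^+ 2)^-1 * (nrm w ^+ 2 + nrm (1 : C) ^+ 2) <= nrm (w ^+ 2 - 1 ^+ 2).
Proof.
move=> w0 /coneE[_ h1 h2]; have b1 : 0 < 1 + b ^+ 2 by rewrite ltr_wpDr ?sqr_ge0.
have q0 : 0 <= (1 + b ^+ 2)^-1 * (nrm w ^+ 2 + nrm (1 : C) ^+ 2).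
  by rewrite mulr_ge0 ?addr_ge0 ?sqr_ge0// invr_ge0 ltW.
rewrite -ler_sqr ?nnegrE ?nrm_ge0// exprMn exprVn mulrC ler_pdivrMr ?exprn_gt0//.
rewrite [X in _ <= X * _]nrm2E nrm1 [nrm w ^+ 2]nrm2E !expr1n !expr2 !ReImE /=.
have x2 : Re w * Re w <= b * b * (Im w * Im w) by nra.
move: (Re w) (Im w) w0 {h1 h2} x2 => x y y0 x2; rewrite -!expr2 in x2 *.
set A := x ^+ 2 + y ^+ 2 + 1.
have x0 := sqr_ge0 x; have y0' := sqr_ge0 y; have b0 := sqr_ge0 b.
have H1 : A ^+ 2 - 4 * x ^+ 2 = (x ^+ 2 - y ^+ 2 - 1) ^+ 2 + (x * y + y * x) ^+ 2.
  by rewrite /A; ring.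
have H2 : A ^+ 2 <= (1 + b ^+ 2) * (A ^+ 2 - 4 * x ^+ 2).
  have H3 : 4 * (x ^+ 2 + y ^+ 2) <= A ^+ 2.
    have := sqr_ge0 (x ^+ 2 + y ^+ 2 - 1); rewrite /A; nra.
  have := ler_wpM2l b0 H3; lra.
have H4 : 0 <= A ^+ 2 - 4 * x ^+ 2 by rewrite H1 addr_ge0 ?sqr_ge0.
rewrite subr0 -H1; apply: (le_trans H2).
set X := A ^+ 2 - _ in H4 *; have c1 : 1 <= 1 + b ^+ 2 by lra.
have := mulr_ge0 (mulr_ge0 (ltW b1) H4) (_ : 0 <= (1 + b ^+ 2) - 1).
by rewrite subr_ge0 => /(_ c1); lra.
Qed.

Lemma dif_ker w z : w ^+ 2 - z ^+ 2 != 0 -> differentiable (fun v => ker v z) w.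
Proof.
move=> wz; apply: dif_div; first exact: dif_cst; last by [].
apply: difB; last exact: dif_cst.
by rewrite (_ : (fun y => y ^+ 2) = (fun y => y * y))//; apply: difM; exact: dif_id.
Qed.

Lemma Imgt0_neq0 w : 0 < Im w -> w != 0.
Proof. by apply: contraTneq => ->; rewrite ltxx. Qed.

(** The poles 1 and -1 are real, so a ray in the open upper half-plane can be turned to the
    imaginary axis without meeting them. *)
Lemma rbound_ker1 v : 0 < Im v -> exists2 B : R, 0 <= B &
  rbound (fun w => ker w 1) v 1 B /\ raylim (fun w => ker w 1) v = Jcst.
Proof.
move=> v0; pose b := `|Re v| / Im v; pose m := Num.min (Im v) 1.
have b0 : 0 <= b by rewrite divr_ge0// ltW.
have b1 : 0 < 1 + b ^+ 2 by rewrite ltr_wpDr ?sqr_ge0.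
have b1' : 0 < (1 + b ^+ 2)^-1 by rewrite invr_gt0.
have kb w : 0 < Im w -> cone (- b) b 0 w -> nrm (ker w 1) <=
    2 / (1 + b ^+ 2)^-1 * (1 / (1 ^+ 2 + nrm w ^+ 2)).
  move=> w0 wc; have := ker_bound b1' (oner_neq0 C) (ker_sep_cone w0 wc).
  by rewrite nrm1.
have B0 : 0 <= 2 / (1 + b ^+ 2)^-1 by rewrite divr_ge0// ltW.
have bv : b * Im v = `|Re v| by rewrite /b divfK// gt_eqF.
have cv : cone (- b) b (Im v) v.
  apply/coneE; rewrite mulNr bv; split=> //; last exact: ler_norm.
  by rewrite lerNl (le_trans (ler_norm _))// normrN.
exists (2 / (1 + b ^+ 2)^-1) => //; split.
  move=> _ [t t0 ->]; have ct := cone_rc (ltW t0) cv.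
  have tv : 0 < t * Im v by rewrite mulr_gt0.
  apply: kb; first by have /coneE[? _ _] := ct; lra.
  exact: cone_le (ltW tv) ct.
have m0 : 0 < m by rewrite lt_min v0 ltr01.
have cvm : cone (- b) b m v by apply: cone_le cv; rewrite ge_min lexx.
have cim : cone (- b) b m (Complex 0 1).
  by apply/coneE; rewrite /= ge_min lexx orbT !mulr1 oppr_le0.
have kd w : 0 < Im w -> cone (- b) b 0 w -> differentiable (fun w => ker w 1) w.
  move=> w0 wc; apply: dif_ker; apply: contraTneq (ker_sep_cone w0 wc) => ->.
  by rewrite nrm0 -ltNge mulr_gt0// nrm1 expr1n ltr_wpDl ?sqr_ge0.
exact: (raylim_cone m0 ltr01 B0 cvm cim kd kb).
Qed.

Lemma raylim0 p : raylim (fun _ : C => 0) p = 0.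
Proof.
rewrite /raylim (_ : (fun n => _) = fun=> 0) ?ulim_cst//; apply/funext => n.
have m0 m a b : mean m (fun _ : C => 0) a b = 0.
  by elim: m a b => [|m IH] a b /=; rewrite ?IH /mid addr0 mul0r.
apply: big1 => k _; rewrite /int /av (_ : (fun n => _) = fun=> 0).
  by rewrite ulim_cst mulr0.
by apply/funext => m; rewrite m0.
Qed.

Lemma raylimZ (c : C) g p (a B : R) : 0 < a -> 0 <= B -> rbound g p a B ->
  raylim (fun w => c * g w) p = c * raylim g p.
Proof.
move=> a0 B0 gB; have := @raylimL _ c g (fun=> 0) p a B 1 0 a0 B0 ltr01 (lexx 0) gB.
rewrite raylim0 addr0 => <-; first by apply: eq_raylim => w _; rewrite addr0.
by move=> w _; rewrite nrm0 mul0r.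
Qed.

(** Substituting [z * w] for [w] moves the pole from [z] to 1 and the ray of [z * v] to that of
    [v]. *)
Lemma raylim_ker z v : z != 0 -> 0 < Im v -> raylim (fun w => ker w z) (z * v) = Jcst.
Proof.
move=> z0 v0; have [B B0 [kB <-]] := rbound_ker1 v0.
have kz w : ker (z * w) z = z^-1 * ker w 1.
  rewrite /ker exprMn expr1n mulr1 -[X in _ - X](mulr1 (z ^+ 2)) -mulrBr invfM.
  by set d := (_ - 1)^-1; field.
have kB' : rbound (fun w => ker (z * w) z) v 1 (nrm z^-1 * B).
  by move=> w /kB wB; rewrite kz nrmM -mulrA ler_wpM2l ?nrm_ge0.
have B'0 : 0 <= nrm z^-1 * B by rewrite mulr_ge0 ?nrm_ge0.
transitivity (z * raylim (fun w => ker (z * w) z) v).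
  rewrite /raylim -(ulimZ _ (fun n => rbound_ray n ltr01 B'0 kB')).
  congr ulim; apply/funext => n; rewrite /ray mulr_sumr; apply: eq_bigr => k _.
  by rewrite ![rc _ * (z * v)]mulrCA int_scale.
rewrite (eq_raylim (h := fun w => z^-1 * ker w 1)) => [|w _]; last exact: kz.
by rewrite (raylimZ _ ltr01 B0 kB) mulrA divff// mul1r.
Qed.

Lemma raylim_ker_dirL z : 0 < Im z -> `|Re z| * 4 <= Im z ->
  raylim (fun w => ker w z) dirL = Jcst.
Proof.
move=> z0 zi; have zn := Imgt0_neq0 z0.
have E : dirL = z * (dirL / z) by rewrite mulrC divfK.
rewrite {1}E; apply: raylim_ker => //.
move: (dirL / z) E => v E.
have : Re dirL = Re (z * v) by rewrite {1}E.
have : Im dirL = Im (z * v) by rewrite {1}E.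
rewrite !dirE => h1 h2; have := ler_norm (Re z); have := ler_norm (- Re z).
rewrite normrN => h3 h4.
have h5 : 0 < (Re z ^+ 2 + Im z ^+ 2) * Im v.
  rewrite (_ : _ * Im v = Re z * (Re z * Im v + Im z * Re v)
    - Im z * (Re z * Re v - Im z * Im v)); last by ring.
  by rewrite -h1 -h2; lra.
rewrite -(pmulr_rgt0 _ (_ : 0 < Re z ^+ 2 + Im z ^+ 2))//.
by have := sqr_ge0 (Re z); nra.
Qed.

(** Here [dirR / z] lies in the lower half-plane, so [z] is replaced by [- z]; the kernel is odd in
    the pole, whence the sign. The difference of the two rays, [2 * Jcst], is what the residue at
    [z] contributes. *)
Lemma raylim_ker_dirR z : 0 < Im z -> `|Re z| * 4 <= Im z ->
  raylim (fun w => ker w z) dirR = - Jcst.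
Proof.
move=> z0 zi; have zn : - z != 0 by rewrite oppr_eq0 Imgt0_neq0.
have E : dirR = (- z) * (dirR / - z) by rewrite mulrC divfK.
have kz w : ker w z = (-1) * ker w (- z) by rewrite /ker sqrrN; ring.
have v0 : 0 < Im (dirR / - z).
  move: (dirR / - z) E => v E.
  have : Re dirR = Re (- z * v) by rewrite {1}E.
  have : Im dirR = Im (- z * v) by rewrite {1}E.
  rewrite -[- z]sub0r !dirE /= !sub0r => h1 h2; have := ler_norm (Re z).
  have := ler_norm (- Re z); rewrite normrN => h3 h4.
  have h5 : 0 < (Re z ^+ 2 + Im z ^+ 2) * Im v.
    rewrite (_ : _ * Im v = - Re z * (- Re z * Im v + - Im z * Re v)
      + Im z * (- Re z * Re v - - Im z * Im v)); last by ring.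
    by rewrite -h1 -h2; lra.
  rewrite -(pmulr_rgt0 _ (_ : 0 < Re z ^+ 2 + Im z ^+ 2))//.
  by have := sqr_ge0 (Re z); nra.
rewrite (eq_raylim (h := fun w => (-1) * ker w (- z))) => [|w _]; last exact: kz.
have Sep w : onray dirR w -> 1/10 * (nrm w ^+ 2 + nrm (- z) ^+ 2) <= nrm (w ^+ 2 - (- z) ^+ 2).
  move=> [t t0 ->]; rewrite sqrrN nrmN; apply: sep_dirR; rewrite nrm2E.
  have := ler_norm (Re z); have := ler_norm (- Re z); rewrite normrN; nra.
have K1 : 0 < (1/10 : R) by lra.
have := rbound_ker K1 zn Sep (F := fun=> 1) (M := 1) _.
move=> /(_ (fun w _ => _))/= kb.
rewrite (raylimZ _ (nrm_gt0 zn) (_ : 0 <= 2 / (1/10) * 1)).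
- by rewrite {1}E raylim_ker// mulN1r.
- lra.
move=> w wr; have := kb _ w wr; rewrite mul1r; apply; last by rewrite nrm1.
Qed.

End ker_along_rays.

(** * Cauchy's formula between two rays *)

Section sector_domain.
Context {R : realType}.
Local Notation C := (CC R).
Local Notation Re := complex.Re.
Local Notation Im := complex.Im.
Implicit Types (g F : C -> C) (p q r w z s : C) (K : set C).

(** It contains the cone between [dirR] and [dirL] and the whole first quadrant, but keeps away from
    -1, which [mob] sends to the point opposite [z]. *)
Definition sector : set C := [set w | 0 < Im w /\ - (2 * Im w) < Re w].

(** A narrow cone around the imaginary axis, uniformly separated from both bounding rays. *)
Definition middle : set C := [set z | 0 < Im z /\ `|Re z| * 4 <= Im z].

(** This serves to choose a subdivision none of whose horizontal sides has the height of [z]. *)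
Lemma pow2_neq (n k : nat) : dy n k != 3 / 2 :> R.
Proof.
apply/eqP => H.
have : (2 ^ k.+1 = 3 * 2 ^ n)%N.
  apply/eqP; rewrite -(eqr_nat R) natrM !natrX; apply/eqP.
  have H' : 2 ^+ k = 3 / 2 * 2 ^+ n :> R by rewrite -H /dy divfK ?expf_neq0.
  by rewrite exprS H'; field.
move=> E; have : (3 %| 2 ^ k.+1)%N by rewrite E dvdn_mulr.
by rewrite Euclid_dvdX.
Qed.

Lemma cone_sector w : 0 < Im w -> cone (-1) 1 0 w -> sector w.
Proof. by move=> w0 /coneE[_ h1 h2]; split=> //; lra. Qed.

Lemma middle_sepR z : middle z -> 1/50 * nrm z ^+ 2 <= (Im z - Re z) ^+ 2.
Proof.
move=> [z0 zi]; rewrite nrm2E; have := ler_norm (Re z).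
by have := ler_norm (- Re z); rewrite normrN; nra.
Qed.

Lemma middle_sepL z : middle z -> 1/50 * nrm z ^+ 2 <= (Im z + Re z) ^+ 2.
Proof.
move=> [z0 zi]; rewrite nrm2E; have := ler_norm (Re z).
by have := ler_norm (- Re z); rewrite normrN; nra.
Qed.

Section cauchy_in_sector.
Variables (F : C -> C) (M : R) (z : C).
Hypothesis Fd : forall w, sector w -> differentiable F w.
Hypothesis FM : forall w, sector w -> nrm (F w) <= M.
Hypothesis mz : middle z.

Let z0 : z != 0. Proof. by apply: Imgt0_neq0; case: mz. Qed.

Let cz : cone (-1) 1 (Im z) z.
Proof.
case: mz => iz zi; apply/coneE; split=> //; have := ler_norm (Re z);
by have := ler_norm (- Re z); rewrite normrN; lra.
Qed.

Let sz : sector z.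
Proof. by case: (mz) => iz _; apply: cone_sector => //; exact: cone_le (ltW iz) cz. Qed.

Let M0 : 0 <= M. Proof. by apply: le_trans (FM sz); exact: nrm_ge0. Qed.

(** The pole is removed by writing the integrand as the difference quotient of [F] at [z] times 2z /
    (w + z), with the derivative filled in at [z]. Continuity there is all that [goursat_vertex]
    asks for. *)
Let quo_ex : exists N : C -> C, [/\
  forall w, w != z -> w + z != 0 -> N w = (F w - F z) * ker w z,
  {for z, continuous N} &
  forall w, sector w -> w != z -> differentiable N w].
Proof.
have [a aP] := diff_C (Fd sz).
pose q w := if w == z then a else (F w - F z) / (w - z).
pose h w := 2 * z / (w + z).
have kE w : w != z -> w + z != 0 -> (F w - F z) / (w - z) * h w = (F w - F z) * ker w z.
  move=> wz wz'; rewrite /h /ker; field.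
  by rewrite wz' subr_sqr mulf_neq0 ?subr_eq0 ?wz.
have hd w : w + z != 0 -> differentiable h w.
  by move=> wz; exact: dif_div.
have iz : 0 < Im z by case: mz.
have zz : z + z != 0 by apply: Imgt0_neq0; rewrite ImD; lra.
exists (fun w => q w * h w); split.
- by move=> w wz wz'; rewrite /q (negbTE wz) kE.
- suff qc : {for z, continuous q}.
    exact: continuousM qc (differentiable_continuous (hd _ zz)).
  apply/cont_nrmP => e e0; have e2 : 0 < e / 2 by lra.
  have [d d0 dP] := aP _ e2; exists d => // y yd.
  rewrite /q eqxx; have [|yz] := eqVneq y z; first by rewrite subrr nrm0.
  have n0 : 0 < nrm (y - z) by rewrite nrm_gt0 ?subr_eq0.
  have -> : (F y - F z) / (y - z) - a = (F y - (F z + a * (y - z))) / (y - z).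
    by field; rewrite subr_eq0.
  rewrite nrmM nrmV ltr_pdivrMr//; apply: (le_lt_trans (dP y yd)); nra.
- move=> w sw wz.
  have wz' : w + z != 0 by apply: Imgt0_neq0; rewrite ImD; case: sw => ? _; lra.
  apply: (near_diff (G := fun v => (F v - F z) / (v - z) * h v)).
    exists (nrm (w - z)) => [|y]; first by rewrite nrm_gt0 ?subr_eq0.
    rewrite /q; case: eqVneq => [->|//]; by rewrite nrmBC ltxx.
  apply: difM; last exact: hd.
  apply: dif_div; last by rewrite subr_eq0.
    by apply: difB; [exact: Fd|exact: dif_cst].
  by apply: difB; [exact: dif_id|exact: dif_cst].
Qed.

(** Splitting [F] into [F z] and [F - F z]: the kernel integrates to [Jcst] on one ray and [- Jcst]
    on the other, while the rest, [N], has no pole and the same integral on both. *)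
Lemma sector_formula : J dirL z F - J dirR z F = 2 * Jcst * F z.
Proof.
have [N [NE Nc Nd]] := quo_ex.
have iz : 0 < Im z by case: mz.
have wz' w : 0 < Im w -> w + z != 0.
  by move=> iw; apply: Imgt0_neq0; rewrite ImD; lra.
have K1 : 0 < (1/10 : R) by lra.
have sepR w : onray dirR w -> 1/10 * (nrm w ^+ 2 + nrm z ^+ 2) <= nrm (w ^+ 2 - z ^+ 2).
  by move=> [t t0 ->]; apply: sep_dirR; exact: middle_sepR.
have sepL w : onray dirL w -> 1/10 * (nrm w ^+ 2 + nrm z ^+ 2) <= nrm (w ^+ 2 - z ^+ 2).
  by move=> [t t0 ->]; apply: sep_dirL; exact: middle_sepL.
have n0 : 0 < nrm z := nrm_gt0 z0.
have onc p w : p = dirR \/ p = dirL -> onray p w -> 0 < Im w /\ cone (-1) 1 0 w.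
  move=> pE [t t0 ->]; split; first by case: pE => ->; rewrite !dirE; lra.
  by apply/coneE; case: pE => ->; rewrite !dirE; split; lra.
have wne w : 1/10 * (nrm w ^+ 2 + nrm z ^+ 2) <= nrm (w ^+ 2 - z ^+ 2) -> w != z.
  move=> H; apply: contraTneq H => ->; rewrite subrr nrm0 -ltNge; nra.
have key p : p = dirR \/ p = dirL ->
    (forall w, onray p w -> 1/10 * (nrm w ^+ 2 + nrm z ^+ 2) <= nrm (w ^+ 2 - z ^+ 2)) ->
    J p z F = F z * raylim (fun w => ker w z) p + raylim N p /\
    rbound N p (nrm z) (2 / (1/10) * (2 * M)).
  move=> pE sep.
  have F1 : rbound (fun w => ker w z) p (nrm z) (2 / (1/10) * 1).
    move=> w pw; have := rbound_ker K1 z0 sep (F := fun=> 1) (M := 1).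
    by move=> /(_ _ w pw); rewrite mul1r; apply => v _; rewrite nrm1.
  have Ne w : onray p w -> N w = (F w - F z) * ker w z.
    by move=> pw; have [iw _] := onc p w pE pw; rewrite NE ?wz' ?wne ?sep.
  have F2 : rbound N p (nrm z) (2 / (1/10) * (2 * M)).
    move=> w pw; rewrite Ne//; apply: (rbound_ker K1 z0 sep (F := fun v => F v - F z)) => //.
    move=> v pv; have [iv cv] := onc p v pE pv.
    have := nrmB (F v) (F z); have := FM (cone_sector iv cv); have := FM sz; lra.
  split=> //.
  have b1 : 0 <= 2 / (1/10) * 1 :> R by lra.
  have b2 : 0 <= 2 / (1/10) * (2 * M) by have := M0; lra.
  rewrite -(raylimL (F z) n0 b1 n0 b2 F1 F2).
  by apply: eq_raylim => w pw; rewrite Ne//; ring.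
have [ER bR] := key _ (or_introl erefl) sepR.
have [EL bL] := key _ (or_intror erefl) sepL.
have B0 : 0 <= 2 / (1/10) * (2 * M) by have := M0; lra.
suff E : raylim N dirL = raylim N dirR.
  rewrite ER EL E raylim_ker_dirL ?raylim_ker_dirR//; try by case: mz.
  ring.
(* With base points at height 2/3 Im z the corners have heights [dy n k * sg], which by [pow2_neq]
   never equal Im z. *)
pose sg : R := 2 / 3 * Im z; have sg0 : 0 < sg by rewrite /sg; lra.
have onc1 p w : p = dirR \/ p = dirL -> 0 < Im w -> cone (Re p) (Re p) 0 w -> onray p w.
  move=> pE iw /coneE[_ h1 h2]; exists (Im w) => //.
  have h3 : Re w = Re p * Im w by apply/eqP; rewrite eq_le h1 h2.
  have h4 : Im p = 1 by case: pE => ->.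
  apply/eqP; rewrite -[w == _]eq_sym; case: w iw h1 h2 h3 => a b /= _ _ _ ->.
  by case: pE => -> ; apply/eqP; congr Complex; rewrite /=; ring.
(* The cone with [al = be = Re p] is the ray of [p] itself, so [raylim_cone] merely moves the base
   point along it. *)
have resc p : p = dirR \/ p = dirL -> rbound N p (nrm z) (2 / (1/10) * (2 * M)) ->
    (forall w, onray p w -> 1/10 * (nrm w ^+ 2 + nrm z ^+ 2) <= nrm (w ^+ 2 - z ^+ 2)) ->
    raylim N p = raylim N (rc sg * p).
  move=> pE pb sep; have ip : Im p = 1 by case: pE => ->.
  pose m := Num.min 1 sg.
  apply: (raylim_cone (al := Re p) (be := Re p) (m := m) _ n0 B0).
  - by rewrite lt_min ltr01.
  - by apply/coneE; rewrite ip mulr1 ge_min !lexx.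
  - by apply/coneE; rewrite !ReImE ip !mul0r mulr1 subr0 addr0 [Re p * _]mulrC ge_min !lexx orbT.
  - move=> w iw cw; have pw := onc1 p w pE iw cw; apply: Nd; last exact/wne/sep.
    by have [? ?] := onc p w pE pw; exact: cone_sector.
  - by move=> w iw cw; apply: pb; exact: onc1.
rewrite (resc _ (or_intror erefl) bL sepL) (resc _ (or_introl erefl) bR sepR).
symmetry.
(* Outside the annulus between |z|/2 and 2|z|, |w^2 - z^2| is at least 3/4 of the larger of |w|^2
   and |z|^2. *)
pose rho := Num.min (nrm z / 2) (2 * nrm z)^-1.
have r0 : 0 < rho by rewrite lt_min divr_gt0//= invr_gt0; lra.
have cR : cone (-1) 1 sg (rc sg * dirR).
  by apply/coneE; rewrite !dirE; split; lra.
have cL : cone (-1) 1 sg (rc sg * dirL).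
  by apply/coneE; rewrite !dirE; split; lra.
have Nb w : 0 < Im w -> cone (-1) 1 0 w -> w != z ->
    nrm (N w) <= 4 * M * nrm z / nrm (w ^+ 2 - z ^+ 2).
  move=> iw cw wz; rewrite NE ?wz'// /ker 2!nrmM nrmV nrmM nrm_nat mulrA.
  rewrite ler_wpM2r ?invr_ge0 ?nrm_ge0// mulrA ler_wpM2r ?nrm_ge0//.
  by have := nrmB (F w) (F z); have := FM (cone_sector iw cw); have := FM sz; lra.
apply: (@raylim_ends _ N _ _ (-1) 1 sg (4 * (2 / (1/10) * (2 * M)))
   (6 * M * (nrm z + (nrm z)^-1)) rho sg0 _ r0 cR cL).
- by rewrite !mulr_ge0// addr_ge0 ?invr_ge0 ?nrm_ge0.
- move=> n k; have t0 := @dy_gt0 R n k.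
  have izn : Im z != 0 by rewrite gt_eqF.
  have tau : dy n k * sg != Im z.
    apply: contra_neq (pow2_neq n k) => H.
    have : dy n k * (2 / 3) * Im z = 1 * Im z by rewrite -mulrA mul1r; exact: H.
    by move=> /(mulIf izn) H'; lra.
  have tau' : dy n k.+1 * sg != Im z.
    apply: contra_neq (pow2_neq n k.+1) => H.
    have : dy n k.+1 * (2 / 3) * Im z = 1 * Im z by rewrite -mulrA mul1r; exact: H.
    by move=> /(mulIf izn) H'; lra.
  have t'0 := @dy_gt0 R n k.+1.
  have E2 : dy n k.+1 = 2 * dy n k :> R by rewrite dyS.
  pose m := Num.min (dy n k * sg) (Im z).
  have m0 : 0 < m by rewrite lt_min iz andbT mulr_gt0.
  have cm p t : p = dirR \/ p = dirL -> dy n k <= t -> cone (-1) 1 m (rc t * (rc sg * p)).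
    move=> pE tk; have tp : 0 < t by lra.
    have := cone_rc (ltW tp) (_ : cone (-1) 1 sg (rc sg * p)).
    case: pE => -> /(_ ltac:(done)); apply: cone_le; rewrite ge_min ler_wpM2r ?(ltW sg0)//.
  have kk : dy n k <= dy n k.+1 :> R by lra.
  have Ka := cm _ _ (or_introl erefl) (lexx _).
  have Kb := cm _ _ (or_introl erefl) kk.
  have Kc := cm _ _ (or_intror erefl) kk.
  have Kd := cm _ _ (or_intror erefl) (lexx _).
  have Kz : cone (-1) 1 m z by apply: cone_le cz; rewrite ge_min lexx orbT.
  have Nd' w : cone (-1) 1 m w -> w != z -> differentiable N w.
    move=> cw; apply: Nd; apply: cone_sector; last exact: cone_le (ltW m0) cw.
    by have /coneE[? _ _] := cw; lra.
  have GV a b u := @goursat_vertex R (cone (-1) 1 m) N z a b u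
    (@cone_mid _ _ _ _) (@cone_closed _ _ _ _) Nc Nd' Kz.
  have trans t (a b : C) : t * sg != Im z -> cone (-1) 1 m a -> cone (-1) 1 m b ->
      Im a = t * sg -> Im b = t * sg -> tri N z a b = 0.
    move=> tn ca cb ia ib; have := tn; rewrite neq_lt => /orP[tl|tg].
      by apply: (GV a b (Complex 0 1)) => //; rewrite Re_mul ReB ImB /= ?ia ?ib; lra.
    by apply: (GV a b (Complex 0 (-1))) => //; rewrite Re_mul ReB ImB /= ?ia ?ib; lra.
  have iE t p : p = dirR \/ p = dirL -> Im (rc t * (rc sg * p)) = t * sg.
    by case=> ->; rewrite !dirE; ring.
  have [zr1 zr2] : Re z < Im z /\ - Re z < Im z.
    case: mz => _; have := ler_norm (Re z); have := ler_norm (- Re z); rewrite normrN.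
    by split; lra.
  (* The apex is [z], inside the quadrilateral or not. The direction [u] tells on which side of [z]
     the opposite edge lies: [dirR] and [dirL] for edges on the rays, i or -i for the horizontal
     ones. *)
  rewrite (quad_tri N z).
  rewrite (GV _ _ dirR Ka Kb); [|by rewrite !dirE; lra..].
  rewrite (GV _ _ dirL Kc Kd); [|by rewrite !dirE; lra..].
  rewrite (trans (dy n k.+1) _ _ tau' Kb Kc) ?iE//; [|by left|by right].
  rewrite (trans (dy n k) _ _ tau Kd Ka) ?iE//; [|by right|by left].
  by rewrite !addr0.
- move=> n; apply: (rbound_ray _ n0 B0) => w [t t0 ->]; apply: bL.
  by exists (t * sg); rewrite ?mulr_gt0// rcM mulrA.
- move=> w iw cw; rewrite le_min => /andP[wr _].
  have wz : w != z by apply: contraTneq wr => ->; rewrite -ltNge; lra.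
  apply: (le_trans (Nb w iw cw wz)).
  have := nrm_rev (z ^+ 2) (w ^+ 2); rewrite nrmBC !nrmX => H.
  have H2 : 3/4 * nrm z ^+ 2 <= nrm (w ^+ 2 - z ^+ 2) by have := nrm_ge0 w; nra.
  have z2 : 0 < nrm z ^+ 2 by rewrite exprn_gt0.
  rewrite ler_pdivrMr; last by lra.
  apply: le_trans (ler_wpM2l _ H2); last first.
    by rewrite !mulr_ge0// addr_ge0 ?invr_ge0 ?nrm_ge0.
  rewrite (_ : _ * (3/4 * _) = 9/2 * M * (nrm z ^+ 3 + nrm z)); last by field; lra.
  have := mulr_ge0 M0 (nrm_ge0 z); have := mulr_ge0 M0 (exprn_ge0 3 (nrm_ge0 z)); lra.
- move=> w iw cw wr.
  have wr' : 2 * nrm z <= nrm w.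
    apply: le_trans wr; rewrite -[leLHS]invrK lef_pV2 ?posrE//; last by rewrite invr_gt0; lra.
    by rewrite ge_min lexx orbT.
  have wz : w != z by apply: contraTneq wr' => ->; rewrite -ltNge; lra.
  have := nrm_rev (w ^+ 2) (z ^+ 2); rewrite !nrmX => H.
  have H2 : 3/4 * nrm w ^+ 2 <= nrm (w ^+ 2 - z ^+ 2) by nra.
  have w2 : 0 < nrm w ^+ 2 by rewrite exprn_gt0//; lra.
  apply: (le_trans (ler_wpM2r (ltW w2) (Nb w iw cw wz))).
  rewrite mulrAC ler_pdivrMr; last by lra.
  have h1 : 0 <= M * (nrm z)^-1 by rewrite mulr_ge0// invr_ge0 nrm_ge0.
  have h2 := mulr_ge0 M0 (nrm_ge0 z).
  apply: le_trans (ler_wpM2l _ H2); last by lra.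
  have := mulr_ge0 h1 (ltW w2); have := mulr_ge0 h2 (ltW w2); lra.
Qed.

End cauchy_in_sector.

End sector_domain.

(** * Cauchy estimates and limits of holomorphic functions *)

Section cauchy_estimates.
Context {R : realType}.
Local Notation C := (CC R).
Local Notation Re := complex.Re.
Local Notation Im := complex.Im.
Implicit Types (g F : C -> C) (p q r w z s : C) (K : set C).

(** Each of two rays contributes 4 * 14 = 56 times [M], with 14 from the bound on [k2]; the sector
    formula divides the sum by [2 * Jcst]. *)
Definition halfplane_cst : R := 56 / nrm (Jcst : C).

Lemma halfplane_cst_ge0 : 0 <= halfplane_cst.
Proof. by rewrite divr_ge0 ?nrm_ge0. Qed.

(** What linearity of [raylim] needs, freed from the scale in [rbound], so that integrands of
    different scales can be combined. *)
Definition rb g p := (exists N : R, forall n, nrm (ray n g p) <= N) /\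
  (exists B : R, forall w, onray p w -> nrm (g w) <= B).

Lemma rbound_rb g p (a B : R) : 0 < a -> 0 <= B -> rbound g p a B -> rb g p.
Proof.
move=> a0 B0 gB; split; first by exists (4 * B) => n; exact: rbound_ray gB.
by exists (B * (a / a ^+ 2)) => w; exact: rbound_le gB.
Qed.

Lemma ray_lin (c : C) g h p n : rb g p -> rb h p ->
  ray n (fun w => c * g w + h w) p = c * ray n g p + ray n h p.
Proof.
move=> [_ [B gB]] [_ [B' hB]]; rewrite /ray mulr_sumr -big_split /=.
apply: eq_bigr => k _; apply: intL.
  exact: (bdd_means_le (@onray_mid _ p) (onray_dy _ _ _) (onray_dy _ _ _) gB).
exact: (bdd_means_le (@onray_mid _ p) (onray_dy _ _ _) (onray_dy _ _ _) hB).
Qed.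

Lemma rb_lin (c : C) g h p : rb g p -> rb h p -> rb (fun w => c * g w + h w) p.
Proof.
move=> gb hb; have [[N gN] [B gB]] := gb; have [[N' hN] [B' hB]] := hb; split.
  exists (nrm c * N + N') => n; rewrite ray_lin// (le_trans (nrmD _ _))//.
  by rewrite lerD// nrmM ler_wpM2l ?nrm_ge0.
exists (nrm c * B + B') => w pw; rewrite (le_trans (nrmD _ _))// nrmM.
by rewrite lerD ?hB// ler_wpM2l ?nrm_ge0 ?gB.
Qed.

Lemma raylim_lin (c : C) g h p : rb g p -> rb h p ->
  raylim (fun w => c * g w + h w) p = c * raylim g p + raylim h p.
Proof.
move=> gb hb; have [[N gN] _] := gb; have [[N' hN] _] := hb.
rewrite /raylim -(ulimL _ gN hN).
by congr ulim; apply/funext => n; exact: ray_lin.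
Qed.

(* Second-order Taylor expansion of the kernel at i under the sector formula. *)
Lemma taylor_halfplane g (M : R) : (forall w, 0 < Im w -> differentiable g w) ->
  (forall w, 0 < Im w -> nrm (g w) <= M) ->
  exists D : C, forall s, nrm (s - Complex 0 1) <= 1/8 ->
    nrm (g s - g (Complex 0 1) - D * (s - Complex 0 1))
      <= halfplane_cst * M * nrm (s - Complex 0 1) ^+ 2.
Proof.
move=> gd gM; set i : C := Complex 0 1.
have [Ri Ii] : Re i = 0 /\ Im i = 1 by [].
clearbody i.
have M0 : 0 <= M by apply: le_trans (gM i _); rewrite ?nrm_ge0 ?Ii.
have mid_s s : nrm (s - i) <= 1/8 -> middle s.
  move=> si; have := Re_le_nrm (s - i); have := Im_le_nrm (s - i).
  rewrite ReB ImB Ri Ii subr0 ler_norml => /andP[h1 h2] h3; split; lra.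
have mi : middle i by apply: mid_s; rewrite subrr nrm0; lra.
(* By partial fractions [ker w s] is 1/(w - s) - 1/(w + s); [k1] and [k2] are the first-order
   coefficient and the second-order remainder of both terms at s = i. *)
pose k1 w := (w - i)^-1 ^+ 2 + (w + i)^-1 ^+ 2.
pose k2 s w := (w - s)^-1 * (w - i)^-1 ^+ 2 - (w + s)^-1 * (w + i)^-1 ^+ 2.
pose good w := [/\ 0 < Im w, 1/2 <= nrm (w - i) ^+ 2,
  1 + nrm w ^+ 2 <= 6 * nrm (w - i) ^+ 2 & 1 + nrm w ^+ 2 <= nrm (w + i) ^+ 2].
have goodray p w : p = dirR \/ p = dirL -> onray p w -> good w.
  move=> pE [t t0 ->]; rewrite /good !nrm2E.
  rewrite !(ReB, ImB, ReD, ImD).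
  have [-> ->] : Re (rc t * p) = t * Re p /\ Im (rc t * p) = t.
    by case: pE => ->; rewrite !dirE; split; ring.
  rewrite Ri Ii; have -> : (t * Re p - 0) ^+ 2 = t ^+ 2.
    by case: pE => ->; rewrite !dirE; ring.
  have -> : (t * Re p + 0) ^+ 2 = t ^+ 2 by case: pE => ->; rewrite !dirE; ring.
  have -> : (t * Re p) ^+ 2 = t ^+ 2 by case: pE => ->; rewrite !dirE; ring.
  have := sqr_ge0 (t - 1/2); have := sqr_ge0 (t - 3/5); split; nra.
have far s w : nrm (s - i) <= 1/8 -> good w ->
    [/\ 1/2 <= nrm (w - s), 1/2 <= nrm (w + s), 7/10 <= nrm (w - i) & 1 <= nrm (w + i)].
  move=> si [_ g1 _ g3]; have h1 : 7/10 <= nrm (w - i).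
    rewrite -ler_sqr ?nnegrE ?nrm_ge0//; nra.
  have h2 : 1 <= nrm (w + i).
    rewrite -ler_sqr ?nnegrE ?nrm_ge0// expr1n; have := sqr_ge0 (nrm w); lra.
  split=> //.
    by have := nrm_tri s w i; lra.
  have -> : w + s = (w + i) - (i - s) by ring.
  by have := nrm_rev (w + i) (i - s); rewrite (nrmBC i); lra.
have n0 (w : C) (e : R) : 0 < e -> e <= nrm w -> w != 0.
  by move=> e0; apply: contraTneq => ->; rewrite nrm0 -ltNge.
have kE s w : nrm (s - i) <= 1/8 -> good w ->
    ker w s = ker w i + (s - i) * k1 w + (s - i) ^+ 2 * k2 s w.
  move=> si gw; have [h1 h2 h3 h4] := far s w si gw.
  have ws : w - s != 0 by apply: n0 h1; lra.
  have ws' : w + s != 0 by apply: n0 h2; lra.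
  have wi : w - i != 0 by apply: n0 h3; lra.
  have wi' : w + i != 0 by apply: n0 h4; lra.
  by rewrite /ker /k1 /k2; field; rewrite ws ws' wi wi' !subr_sqr !mulf_neq0.
have k1b w : good w -> nrm (k1 w) <= 14 * (1 / (1 ^+ 2 + nrm w ^+ 2)).
  move=> gw; have [h1 h2 h3 h4] := far i w ltac:(rewrite subrr nrm0; lra) gw.
  have [_ _ g2 g3] := gw; rewrite /k1 (le_trans (nrmD _ _))// !nrmX !nrmV !exprVn.
  have w1 : 0 < 1 + nrm w ^+ 2 by rewrite ltr_wpDr ?sqr_ge0.
  have e1 : (nrm (w - i) ^+ 2)^-1 <= 6 / (1 + nrm w ^+ 2).
    rewrite ler_pdivlMr// mulrC ler_pdivrMr//; nra.
  have e2 : (nrm (w + i) ^+ 2)^-1 <= 1 / (1 + nrm w ^+ 2).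
    rewrite ler_pdivlMr// mulrC ler_pdivrMr ?mul1r//; nra.
  have : 0 < (1 + nrm w ^+ 2)^-1 by rewrite invr_gt0.
  rewrite expr1n; lra.
have k2b s w : nrm (s - i) <= 1/8 -> good w ->
    nrm (k2 s w) <= 14 * (1 / (1 ^+ 2 + nrm w ^+ 2)).
  move=> si gw; have [h1 h2 h3 h4] := far s w si gw.
  have [_ _ g2 g3] := gw; rewrite /k2 (le_trans (nrmB _ _))//.
  rewrite [X in X + _ <= _]nrmM [X in _ + X <= _]nrmM !nrmX !nrmV !exprVn.
  have w1 : 0 < 1 + nrm w ^+ 2 by rewrite ltr_wpDr ?sqr_ge0.
  have e1 : (nrm (w - i) ^+ 2)^-1 <= 6 / (1 + nrm w ^+ 2).
    rewrite ler_pdivlMr// mulrC ler_pdivrMr//; nra.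
  have e2 : (nrm (w + i) ^+ 2)^-1 <= 1 / (1 + nrm w ^+ 2).
    rewrite ler_pdivlMr// mulrC ler_pdivrMr ?mul1r//; nra.
  have e3 : (nrm (w - s))^-1 <= 2.
    by rewrite -[leRHS]invrK lef_pV2 ?posrE ?invr_gt0//; lra.
  have e4 : (nrm (w + s))^-1 <= 2.
    by rewrite -[leRHS]invrK lef_pV2 ?posrE ?invr_gt0//; lra.
  have e5 : (nrm (w - s))^-1 * (nrm (w - i) ^+ 2)^-1 <= 2 * (6 / (1 + nrm w ^+ 2)).
    by rewrite ler_pM ?invr_ge0 ?sqr_ge0 ?nrm_ge0.
  have e6 : (nrm (w + s))^-1 * (nrm (w + i) ^+ 2)^-1 <= 2 * (1 / (1 + nrm w ^+ 2)).
    by rewrite ler_pM ?invr_ge0 ?sqr_ge0 ?nrm_ge0.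
  rewrite expr1n; lra.
have sep p w : p = dirR \/ p = dirL -> onray p w ->
    1/10 * (nrm w ^+ 2 + nrm i ^+ 2) <= nrm (w ^+ 2 - i ^+ 2).
  case=> -> [t t0 ->]; first exact/sep_dirR/middle_sepR.
  exact/sep_dirL/middle_sepL.
have K1 : 0 < (1/10 : R) by lra.
have pR : dirR = dirR :> C \/ dirR = dirL :> C by left.
have pL : dirL = dirR :> C \/ dirL = dirL :> C by right.
have i0 : i != 0 by apply: Imgt0_neq0; rewrite Ii.
have B1 : 0 <= 2 / (1/10) * M by lra.
have B2 : 0 <= M * 14 by lra.
have gray p w : p = dirR \/ p = dirL -> onray p w -> nrm (g w) <= M.
  by move=> pE pw; apply: gM; have [] := goodray p w pE pw.
have b1 p : p = dirR \/ p = dirL -> rbound (fun w => g w * k1 w) p 1 (M * 14).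
  move=> pE w pw; rewrite nrmM -mulrA ler_pM ?nrm_ge0//; first exact: gray pw.
  by apply: k1b; exact: goodray pw.
have b2 p s : nrm (s - i) <= 1/8 -> p = dirR \/ p = dirL ->
    rbound (fun w => g w * k2 s w) p 1 (M * 14).
  move=> si pE w pw; rewrite nrmM -mulrA ler_pM ?nrm_ge0//; first exact: gray pw.
  by apply: k2b => //; exact: goodray pw.
have b0 p : p = dirR \/ p = dirL -> rbound (fun w => g w * ker w i) p (nrm i) (2 / (1/10) * M).
  move=> pE; apply: (rbound_ker K1 i0); first by move=> w; exact: sep.
  by move=> w; exact: gray.
have ni : 0 < nrm i := nrm_gt0 i0.
pose A p := raylim (fun w => g w * k1 w) p.
pose E p s := raylim (fun w => g w * k2 s w) p.
have JE p s : nrm (s - i) <= 1/8 -> p = dirR \/ p = dirL ->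
    J p s g = (s - i) ^+ 2 * E p s + ((s - i) * A p + J p i g).
  move=> si pE; have r1 := rbound_rb ltr01 B2 (b1 p pE).
  have r2 := rbound_rb ltr01 B2 (b2 p s si pE).
  have r0 := rbound_rb ni B1 (b0 p pE).
  have E1 := raylim_lin (s - i) r1 r0.
  have E2 := raylim_lin ((s - i) ^+ 2) r2 (rb_lin (s - i) r1 r0).
  transitivity (raylim (fun w => (s - i) ^+ 2 * (g w * k2 s w) +
      ((s - i) * (g w * k1 w) + g w * ker w i)) p); last by rewrite E2 E1.
  apply: eq_raylim => w pw; rewrite kE//; last exact: goodray pw.
  by move: (ker w i) (k1 w) (k2 s w) => a b c; ring.
have Eb p s : nrm (s - i) <= 1/8 -> p = dirR \/ p = dirL -> nrm (E p s) <= 56 * M.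
  move=> si pE; have := rbound_raylim ltr01 B2 (b2 p s si pE).
  by rewrite mulrA mulrAC (_ : 4 * 14 = 56 :> R)//; lra.
have c0 : 2 * Jcst != 0 :> C by rewrite mulf_neq0 ?Jcst_neq0// pnatr_eq0.
exists ((A dirL - A dirR) / (2 * Jcst)) => s si.
have gE w : middle w -> g w = (J dirL w g - J dirR w g) / (2 * Jcst).
  move=> mw; rewrite (@sector_formula _ g M w)//.
  - by rewrite mulrAC divff// mul1r.
  - by move=> v [v0 _]; exact: gd.
  - by move=> v [v0 _]; exact: gM.
rewrite (gE s) ?(gE i)//; last exact: mid_s.
rewrite (JE dirR s si pR) (JE dirL s si pL).
have -> : ((s - i) ^+ 2 * E dirL s + ((s - i) * A dirL + J dirL i g) -
   ((s - i) ^+ 2 * E dirR s + ((s - i) * A dirR + J dirR i g))) / (2 * Jcst) -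
  (J dirL i g - J dirR i g) / (2 * Jcst) -
  (A dirL - A dirR) / (2 * Jcst) * (s - i)
  = (E dirL s - E dirR s) / (2 * Jcst) * (s - i) ^+ 2.
  move: (E dirL s) (E dirR s) (A dirL) (A dirR) (J dirL i g) (J dirR i g).
  by move=> a b c d e f; field; exact: Jcst_neq0.
rewrite nrmM nrmX ler_wpM2r ?sqr_ge0// /halfplane_cst nrmM nrmV nrmM nrm_nat.
have J0 : 0 < nrm (Jcst : C) by rewrite nrm_gt0// Jcst_neq0.
rewrite ler_pdivrMr ?mulr_gt0//.
rewrite (_ : _ / _ * M * _ = 112 * M); last by field; rewrite gt_eqF.
move: (nrmB (E dirL s) (E dirR s)) (Eb dirL s si pL) (Eb dirR s si pR).
set a := nrm _; set b := nrm _; set c := nrm _; move: a b c => a b c; clear; lra.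
Qed.

(** Rounded up from (16 + h/8) * 64/31 + h * (64/31)^2 with h = [halfplane_cst], the outcome of the
    change of variable in [taylor_disc]. *)
Definition disc_cst : R := 48 + 6 * halfplane_cst.

Lemma disc_cst_ge0 : 0 <= disc_cst.
Proof. by have := halfplane_cst_ge0; rewrite /disc_cst; lra. Qed.

(** [taylor_halfplane] is transported by the Cayley map [m], whose inverse takes the disc of radius
    rho/32 into |s - i| <= 1/8. That the constant depends neither on [g] nor on [rho] is what allows
    passage to ultralimits. *)
Lemma taylor_disc g (M rho : R) : 0 < rho ->
  (forall w, nrm w < rho -> differentiable g w) ->
  (forall w, nrm w < rho -> nrm (g w) <= M) ->
  exists D : C, forall w, nrm w <= rho / 32 ->
    nrm (g w - g 0 - D * w) <= disc_cst * M * (nrm w / rho) ^+ 2.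
Proof.
move=> r0 gd gM.
have [i [iE Ri Ii i2]] : exists i : C,
    [/\ i = Complex 0 1, Re i = 0, Im i = 1 & i ^+ 2 = -1].
  by exists (Complex 0 1); split=> //; exact: sqr_i.
have M0 : 0 <= M by apply: le_trans (gM 0 _); rewrite ?nrm_ge0 ?nrm0.
have ni : nrm i = 1.
  by apply/eqP; rewrite -(@eqrXn2 _ 2) ?nrm_ge0// nrm2E Ri Ii expr0n expr1n add0r.
pose m (s : C) := rc rho * ((s - i) / (s + i)).
have sip s : 0 < Im s -> s + i != 0.
  by move=> s0; apply: Imgt0_neq0; rewrite ImD Ii; lra.
have mr s : 0 < Im s -> nrm (m s) < rho.
  move=> s0; rewrite nrm_rcM ?(ltW r0)// -[ltRHS]mulr1 ltr_pM2l// nrmM nrmV.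
  rewrite ltr_pdivrMr ?nrm_gt0 ?sip// mul1r -ltr_sqr ?nnegrE ?nrm_ge0//.
  by rewrite !nrm2E !ReImE Ri Ii; nra.
have [||D DP] := @taylor_halfplane (g \o m) M.
- move=> s s0; apply: differentiable_comp; last exact/gd/mr.
  apply: difM; first exact: dif_cst.
  apply: dif_div; last exact: sip.
    by apply: difB; [exact: dif_id|exact: dif_cst].
  by apply: difD; [exact: dif_id|exact: dif_cst].
- by move=> s s0; exact/gM/mr.
have mi : m i = 0 by rewrite /m subrr mul0r mulr0.
rewrite /= -iE mi in DP.
have rc0 : rc rho != 0 by apply/eqP => /(congr1 (@complex.Re _)) /= h; lra.
have H0 := halfplane_cst_ge0.
(* The estimate is tested at the single point i + 1/8, where [g] is at most [M]. *)
have D0 : nrm D <= (16 + halfplane_cst / 8) * M.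
  pose s := i + rc (1/8).
  have si : nrm (s - i) = 1/8 by rewrite /s addrC addKr nrmR ger0_norm//; lra.
  have := DP s; rewrite si lexx => /(_ isT).
  have s0 : 0 < Im s by rewrite !ReImE Ii; lra.
  have := nrm_rev (D * (s - i)) (g (m s) - g 0); rewrite nrmBC nrmM si.
  have := nrmB (g (m s)) (g 0); have := gM _ (mr s s0).
  have := gM 0; rewrite nrm0 => /(_ r0); lra.
(* The inverse Cayley map i(1 + u)/(1 - u) has derivative 2i at u = 0, and u = w / rho. *)
exists (2 * i * D / rc rho) => w wr.
have [u wu uw] : exists2 u, w = rc rho * u & nrm u = nrm w / rho.
  by exists (w / rc rho); rewrite ?nrmM ?nrmV ?nrmR ?gtr0_norm// mulrC divfK.
have u1 : nrm u <= 1/32 by rewrite uw ler_pdivrMr//; lra.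
have u0 := nrm_ge0 u.
have u1' : 31/32 <= nrm (1 - u) by have := nrm_rev (1 : C) u; rewrite nrm1; lra.
have un : 1 - u != 0 by apply: contraTneq u1' => ->; rewrite nrm0 -ltNge; lra.
pose s := i * (1 + u) / (1 - u).
have sE : s - i = 2 * i * u / (1 - u) by rewrite /s; field.
have sE' : s + i = 2 * i / (1 - u) by rewrite /s; field.
clearbody s.
have sb : nrm (s - i) <= 64/31 * nrm u.
  rewrite sE !nrmM nrmV ni nrm_nat ler_pdivrMr; last by lra.
  nra.
have s8 : nrm (s - i) <= 1/8 by lra.
have msw : m s = w.
  rewrite /m wu; congr (_ * _).
  rewrite sE'.
  have i0 : i != 0 by apply: Imgt0_neq0; rewrite Ii.
  by rewrite sE; field; rewrite un i0.
have := DP s s8; rewrite msw => H.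
have -> : g w - g 0 - 2 * i * D / rc rho * w =
    (g w - g 0 - D * (s - i)) + D * (2 * i * u ^+ 2 / (1 - u)).
  by rewrite sE wu; field; rewrite rc0 un.
rewrite (le_trans (nrmD _ _))// -uw.
have h1 : nrm (2 * i * u ^+ 2 / (1 - u)) <= 64/31 * nrm u ^+ 2.
  rewrite !nrmM nrmV ni nrm_nat ler_pdivrMr; last by lra.
  have := ler_wpM2l (sqr_ge0 (nrm u)) u1'; rewrite expr2; lra.
have h2 : nrm (D * (2 * i * u ^+ 2 / (1 - u))) <=
    (16 + halfplane_cst / 8) * M * (64/31 * nrm u ^+ 2).
  by rewrite nrmM ler_pM ?nrm_ge0.
have h3 : nrm (s - i) ^+ 2 <= (64/31 * nrm u) ^+ 2.
  by rewrite ler_sqr ?nnegrE ?nrm_ge0//; lra.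
have h4 := ler_wpM2l (mulr_ge0 H0 M0) h3.
have k1 := mulr_ge0 M0 (sqr_ge0 (nrm u)).
have k2 := mulr_ge0 (mulr_ge0 H0 M0) (sqr_ge0 (nrm u)).
rewrite /disc_cst; lra.
Qed.

End cauchy_estimates.

(** * Ultralimits of bounded families of holomorphic functions *)

Section bounded_families.
Context {R : realType} {V : normedModType (CC R)}.
Local Notation C := (CC R).
Implicit Types (x y h : V) (M r : R).

Lemma dif_affine (x h : V) (l : C) : differentiable (fun l : C => x + l *: h) l.
Proof. by apply: differentiableD => //; exact: ex_diff. Qed.

(** On the complex line through [x] in direction [h] the disc has radius r / |h|, and the
    one-variable estimate is read off at the parameter 1. Its linear coefficient must be [L h], by
    comparison at small parameters. *)
Lemma taylor_ball (u : V -> C) x r M (L : {linear V -> C}) : 0 < r ->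
  (forall y, nrm (y - x) < r -> differentiable u y) ->
  (forall y, nrm (y - x) < r -> nrm (u y) <= M) ->
  (forall e, 0 < e -> exists2 d : R, 0 < d & forall h, nrm h < d ->
      nrm (u (x + h) - u x - L h) <= e * nrm h) ->
  forall h, nrm h <= r / 32 ->
    nrm (u (x + h) - u x - L h) <= disc_cst * M * (nrm h / r) ^+ 2.
Proof.
move=> r0 ud uM uL h hr; have [->|hn] := eqVneq h 0.
  by rewrite addr0 subrr linear0 subrr !nrm0 mul0r expr0n mulr0.
have h0 : 0 < nrm h := nrm_gt0 hn.
have M0 : 0 <= M by apply: le_trans (uM x _); rewrite ?nrm_ge0// subrr nrm0.
pose rho := r / nrm h; have rho0 : 0 < rho by rewrite divr_gt0.
have inb (l : C) : nrm l < rho -> nrm (x + l *: h - x) < r.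
  by move=> lr; rewrite addrC addKr nrmZ -ltr_pdivlMr.
have [||D DP] := @taylor_disc R (fun l => u (x + l *: h)) M rho rho0.
- move=> l lr; apply: (@differentiable_comp _ _ _ _ (fun l : C => x + l *: h) u).
    exact: dif_affine.
  by apply: ud; exact: inb.
- by move=> l lr; apply: uM; exact: inb.
have c0 := @disc_cst_ge0 R.
suff DL : D = L h.
  have := DP 1; rewrite nrm1 scale1r scale0r addr0 mulr1 DL div1r /rho invf_div.
  by apply; rewrite !ler_pdivlMr// mul1r; lra.
apply/eqP; rewrite -subr_eq0; apply/eqP/nrm_eq0/eqP.
rewrite eq_le nrm_ge0 andbT; apply/ler_addgt0Pl => e e0; rewrite addr0.
have e2 : 0 < e / 2 / nrm h by rewrite !divr_gt0.
have [d d0 dP] := uL _ e2.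
pose k := disc_cst * M / rho ^+ 2.
have k0 : 0 <= k by apply: divr_ge0; [exact: mulr_ge0|exact: exprn_ge0 (ltW rho0)].
(* Small enough for the expansion with [L], for [taylor_disc], and to make the quadratic remainder
   at most half of the allowed error. *)
pose t : R := Num.min (d / (2 * nrm h)) (Num.min (rho / 32) (e / (2 * (k + 1)))).
have t0 : 0 < t.
  by rewrite !lt_min !divr_gt0 ?mulr_gt0//; lra.
have t1 : t * nrm h < d.
  have : t <= d / (2 * nrm h) by rewrite ge_min lexx.
  by rewrite ler_pdivlMr ?mulr_gt0//; nra.
have t2 : t <= rho / 32 by rewrite !ge_min lexx orbT.
have t3 : k * t <= e / 2.
  have : t <= e / (2 * (k + 1)) by rewrite !ge_min lexx !orbT.
  by rewrite ler_pdivlMr; [nra|lra].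
have nt : nrm (rc t) = t by rewrite nrmR gtr0_norm.
have := DP (rc t); rewrite nt scale0r addr0 => /(_ t2) H1.
have := dP (rc t *: h); rewrite nrmZ nt => /(_ t1).
rewrite linearZ /= => H2.
have H3 : t * nrm (D - L h) <= k * t ^+ 2 + t * (e / 2).
  rewrite -{1}nt -nrmM.
  have -> : rc t * (D - L h) = (u (x + rc t *: h) - u x - rc t * L h) -
     (u (x + rc t *: h) - u x - D * rc t) by ring.
  rewrite (le_trans (nrmB _ _))// addrC lerD//.
    by rewrite (le_trans H1)// /k expr_div_n mulrA mulrAC.
  by apply: (le_trans H2); rewrite le_eqVlt; apply/orP; left; apply/eqP; field; rewrite gt_eqF.
by have : t * nrm (D - L h) <= t * e; [nra|rewrite ler_pM2l].
Qed.

(** The quadratic Taylor remainder has the same constant for every member of the family, so it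
    survives the ultralimit, with the ultralimit of the differentials as differential. *)
Lemma ulim_diff {I : Type} (U : set_system I) {UU : UltraFilter U}
    (u : I -> V -> C) x r M : 0 < r ->
  (forall i y, nrm (y - x) < r -> differentiable (u i) y) ->
  (forall i y, nrm (y - x) < r -> nrm (u i y) <= M) ->
  differentiable (fun y => ulim U (u ^~ y)) x.
Proof.
move=> r0 ud uM.
have xx : nrm (x - x) < r by rewrite subrr nrm0.
have [L LP] : {L : I -> {linear V -> C} & forall i, forall e : R, 0 < e ->
    exists2 d : R, 0 < d & forall h, nrm h < d ->
      nrm (u i (x + h) - u i x - L i h) <= e * nrm h}.
  apply: (@choice _ _ (fun i (L : {linear V -> C}) => forall e : R, 0 < e ->
    exists2 d : R, 0 < d & forall h, nrm h < d ->
      nrm (u i (x + h) - u i x - L h) <= e * nrm h)) => i.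
  by have /diff_nrmP[L [_ Lo]] := ud i x xx; exists L.
have T i h : nrm h <= r / 32 ->
    nrm (u i (x + h) - u i x - L i h) <= disc_cst * M * (nrm h / r) ^+ 2.
  move=> hr; apply: taylor_ball => //; first exact: ud.
    exact: uM.
  exact: LP.
have xh h : nrm h <= r / 32 -> nrm (x + h - x) < r.
  by move=> hr; rewrite addrC addKr; lra.
have c0 := @disc_cst_ge0 R.
have [i0 _] := filter_ex (filterT (F := U)).
have M0 : 0 <= M by apply: le_trans (uM i0 x xx); exact: nrm_ge0.
(* A bound for all differentials at once, from the Taylor estimate at vectors of norm r/32. *)
pose k := (2 + disc_cst) * M * (32 / r).
have Lb i h : nrm (L i h) <= k * nrm h.
  have [->|hn] := eqVneq h 0; first by rewrite linear0 !nrm0 mulr0.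
  have h0 : 0 < nrm h := nrm_gt0 hn.
  pose c := r / 32 / nrm h; have cp : 0 < c by rewrite !divr_gt0.
  have nc : nrm (rc c *: h) = r / 32.
    by rewrite nrmZ nrmR gtr0_norm// /c divfK// gt_eqF.
  have := T i (rc c *: h); rewrite nc => /(_ (lexx _)) H.
  have hb : nrm (rc c *: h) <= r / 32 by rewrite nc.
  have ux := uM i x xx; have uxh := uM i _ (xh _ hb).
  have := nrm_rev (L i (rc c *: h)) (u i (x + rc c *: h) - u i x); rewrite [leRHS]nrmBC.
  have := nrmB (u i (x + rc c *: h)) (u i x).
  move: H; rewrite !linearZ /= [nrm (rc c *: _)]nrmZ nrmR gtr0_norm// => H h1 h2.
  have h3 : c * nrm (L i h) <= (2 + disc_cst) * M.
    have h4 : (r / 32 / r) ^+ 2 <= 1.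
      by rewrite (_ : r / 32 / r = 1/32); [rewrite expr2; lra|field; rewrite gt_eqF].
    have := ler_wpM2l (mulr_ge0 c0 M0) h4; lra.
  have -> : nrm (L i h) = c * nrm (L i h) * (32 / r * nrm h).
    by rewrite /c; field; rewrite !gt_eqF.
  rewrite /k -[leRHS]mulrA ler_wpM2r// mulr_ge0 ?divr_ge0 ?(ltW r0)//; exact: ltW.
pose Lf h := ulim U (fun i => L i h).
have Llin : linear Lf.
  move=> a h h'; transitivity (a * Lf h + Lf h'); last by [].
  rewrite /Lf -(ulimL a (Lb^~ h) (Lb^~ h')).
  by congr ulim; apply/funext => i; rewrite linearP.
pose LM := GRing.isLinear.Build _ _ _ _ _ Llin.
pose LL : {linear V -> C} := HB.pack Lf LM.
apply/diff_nrmP; exists LL; split.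
  by exists k => h; apply: ulim_nrm => i; exact: Lb.
move=> e e0; pose q := disc_cst * M / r ^+ 2.
have q0 : 0 <= q by apply: divr_ge0; [exact: mulr_ge0|exact: exprn_ge0 (ltW r0)].
have q1 : 0 < q + 1 by lra.
exists (Num.min (r / 32) (e / (q + 1))) => [|h].
  by rewrite lt_min !divr_gt0.
rewrite lt_min => /andP[/ltW h1]; rewrite ltr_pdivlMr// => h2.
have u1 i : nrm (u i x) <= M by exact: uM.
have u2 i : nrm (u i (x + h)) <= M by apply: uM; exact: xh.
have E : ulim U (u^~ (x + h)) - ulim U (u^~ x) - LL h =
    ulim U (fun i => (-1) * L i h + ((-1) * u i x + u i (x + h))).
  have b1 i : nrm ((-1) * u i x + u i (x + h)) <= M + M.
    by rewrite mulN1r (le_trans (nrmD _ _))// nrmN lerD.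
  by rewrite (ulimL (-1) (Lb^~ h) b1) (ulimL (-1) u1 u2) /LL /= /Lf; ring.
rewrite E; apply: ulim_nrm => i.
have -> : (-1) * L i h + ((-1) * u i x + u i (x + h)) = u i (x + h) - u i x - L i h.
  by ring.
apply: (le_trans (T i h h1)).
have -> : disc_cst * M * (nrm h / r) ^+ 2 = q * nrm h * nrm h.
  by rewrite /q; field; rewrite gt_eqF.
rewrite ler_wpM2r ?nrm_ge0//; have := nrm_ge0 h; nra.
Qed.

End bounded_families.

(** * Integrals depending on a parameter *)

Section holomorphic_integrals.
Context {R : realType} {V : normedModType (CC R)}.
Local Notation C := (CC R).
Implicit Types (x y : V) (p q w : C) (h : C -> V -> C).

Lemma mean_diff K h n p q x : midconvex K -> K p -> K q ->
  (forall w, K w -> differentiable (h w) x) ->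
  differentiable (fun y => mean n (h^~ y) p q) x.
Proof.
move=> Kc Kp Kq hd; elim: n p q Kp Kq => [|n IH] p q Kp Kq /=; rewrite /mid;
  apply: difM; try exact: dif_cst; apply: difD; do ?exact: hd;
  apply: IH => //; exact: Kc.
Qed.

Lemma dif_sum n (F : 'I_n -> V -> C) x :
  (forall j, differentiable (F j) x) -> differentiable (fun y => \sum_(j < n) F j y) x.
Proof.
elim: n F => [|n IH] F Fd.
  by rewrite (_ : (fun y => _) = fun=> 0) ?dif_cst//; apply/funext => y; rewrite big_ord0.
rewrite (_ : (fun y => _) =
    fun y => \sum_(j < n) F (widen_ord (leqnSn n) j) y + F ord_max y); last first.
  by apply/funext => y; rewrite big_ord_recr.
by apply: difD => //; exact: IH.
Qed.

Lemma raylim_diff h p x (a : V -> R) (r a0 B : R) : 0 < r -> 0 < a0 -> 0 <= B ->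
  (forall w y, onray p w -> nrm (y - x) < r -> differentiable (h w) y) ->
  (forall y, nrm (y - x) < r -> a0 <= a y) ->
  (forall y, nrm (y - x) < r -> rbound (h^~ y) p (a y) B) ->
  differentiable (fun y => raylim (h^~ y) p) x.
Proof.
move=> r0 a00 B0 hd ha hB.
have hb y w : nrm (y - x) < r -> onray p w -> nrm (h w y) <= B / a0.
  move=> yr pw; have ay := ha y yr; have a1 : 0 < a y by lra.
  apply: (le_trans (rbound_le a1 B0 (hB y yr) pw)); rewrite ler_wpM2l//.
  have -> : a y / a y ^+ 2 = (a y)^-1 by field; rewrite gt_eqF.
  by rewrite lef_pV2 ?posrE.
apply: (ulim_diff (r := r) (M := 4 * B)) => // [n y yr|n y yr]; last first.
  by apply: rbound_ray (hB y yr) => //; have := ha y yr; lra.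
apply: (dif_sum (F := fun (k : 'I_n.*2) y =>
  int (h^~ y) (rc (dy n k) * p) (rc (dy n k.+1) * p))) => k.
apply: difM; first exact: dif_cst.
apply: (ulim_diff (r := r - nrm (y - x)) (M := B / a0)); first by lra.
  move=> m y' yr'; apply: (mean_diff _ (@onray_mid _ p) (onray_dy _ _ _) (onray_dy _ _ _)).
  by move=> w pw; apply: hd => //; have := nrm_tri y y' x; lra.
move=> m y' yr'; rewrite -[mean _ _ _ _]subr0.
apply: (mean_bound _ (@onray_mid _ p) (onray_dy _ _ _) (onray_dy _ _ _)) => w pw.
by rewrite subr0; apply: hb => //; have := nrm_tri y y' x; lra.
Qed.

Definition lip_cst : R := 64 * (2 + disc_cst).

(** Within rho/32 of the centre the Taylor estimate applies; farther out the trivial bound 2M is at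
    most 64 M |w - c| / rho. *)
Lemma lip_disc (g : C -> C) (c : C) (M rho : R) : 0 < rho ->
  (forall w, nrm (w - c) < rho -> differentiable g w) ->
  (forall w, nrm (w - c) < rho -> nrm (g w) <= M) ->
  forall w, nrm (w - c) < rho -> nrm (g w - g c) <= lip_cst * M / rho * nrm (w - c).
Proof.
move=> r0 gd gM w wr; have c0 := @disc_cst_ge0 R.
have cc : nrm (c - c) < rho by rewrite subrr nrm0.
have M0 : 0 <= M by apply: le_trans (gM c cc); exact: nrm_ge0.
have sh (v : C) : nrm v < rho -> nrm (v + c - c) < rho by rewrite addrK.
have [||D DP] := @taylor_disc R (fun v => g (v + c)) M rho r0.
- move=> v vr; apply: (@differentiable_comp _ _ _ _ (fun v : C => v + c) g).
    by apply: difD; [exact: dif_id|exact: dif_cst].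
  exact/gd/sh.
- by move=> v vr; exact/gM/sh.
rewrite add0r in DP.
have Db : nrm D <= (2 + disc_cst) * M * 32 / rho.
  have n32 : nrm (rc (rho / 32)) = rho / 32 by rewrite nrmR gtr0_norm//; lra.
  have v32 : nrm (rc (rho / 32)) < rho by rewrite n32; lra.
  have := DP (rc (rho / 32)); rewrite n32 => /(_ (lexx _)).
  have := nrm_rev (D * rc (rho / 32)) (g (rc (rho / 32) + c) - g c).
  rewrite [leRHS]nrmBC nrmM n32 => h1 h2; have h3 := nrmB (g (rc (rho / 32) + c)) (g c).
  have h4 := gM _ (sh _ v32); have h5 := gM c cc.
  have h6 : (rho / 32 / rho) ^+ 2 <= 1.
    by rewrite (_ : rho / 32 / rho = 1/32); [rewrite expr2; lra|field; rewrite gt_eqF].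
  have h7 := ler_wpM2l (mulr_ge0 c0 M0) h6.
  rewrite ler_pdivlMr//; lra.
have w0 := nrm_ge0 (w - c).
have k0 : 0 <= M * nrm (w - c) / rho by rewrite divr_ge0 ?mulr_ge0// ltW.
have k1 := mulr_ge0 c0 k0.
have [wl|wl] := leP (nrm (w - c)) (rho / 32).
  have := DP (w - c) wl; rewrite subrK => h1.
  have h2 := nrm_rev (g w - g c) (D * (w - c)).
  have h3 : (nrm (w - c) / rho) ^+ 2 <= nrm (w - c) / rho.
    have q0 : 0 <= nrm (w - c) / rho by rewrite divr_ge0// ltW.
    have q1 : nrm (w - c) / rho <= 1 by rewrite ler_pdivrMr// mul1r ltW.
    nra.
  have h4 := ler_wpM2l (mulr_ge0 c0 M0) h3.
  have h5 := ler_wpM2r w0 Db; rewrite nrmM in h2.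
  have -> : lip_cst * M / rho * nrm (w - c) = 64 * (2 + disc_cst) * (M * nrm (w - c) / rho).
    by rewrite /lip_cst; ring.
  have h6 : (2 + disc_cst) * M * 32 / rho * nrm (w - c) = 32 * (2 + disc_cst) * (M * nrm (w - c) / rho) by ring.
  have h7 : disc_cst * M * (nrm (w - c) / rho) = disc_cst * (M * nrm (w - c) / rho) by ring.
  by rewrite h6 in h5; rewrite h7 in h4; lra.
have h1 := nrmB (g w) (g c); have h2 := gM _ wr; have h3 := gM c cc.
have h4 : 1/32 <= nrm (w - c) / rho by rewrite ler_pdivlMr//; lra.
have h5 := ler_wpM2l M0 h4.
have -> : lip_cst * M / rho * nrm (w - c) = 64 * (2 + disc_cst) * (M * (nrm (w - c) / rho)).
  by rewrite /lip_cst; ring.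
rewrite -mulrA in k1; lra.
Qed.

End holomorphic_integrals.

(** * Coefficient functionals of a Schauder basis *)

Section schauder.
Context {R : realType} {X : completeNormedModType (CC R)}.
Local Notation C := (CC R).
Implicit Types (x y z : X).

Lemma nrm_complete (u : nat -> X) (r : nat -> R) :
  (forall n m, (n <= m)%N -> nrm (u m - u n) <= r n) ->
  (forall e, 0 < e -> exists n, r n < e) ->
  exists c, forall n, nrm (c - u n) <= r n.
Proof.
move=> ur r0; have : cvg (u @ \oo).
  apply: cauchy_cvg; apply/cauchy_exP => e /posC[d d0 ->].
  have [n rn] := r0 d d0; exists (u n); exists n => // m /= nm.
  rewrite -ball_normE /= -opprB normrN nrmE ltcR.
  exact: le_lt_trans (ur n m nm) rn.
move=> /cvg_ex[c uc]; exists c => n; apply/ler_addgt0Pl => e e0.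
have : nbhs c [set y | nrm (y - c) < e] by apply/nbhs_nrm; exists e.
move=> /uc[N _ NP].
have := NP (maxn n N) (leq_maxr _ _); have := ur n (maxn n N) (leq_maxl _ _) => /= h1 h2.
by have := nrm_tri (u (maxn n N)) c (u n); rewrite (nrmBC c (u (maxn n N))); lra.
Qed.

Lemma pow_small (a e : R) : 0 < e -> exists n : nat, a / 2 ^+ n < e.
Proof.
move=> e0; exists (Num.truncn (a / e)).+1; set n := _.+1.
rewrite ltr_pdivrMr ?exprn_gt0// mulrC -ltr_pdivrMr//.
rewrite (lt_trans (truncnS_gt _))//.
by rewrite -natrX ltr_nat ltn_expl.
Qed.

(** Baire's theorem: otherwise every ball contains a smaller one that misses [A m], and nested balls
    with halving radii shrink to a point covered by no [A m]. *)
Lemma baire_nrm (A : nat -> set X) : (forall x, exists m, A m x) ->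
  exists m x (r : R), 0 < r /\ forall y, nrm (y - x) < r ->
    forall e : R, 0 < e -> exists2 z, A m z & nrm (z - y) < e.
Proof.
move=> Acov; apply: contrapT => nB.
have step m (t : X * R) : exists t' : X * R, 0 < t.2 ->
    [/\ 0 < t'.2, t'.2 <= t.2 / 2, nrm (t'.1 - t.1) + t'.2 <= t.2 &
      forall z, nrm (z - t'.1) <= t'.2 -> ~ A m z].
  case: t => x r /=; have [r0|] := pselect (0 < r); last by exists (0, 0).
  have [y [yr [e [e0 eA]]]] : exists y, nrm (y - x) < r /\
      exists e : R, 0 < e /\ forall z, A m z -> e <= nrm (z - y).
    apply: contrapT => H; apply: nB; exists m, x, r; split=> // y yr e e0.
    apply: contrapT => nz; apply: H; exists y; split=> //; exists e; split=> //.
    by move=> z Az; rewrite leNgt; apply/negP => ze; apply: nz; exists z.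
  pose d := Num.min e (r - nrm (y - x)) / 2.
  have m0 : 0 < Num.min e (r - nrm (y - x)) by rewrite lt_min e0 subr_gt0.
  have m1 : Num.min e (r - nrm (y - x)) <= e by rewrite ge_min lexx.
  have m2 : Num.min e (r - nrm (y - x)) <= r - nrm (y - x) by rewrite ge_min lexx orbT.
  have n0 := nrm_ge0 (y - x).
  exists (y, d) => _ /=; split; rewrite /d; try lra.
  by move=> z zd Az; have := eA z Az; lra.
pose f m := projT1 (choice (step m)); have fP m := projT2 (choice (step m)).
rewrite -/(f _) in fP.
pose s := fix s n := if n is n'.+1 then f n' (s n') else (0 : X, 1 : R).
have s0 n : 0 < (s n).2.
  by elim: n => [|n IH] /=; [exact: ltr01|have [] := fP n (s n) IH].
have sP n := fP n (s n) (s0 n).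
have sd n k : nrm ((s (n + k)%N).1 - (s n).1) + (s (n + k)%N).2 <= (s n).2.
  elim: k => [|k IH]; first by rewrite addn0 subrr nrm0 add0r.
  rewrite addnS; have [_ _ h _] := sP (n + k)%N.
  have := nrm_tri (s (n + k)%N).1 (s (n + k).+1).1 (s n).1; rewrite /= in h *; lra.
have sr n : (s n).2 <= 1 / 2 ^+ n.
  elim: n => [|n IH] /=; first by rewrite expr0 divr1.
  have [_ h _ _] := sP n; rewrite exprS invfM mulrA mulrAC; lra.
have [||c cP] := @nrm_complete (fun n => (s n).1) (fun n => (s n).2).
- by move=> n m nm; have := sd n (m - n)%N; rewrite subnKC//; have := s0 m; lra.
- by move=> e e0; have [n nP] := pow_small 1 e0; exists n; have := sr n; lra.
have [m Am] := Acov c; have [_ _ _ /(_ c)] := sP m.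
by apply => //; exact: (cP m.+1).
Qed.

Variable e : nat -> X.
Hypothesis e_basis : schauder_basis e.

Definition psum (a : nat -> C) n : X := \sum_(k < n) a k *: e k.

Lemma expansionP x a : expansion e x a <-> forall d : R, 0 < d ->
  exists N, forall n, (N <= n)%N -> nrm (psum a n - x) < d.
Proof.
have E n : series (fun j => a j *: e j) n = psum a n by rewrite /series /= big_mkord.
split=> [ex d d0|H].
  have : nbhs x [set y | nrm (y - x) < d] by apply/nbhs_nrm; exists d.
  by move=> /ex[N _ NP]; exists N => n /NP /=; rewrite E.
move=> A /nbhs_nrm[d d0 dA]; have [N NP] := H d d0.
by exists N => // n /= /NP; rewrite -E => /dA.
Qed.

Lemma coefP x : expansion e x (coef e ^~ x).
Proof.
have [a [xa _]] := e_basis x; rewrite (_ : coef e ^~ x = get (expansion e x)).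
  exact: getPex (ex_intro _ a xa).
by apply/funext.
Qed.

Lemma coef_uniq x a : expansion e x a -> forall j, coef e j x = a j.
Proof.
move=> xa j; have [b [_ bu]] := e_basis x.
by rewrite -(bu _ xa) (bu _ (@coefP x)).
Qed.

Lemma psumL (c : C) a b n : psum (fun j => c * a j + b j) n = c *: psum a n + psum b n.
Proof.
rewrite /psum scaler_sumr -big_split /=; apply: eq_bigr => k _.
by rewrite scalerDl scalerA.
Qed.

Lemma coefL (c : C) x y j : coef e j (c *: x + y) = c * coef e j x + coef e j y.
Proof.
apply: (coef_uniq (a := fun j => c * coef e j x + coef e j y)); apply/expansionP => d d0.
have c1 : 0 < 2 * (nrm c + 1) by have := nrm_ge0 c; lra.
have d2 : 0 < d / 2 by lra.
have [N NP] := (expansionP _ _).1 (@coefP x) _ (divr_gt0 d0 c1).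
have [M MP] := (expansionP _ _).1 (@coefP y) _ d2.
exists (maxn N M) => n; rewrite geq_max => /andP[/NP h1 /MP h2].
rewrite psumL (_ : _ - _ = c *: (psum (coef e ^~ x) n - x) + (psum (coef e ^~ y) n - y)).
  rewrite (le_lt_trans (nrmD _ _))// nrmZ.
  move: h1; rewrite ltr_pdivlMr//; have := nrm_ge0 c.
  have := nrm_ge0 (psum (coef e ^~ x) n - x); nra.
by rewrite scalerBr opprD addrACA.
Qed.

Lemma coefB x y j : coef e j (x - y) = coef e j x - coef e j y.
Proof. by rewrite addrC -scaleN1r coefL mulN1r addrC. Qed.

Lemma coef0 j : coef e j 0 = 0.
Proof. by rewrite -(subrr (0 : X)) coefB subrr. Qed.

Lemma coefD x y j : coef e j (x + y) = coef e j x + coef e j y.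
Proof. by rewrite -[x]scale1r coefL mul1r scale1r. Qed.

Lemma coef_e k j : coef e j (e k) = if j == k then 1 else 0.
Proof.
apply: (coef_uniq (a := fun j => if j == k then 1 else 0)); apply/expansionP => d d0.
exists k.+1 => n kn; rewrite /psum (bigD1 (Ordinal kn))//= eqxx scale1r big1 ?addr0.
  by rewrite subrr nrm0.
by move=> i /negPf ik; rewrite -(inj_eq val_inj) /= in ik; rewrite ik scale0r.
Qed.

Hypothesis e_norm : normalized e.

Lemma nrm_e j : nrm (e j) = 1.
Proof. by rewrite /nrm e_norm. Qed.

Lemma psumS a n : psum a n.+1 = psum a n + a n *: e n.
Proof. by rewrite /psum big_ord_recr. Qed.

Lemma nrm_coef_psum a n (B : R) : (forall k, nrm (psum a k) <= B) -> nrm (a n) <= 2 * B.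
Proof.
move=> aB; have -> : nrm (a n) = nrm (psum a n.+1 - psum a n).
  by rewrite psumS addrC addKr nrmZ nrm_e mulr1.
by have := nrmB (psum a n.+1) (psum a n); have := aB n; have := aB n.+1; lra.
Qed.

(** Closed balls of the norm given by the supremum over n of the norms of the partial sums, the norm
    that Banach's argument compares with the given one. *)
Definition bpsum (B : R) : set X := [set x | forall n, nrm (psum (coef e ^~ x) n) <= B].

Lemma bpsumL (c : C) x y (A B : R) : bpsum A x -> bpsum B y ->
  bpsum (nrm c * A + B) (c *: x + y).
Proof.
move=> xA yB n.
have -> : coef e ^~ (c *: x + y) = fun j => c * coef e j x + coef e j y.
  by apply/funext => j; rewrite coefL.
rewrite psumL (le_trans (nrmD _ _))// nrmZ lerD// ler_wpM2l ?nrm_ge0//; exact: xA.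
Qed.

Lemma bpsum_ex x : exists m : nat, bpsum m%:R x.
Proof.
have [N NP] := (expansionP _ _).1 (@coefP x) 1 ltr01.
pose B := 1 + nrm x + \sum_(k < N) nrm (psum (coef e ^~ x) k).
have S0 : 0 <= \sum_(k < N) nrm (psum (coef e ^~ x) k) by rewrite sumr_ge0// => k _; exact: nrm_ge0.
have H n : nrm (psum (coef e ^~ x) n) <= B.
  have x0 := nrm_ge0 x; have [nN|Nn] := ltnP n N.
    rewrite /B (bigD1 (Ordinal nN))//=.
    have : 0 <= \sum_(i < N | i != Ordinal nN) nrm (psum (coef e ^~ x) i).
      by rewrite sumr_ge0// => k _; exact: nrm_ge0.
    lra.
  by have := NP n Nn; have := nrm_rev (psum (coef e ^~ x) n) x; rewrite /B; lra.
exists (Num.truncn B).+1 => n; apply: le_trans (H n) _; exact/ltW/truncnS_gt.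
Qed.

(* Banach's theorem: Baire's theorem gives a bound on a dense subset of a ball,
   and successive approximation spreads it to every vector. *)
Lemma coef_bounded : exists2 K : R, 0 <= K & forall j x, nrm (coef e j x) <= K * nrm x.
Proof.
have [m [x0 [r [r0 H]]]] := baire_nrm bpsum_ex.
pose K : R := 2 * m%:R / r; have K0 : 0 <= K by rewrite divr_ge0 ?mulr_ge0 ?(ltW r0).
have dense y (d : R) : 0 < d -> exists2 z, bpsum (K * nrm y) z & nrm (z - y) < d.
  move=> d0; have [->|yn] := eqVneq y 0.
    exists 0; last by rewrite subrr nrm0.
    move=> n; rewrite nrm0 mulr0 /psum big1 ?nrm0// => k _.
    by rewrite coef0 scale0r.
  have y0 := nrm_gt0 yn; pose t := r / 2 / nrm y; have t0 : 0 < t by rewrite !divr_gt0.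
  have nt : nrm (rc t *: y) = r / 2.
    by rewrite nrmZ nrmR gtr0_norm// /t divfK// gt_eqF.
  have td : 0 < t * d by rewrite mulr_gt0.
  have [|z1 z1b z1y] := H (x0 + rc t *: y) _ _ td.
    by rewrite addrC addKr nt; lra.
  (* Approximants of x0 + v and x0 - v are subtracted: the unknown centre x0 cancels and 2v, a
     multiple of [y], remains. *)
  have [|z2 z2b z2y] := H (x0 - rc t *: y) _ _ td.
    by rewrite addrC addKr nrmN nt; lra.
  pose v := rc t *: y; pose a := rc (2 * t).
  have na : nrm a = 2 * t by rewrite nrmR gtr0_norm// mulr_gt0.
  have an0 : a != 0 by apply/eqP => a0; move: na; rewrite a0 nrm0; lra.
  have vv : v + v = a *: y by rewrite /v -scalerDl -rcD; congr (rc _ *: _); ring.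
  have E : (z1 - (x0 + v)) - (z2 - (x0 - v)) = (z1 - z2) - (v + v).
    rewrite opprD opprB [x0 - v - z2]addrC addrACA; congr (_ + _).
    by rewrite addrACA addNr add0r opprD.
  have z0 : bpsum 0 0.
    by move=> n; rewrite /psum big1 ?nrm0// => k _; rewrite coef0 scale0r.
  exists (a^-1 *: (z1 - z2)).
    have := bpsumL a^-1 (bpsumL (-1) z2b z1b) z0.
    rewrite !addr0 scaleN1r [- z2 + z1]addrC nrmN nrm1 mul1r nrmV na.
    have -> // : (2 * t)^-1 * (m%:R + m%:R) = K * nrm y.
    by rewrite /K /t; field; rewrite !gt_eqF.
  have -> : a^-1 *: (z1 - z2) - y = a^-1 *: ((z1 - z2) - (v + v)).
    by rewrite vv [in RHS]scalerBr scalerA mulVf// scale1r.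
  rewrite -E nrmZ nrmV na mulrC ltr_pdivrMr; last by lra.
  have z1y' : nrm (z1 - (x0 + v)) < t * d := z1y.
  have z2y' : nrm (z2 - (x0 - v)) < t * d := z2y.
  by apply: (le_lt_trans (nrmB _ _)); lra.
have K4 : 0 <= 4 * K by lra.
exists (4 * K) => // j x.
have [->|xn] := eqVneq x 0; first by rewrite coef0 !nrm0 mulr0.
have x1 := nrm_gt0 xn; set d := nrm x in x1 *.
have dense' n y : exists z, bpsum (K * nrm y) z /\ nrm (z - y) < d / 2 ^+ n.+1.
  have d2 : 0 < d / 2 ^+ n.+1 by rewrite divr_gt0 ?exprn_gt0.
  by have [z ? ?] := dense y _ d2; exists z.
pose f n := projT1 (choice (fun y => dense' n y)).
have fP n y : bpsum (K * nrm y) (f n y) /\ nrm (f n y - y) < d / 2 ^+ n.+1.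
  exact: (projT2 (choice (fun y => dense' n y))).
(* [y n] is what is left of [x] after [n] corrections, and [s n] below is the sum of these
   corrections. *)
pose y := fix y n := if n is n'.+1 then y n' - f n' (y n') else x.
have yd n : nrm (y n) <= d / 2 ^+ n.
  case: n => [|n] /=; first by rewrite expr0 divr1.
  by rewrite nrmBC; have [_ /ltW] := fP n (y n).
pose s n := x - y n; have s0 : s 0%N = 0 by rewrite /s subrr.
have sS n : s n.+1 = s n + f n (y n) by rewrite /s /= opprB addrCA addrC.
have d0 : 0 <= K * d by rewrite mulr_ge0// ltW.
have p2 n : 0 < 2 ^+ n :> R by rewrite exprn_gt0.
have sB k l : bpsum (2 * (K * d) / 2 ^+ k - 2 * (K * d) / 2 ^+ (k + l)) (s (k + l)%N - s k).
  elim: l => [|l IH].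
    by rewrite addn0 !subrr => n; rewrite /psum big1 ?nrm0// => i _; rewrite coef0 scale0r.
  have [fb _] := fP (k + l)%N (y (k + l)%N).
  have fb' : bpsum (K * d / 2 ^+ (k + l)) (f (k + l)%N (y (k + l)%N)).
    by move=> n; apply: (le_trans (fb n)); rewrite -mulrA ler_wpM2l.
  have := bpsumL 1 fb' IH; rewrite scale1r nrm1 mul1r addnS sS.
  rewrite [s _ + f _ _]addrC -[f _ _ + s _ - s k]addrA.
  rewrite (_ : K * d / _ + _ = 2 * (K * d) / 2 ^+ k - 2 * (K * d) / 2 ^+ (k + l).+1) //.
  by rewrite exprS; field; rewrite !gt_eqF.
have sB' k l : bpsum (2 * (K * d) / 2 ^+ k) (s (k + l)%N - s k).
  move=> n; apply: (le_trans (sB k l n)); rewrite gerBl.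
  by apply: divr_ge0; [lra|exact: ltW (p2 _)].
have cs k l i : nrm (coef e i (s (k + l)%N) - coef e i (s k)) <= 4 * (K * d) / 2 ^+ k.
  rewrite -coefB; apply: (le_trans (nrm_coef_psum i (sB' k l))).
  by rewrite le_eqVlt; apply/orP; left; apply/eqP; ring.
have cb i k : nrm (coef e i (s k)) <= 4 * (K * d).
  by have := cs 0%N k i; rewrite s0 coef0 subr0 expr0 divr1 add0n.
pose b i := ulim Uoo (fun k => coef e i (s k)).
have bs i k : nrm (b i - coef e i (s k)) <= 4 * (K * d) / 2 ^+ k.
  apply: (ulim_le (cb i)); apply: (@Uoo_ge k) => i0 km /=.
  by rewrite -(subnKC km); exact: cs.
(* For fixed [n] only finitely many coefficients occur, so the partial sum of [b] is within [eta] of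
   that of [s (k + l)] for large [l]. *)
have Pb n k : nrm (psum b n - psum (coef e ^~ (s k)) n) <= 2 * (K * d) / 2 ^+ k.
  apply/ler_addgt0Pl => eta eta0.
  have [l lP] := pow_small (n%:R * (4 * (K * d))) eta0.
  have h1 i : nrm (psum b i - psum (coef e ^~ (s (k + l)%N)) i)
      <= i%:R * (4 * (K * d) / 2 ^+ (k + l)).
    elim: i => [|i IH]; first by rewrite /psum !big_ord0 subrr nrm0 mul0r.
    rewrite !psumS opprD addrACA -scalerBl -natr1 mulrDl mul1r.
    by rewrite (le_trans (nrmD _ _))// lerD// nrmZ nrm_e mulr1.
  have h2 := h1 n; have h3 : n%:R * (4 * (K * d) / 2 ^+ (k + l)) <= eta.
    have n4 : 0 <= n%:R * (4 * (K * d)) by apply: mulr_ge0 => //; lra.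
    apply: le_trans (ltW lP); rewrite mulrA ler_wpM2l//.
    by rewrite lef_pV2 ?posrE// exprD ler_peMl ?(ltW (p2 _))// exprn_ege1// ler1n.
  have h4 := sB' k l n.
  have E : psum (coef e ^~ (s (k + l)%N - s k)) n =
      psum (coef e ^~ (s (k + l)%N)) n - psum (coef e ^~ (s k)) n.
    have := psumL (-1) (coef e ^~ (s k)) (coef e ^~ (s (k + l)%N)) n.
    rewrite scaleN1r addrC => <-; congr psum; apply/funext => i.
    by rewrite coefB mulN1r addrC.
  rewrite E in h4.
  have := nrm_tri (psum (coef e ^~ (s (k + l)%N)) n) (psum b n) (psum (coef e ^~ (s k)) n).
  lra.
(* Once [b] is known to expand [x], uniqueness identifies it with the coefficients of [x], and
   [bs j 0] is the desired bound. *)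
have xb : expansion e x b.
  apply/expansionP => eta eta0; have e2 : 0 < eta / 2 by lra.
  have [k kP] := pow_small (2 * (K * d) + d) e2.
  have [N NP] := (expansionP _ _).1 (@coefP (s k)) _ e2.
  exists N => n /NP h1; have h2 := Pb n k; have h3 := yd k.
  have h4 := nrm_tri (psum (coef e ^~ (s k)) n) (psum b n) x.
  have h5 := nrm_tri (s k) (psum (coef e ^~ (s k)) n) x.
  have h6 : nrm (s k - x) = nrm (y k) by rewrite /s addrC addKr nrmN.
  rewrite mulrDl in kP; lra.
rewrite (coef_uniq xb); have := bs j 0%N; rewrite s0 coef0 subr0 expr0 divr1; lra.
Qed.

End schauder.

(** * Coordinates and neighbourhoods in the polydisc *)

Section polydisc_geometry.
Context {R : realType} {X : completeNormedModType (CC R)}.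
Local Notation C := (CC R).
Variable e : nat -> X.
Hypothesis e_basis : schauder_basis e.
Hypothesis e_norm : normalized e.

Lemma coef_linear k : exists L : {linear X -> C}, forall x : X, L x = coef e k x.
Proof.
have cl : linear (coef e k : X -> C) by move=> a x y; exact: coefL.
pose cM := GRing.isLinear.Build _ _ _ _ _ cl.
pose cL : {linear X -> C} := HB.pack (coef e k : X -> C) cM.
by exists cL.
Qed.

Lemma coef_diff k (x : X) : differentiable (coef e k) x.
Proof.
have [L LE] := coef_linear k; have [K K0 cK] := coef_bounded e_basis e_norm.
apply/diff_nrmP; exists L; split; first by exists K => h; rewrite LE.
move=> d d0; exists 1 => // h _; rewrite LE coefD//.
rewrite [X in nrm X](_ : _ = 0); last by ring.
by rewrite nrm0 mulr_ge0 ?(ltW d0) ?nrm_ge0.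
Qed.

Definition upd k (w : C) (x : X) : X := x + (w - coef e k x) *: e k.

Lemma coef_upd k w (x : X) j : coef e j (upd k w x) = if j == k then w else coef e j x.
Proof.
rewrite /upd addrC coefL// coef_e//; case: eqP => [->|_].
  by rewrite mulr1 subrK.
by rewrite mulr0 add0r.
Qed.

Lemma upd_id k (x : X) : upd k (coef e k x) x = x.
Proof. by rewrite /upd subrr scale0r addr0. Qed.

Lemma upd_diff {V : normedModType C} k (g : V -> C) (f : V -> X) (x : V) :
  differentiable g x -> differentiable f x ->
  differentiable (fun y => upd k (g y) (f y)) x.
Proof.
move=> dg df; apply: differentiableD => //.
apply: (@differentiableZl _ _ _ (fun y => g y - coef e k (f y))); apply: difB => //.
by apply: (@differentiable_comp _ _ _ _ f (coef e k)) => //; exact: coef_diff.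
Qed.

Lemma polydiscP x : polydisc e x <-> forall j, nrm (coef e j x) < 1.
Proof.
have E j : (`|coef e j x| < 1) = (nrm (coef e j x) < 1).
  by rewrite nrmE -ltcR.
by split=> H j; move: (H j); rewrite E.
Qed.

(** Since the basis is normalized, the coefficients tend to 0, so all but finitely many are at most
    1/2. The uniform gap below 1 makes the polydisc open. *)
Lemma coef_sup x : polydisc e x -> exists2 q : R, q < 1 & forall j, nrm (coef e j x) <= q.
Proof.
move=> /polydiscP xD.
have e2 : 0 < 1/4 :> R by lra.
have [N NP] := (expansionP _ _ _).1 (@coefP _ _ _ e_basis x) _ e2.
have tail j : (N <= j)%N -> nrm (coef e j x) <= 1/2.
  move=> Nj; have h1 := NP j Nj; have h2 := NP j.+1 (leqW Nj).
  have -> : nrm (coef e j x) = nrm (psum e (coef e ^~ x) j.+1 - psum e (coef e ^~ x) j).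
    by rewrite psumS addrC addKr nrmZ nrm_e// mulr1.
  have := nrm_tri x (psum e (coef e ^~ x) j.+1) (psum e (coef e ^~ x) j).
  by rewrite (nrmBC x); lra.
have [q q1 qP] : exists2 q : R, q < 1 & forall j, (j < N)%N -> nrm (coef e j x) <= q.
  elim: (N) => [|n [q q1 qP]]; first by exists 0.
  exists (Num.max q (nrm (coef e n x))) => [|j]; first by rewrite gt_max q1 xD.
  by rewrite ltnS leq_eqVlt => /orP[/eqP->|/qP]; rewrite le_max ?lexx ?orbT// => ->.
exists (Num.max q (1/2)) => [|j]; first by rewrite gt_max q1; lra.
by rewrite le_max; have [/qP->//|/tail->] := ltnP j N; rewrite orbT.
Qed.

Variable zc : nat -> C.

Definition nbd (eps : R) n : set X :=
  [set x | polydisc e x /\ forall j, (j < n)%N -> nrm (coef e j x - zc j) < eps].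

Lemma nbd0 eps : nbd eps 0 = polydisc e.
Proof. by rewrite /nbd; apply/seteqP; split=> x; [case|]. Qed.

Lemma nbd_polydisc eps n x : nbd eps n x -> polydisc e x.
Proof. by case. Qed.

Lemma nbdS eps n x : nbd eps n.+1 x -> nbd eps n x.
Proof. by case=> xD xn; split=> // j jn; apply: xn; exact: ltnW. Qed.

Lemma nbd_open eps n x : nbd eps n x ->
  exists2 r : R, 0 < r & forall y, nrm (y - x) < r -> nbd eps n y.
Proof.
move=> [xD xn]; have [K K0 cK] := coef_bounded e_basis e_norm.
have [q q1 qP] := coef_sup xD.
(* For [n = 0] no coordinate is constrained, and [eps] need not be positive. *)
have [q' q'1 q'P] : exists2 q : R, q < eps \/ n = 0%N &
    forall j, (j < n)%N -> nrm (coef e j x - zc j) <= q.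
  elim: n xn => [|n IH] xn; first by exists 0; [right|].
  have [|q' q'1 q'P] := IH; first by move=> j jn; apply: xn; exact: ltnW.
  have xnn := xn n (ltnSn n).
  exists (if n is 0 then nrm (coef e n x - zc n) else Num.max q' (nrm (coef e n x - zc n))).
    by left; case: (n) q'1 xnn => [|m] // [h|//] xnn; rewrite gt_max h.
  move=> j; rewrite ltnS leq_eqVlt => /orP[/eqP->|jn].
    by case: (n) => [|m]; rewrite ?le_max lexx ?orbT.
  by case: (n) jn q'P => // m jn q'P; rewrite le_max q'P.
pose d := Num.min (1 - q) (if n is 0 then 1 else eps - q').
have d0 : 0 < d by rewrite lt_min subr_gt0 q1 /=; case: (n) q'1 => // m [|//]; rewrite subr_gt0.
have K1 : 0 < K + 1 by lra.
exists (d / (K + 1)) => [|y]; first by rewrite divr_gt0.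
rewrite (ltr_pdivlMr _ _ K1) => yx.
have yb j : nrm (coef e j y - coef e j x) < d.
  rewrite -coefB//; apply: le_lt_trans (cK j (y - x)) _.
  by have := nrm_ge0 (y - x); lra.
have d1 : d <= 1 - q by rewrite ge_min lexx.
split.
  apply/polydiscP => j; have := nrm_rev (coef e j y) (coef e j x).
  by have := yb j; have := qP j; lra.
move=> j jn; have d2 : d <= eps - q'.
  by rewrite /d; case: (n) jn => // m _; rewrite ge_min lexx orbT.
have := nrm_tri (coef e j x) (coef e j y) (zc j); have := yb j; have := q'P j jn; lra.
Qed.

Lemma nbd_upd eps k x w : nbd eps k x -> nrm w < 1 -> nrm (w - zc k) < eps ->
  nbd eps k.+1 (upd k w x).
Proof.
move=> [/polydiscP xD xk] w1 wz; split.
  by apply/polydiscP => j; rewrite coef_upd; case: eqP.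
move=> j; rewrite ltnS leq_eqVlt coef_upd => /orP[/eqP->|jk]; first by rewrite eqxx.
by rewrite ltn_eqF// xk.
Qed.

Definition bhol (A : set X) (F : X -> C) := (forall x, A x -> differentiable F x) /\
  exists M : R, forall x, A x -> nrm (F x) <= M.

End polydisc_geometry.

(** * Extension across one coordinate *)

Section mobius.
Context {R : realType}.
Local Notation C := (CC R).
Local Notation Re := complex.Re.
Local Notation Im := complex.Im.
Implicit Types s x : C.
Variables (z : C) (tau : R).
Hypotheses (z1 : nrm z = 1) (tau0 : 0 < tau).

Let b : C := Complex tau 1.
Let b' : C := Complex tau (-1).

(* A Moebius map of the upper half-plane onto the unit disc sending 1 to z and
   the endpoints 0 and oo of its boundary to points at distance O(tau) from z. *)
Definition mob (s : C) : C := z * (b - s * b') / (s * b - b').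

Definition mobV (x : C) : C := (z * b + x * b') / (z * b' + x * b).

Lemma bE : [/\ Re b = tau, Im b = 1, Re b' = tau & Im b' = -1].
Proof. by []. Qed.

Lemma b_sum : b + b' = 2 * rc tau.
Proof.
rewrite -[2]/(1 + 1) mulrDl !mul1r -rcD; apply/eqP; rewrite eq_complex /=.
by rewrite addrN !eqxx.
Qed.

Lemma b_sqr : b ^+ 2 - b' ^+ 2 = 4 * rc tau * Complex 0 1.
Proof.
have -> : 4 * rc tau = rc (4 * tau) by rewrite rcM /rc rmorph_nat.
by rewrite !expr2; apply/eqP; rewrite eq_complex /=; apply/andP; split; apply/eqP; ring.
Qed.

(** As |z| = 1 and tau > 0, this says that [mob s] lies in the unit disc exactly when Im s > 0. *)
Lemma mob_ident s :
  nrm (s * b - b') ^+ 2 - nrm (b - s * b') ^+ 2 = 8 * tau * Im s.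
Proof.
have [h1 h2 h3 h4] := bE; move: (b) (b') h1 h2 h3 h4 => c d h1 h2 h3 h4.
by rewrite !nrm2E !ReImE h1 h2 h3 h4; ring.
Qed.

Lemma mob_den s : 0 < Im s -> s * b - b' != 0.
Proof.
move=> s0; apply/eqP => H; have := mob_ident s; rewrite H nrm0 expr0n sub0r => h.
have := sqr_ge0 (nrm (b - s * b')); have : 0 < 8 * tau * Im s by rewrite !mulr_gt0.
lra.
Qed.

Lemma z_neq0 : z != 0.
Proof. by apply/eqP => z0; move: z1; rewrite z0 nrm0; lra. Qed.

Lemma nrm_b : nrm b ^+ 2 = tau ^+ 2 + 1 /\ nrm b' ^+ 2 = tau ^+ 2 + 1.
Proof. by rewrite !nrm2E /= sqrrN expr1n. Qed.

Lemma nrm_bb : nrm b = nrm b' /\ 0 < nrm b.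
Proof.
have [h1 h2] := nrm_b; have b0 := nrm_ge0 b; have b0' := nrm_ge0 b'.
split; first by apply/eqP; rewrite -(@eqrXn2 _ 2) ?nrm_ge0// h1 h2.
by rewrite lt_def b0 andbT; apply/eqP => h; move: h1; rewrite h; nra.
Qed.

Lemma mob_lt1 s : 0 < Im s -> nrm (mob s) < 1.
Proof.
move=> s0; have d0 := mob_den s0; have n0 := nrm_gt0 d0.
rewrite /mob !nrmM nrmV z1 mul1r ltr_pdivrMr// mul1r.
rewrite -ltr_sqr ?nnegrE ?nrm_ge0// -subr_gt0 mob_ident.
by rewrite !mulr_gt0.
Qed.

Lemma mob_dif s : 0 < Im s -> differentiable mob s.
Proof.
move=> s0; apply: dif_div; last exact: mob_den.
  apply: difM; first exact: dif_cst.
  by apply: difB; [exact: dif_cst|apply: difM; [exact: dif_id|exact: dif_cst]].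
by apply: difB; [apply: difM; [exact: dif_id|exact: dif_cst]|exact: dif_cst].
Qed.

Lemma mobV_den x : nrm x < 1 -> z * b' + x * b != 0.
Proof.
move=> x1; apply/eqP => H; have [bb b0] := nrm_bb.
have : nrm (z * b') = nrm (x * b).
  by rewrite -[z * b'](addrK (x * b)) H sub0r nrmN.
by rewrite !nrmM z1 bb mul1r; have := nrm_ge0 b; nra.
Qed.

Lemma mobV_dif x : nrm x < 1 -> differentiable mobV x.
Proof.
move=> x1; apply: dif_div; last exact: mobV_den.
  by apply: difD; [exact: dif_cst|apply: difM; [exact: dif_id|exact: dif_cst]].
by apply: difD; [exact: dif_cst|apply: difM; [exact: dif_id|exact: dif_cst]].
Qed.

Lemma i_neq0 : (Complex 0 1 : C) != 0.
Proof. by apply: Imgt0_neq0. Qed.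

Lemma rc_tau_neq0 : rc tau != 0.
Proof.
apply/eqP => h; have := nrmR tau; rewrite -/(rc tau) h nrm0 gtr0_norm//.
by move=> h2; move: tau0; rewrite -h2 ltxx.
Qed.

Lemma mobV_den2 x : nrm x < 1 -> mobV x * b - b' != 0.
Proof.
move=> x1; have d0 := mobV_den x1.
have -> : mobV x * b - b' = z * (b ^+ 2 - b' ^+ 2) / (z * b' + x * b).
  by rewrite /mobV; field.
rewrite b_sqr !mulf_neq0 ?invr_eq0 ?z_neq0 ?i_neq0 ?rc_tau_neq0 ?pnatr_eq0//.
Qed.

Lemma mobVK x : nrm x < 1 -> mob (mobV x) = x.
Proof.
move=> x1; have d0 := mobV_den x1; have d1 := mobV_den2 x1.
apply: (mulIf d1); rewrite /mob divfK//.
by rewrite /mobV; field.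
Qed.

Lemma mobV_Im x : nrm x < 1 -> 0 < Im (mobV x).
Proof.
move=> x1; have d1 := mobV_den2 x1; have n1 := nrm_gt0 d1.
have := mob_ident (mobV x); have := mobVK x1; rewrite /mob => E.
have E2 : nrm (b - mobV x * b') = nrm x * nrm (mobV x * b - b').
  by rewrite -nrmM -[X in X * (mobV x * b - b')]E divfK// nrmM z1 mul1r.
rewrite E2 exprMn => H; rewrite -(pmulr_rgt0 _ (_ : 0 < 8 * tau)); last by rewrite mulr_gt0.
rewrite -H subr_gt0 gtr_pMl ?exprn_gt0// expr_lt1 ?nrm_ge0//.
Qed.

(** Here mob s - z = 2 tau z (1 - s) / (s b - b') and s b - b' = i(s + 1) + tau(s - 1). On the
    sector |s - 1| <= 5|s + 1|, so the denominator is at least (1/5 - 1/20)|s - 1| and the distance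
    at most 40/3 tau. *)
Lemma mob_near s (eps : R) : sector s -> 0 < eps -> 20 * tau <= eps -> 20 * tau <= 1 ->
  nrm (mob s - z) < eps.
Proof.
move: (tau0) => t0 [s0 sr] e0 te t1; have d0 := mob_den s0; have n0 := nrm_gt0 d0.
have E : mob s - z = z * (2 * rc tau) * (1 - s) / (s * b - b').
  by rewrite -b_sum /mob; field.
have ns : nrm (s - 1) <= 5 * nrm (s + 1).
  rewrite -ler_sqr ?nnegrE ?nrm_ge0 ?mulr_ge0 ?nrm_ge0// exprMn !nrm2E.
  have [R1 I1] : Re (1 : C) = 1 /\ Im (1 : C) = 0 by [].
  rewrite !(ReB, ImB, ReD, ImD) R1 I1.
  move: (Re s) (Im s) s0 sr => u v v0 uv.
  have [u0|u0] := leP 0 u; first by nra.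
  have : 0 <= (2 * v + u) * (2 * v - u) by rewrite mulr_ge0//; lra.
  by have := sqr_ge0 (u + 13/15); nra.
have s1 : 0 < nrm (s - 1).
  by rewrite nrm_gt0// subr_eq0; apply: contraTneq s0 => ->; rewrite ltxx.
have ds : nrm (s + 1) - tau * nrm (s - 1) <= nrm (s * b - b').
  have i1 : nrm (Complex 0 1 : C) = 1.
    by apply/eqP; rewrite -(@eqrXn2 _ 2) ?nrm_ge0// nrm2E /= expr0n expr1n add0r.
  have bE2 : b = rc tau + Complex 0 1.
    by apply/eqP; rewrite eq_complex /= addr0 add0r !eqxx.
  have bE2' : b' = rc tau - Complex 0 1.
    by apply/eqP; rewrite eq_complex /= oppr0 addr0 add0r !eqxx.
  have -> : s * b - b' = Complex 0 1 * (s + 1) - (- (rc tau * (s - 1))).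
    by rewrite bE2 bE2'; ring.
  apply: le_trans (nrm_rev _ _); rewrite nrmN !nrmM i1 mul1r.
  by rewrite nrmR gtr0_norm.
rewrite E !nrmM nrmV z1 mul1r nrm_nat nrmR gtr0_norm// ltr_pdivrMr// (nrmBC (1 : C)).
have h1 : 20 * tau * nrm (s - 1) <= 1 * nrm (s - 1) by rewrite ler_wpM2r// ltW.
have h2 : 3/20 * nrm (s - 1) <= nrm (s * b - b') by lra.
have h3 : 20 * tau * nrm (s * b - b') <= eps * nrm (s * b - b') by rewrite ler_wpM2r// ltW.
have h4 : tau * (3/20 * nrm (s - 1)) <= tau * nrm (s * b - b') by rewrite ler_wpM2l// ltW.
have h5 : 0 < tau * nrm (s - 1) by rewrite mulr_gt0.
lra.
Qed.

Lemma mobV_near x : nrm x < 1 -> 20 * tau <= 1 -> nrm (x - z) <= tau / 2 ->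
  nrm (mobV x - 1) <= 2 / tau * nrm (x - z).
Proof.
move: (tau0) => t0 x1 t1 xz; have d0 := mobV_den x1; have n0 := nrm_gt0 d0.
have E : mobV x - 1 = (b - b') * (z - x) / (z * b' + x * b).
  by rewrite /mobV; field.
have [hb hb'] := nrm_b; have [bb b0] := nrm_bb.
have b2 : nrm b <= 2.
  by rewrite -ler_sqr ?nnegrE ?nrm_ge0// hb; nra.
have bd : nrm (b - b') = 2.
  apply/eqP; rewrite -(@eqrXn2 _ 2) ?nrm_ge0// nrm2E /= subrr expr0n add0r opprK.
  by apply/eqP; ring.
have dl : tau <= nrm (z * b' + x * b).
  have -> : z * b' + x * b = z * (b + b') - (z - x) * b by ring.
  apply: le_trans (nrm_rev _ _); rewrite b_sum !nrmM z1 mul1r nrm_nat nrmR gtr0_norm//.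
  by rewrite (nrmBC z); have := nrm_ge0 (x - z); nra.
rewrite E !nrmM nrmV bd (nrmBC z) ler_pdivrMr//.
apply: le_trans (ler_wpM2l _ dl); last first.
  by rewrite mulr_ge0 ?nrm_ge0// divr_ge0// ltW.
by rewrite le_eqVlt; apply/orP; left; apply/eqP; field; rewrite gt_eqF.
Qed.

End mobius.

(** * Cauchy integrals over a ray with a moving pole *)

Section J_theory.
Context {R : realType}.
Local Notation C := (CC R).
Local Notation Re := complex.Re.
Local Notation Im := complex.Im.

Definition sep (p s : C) := forall w, onray p w ->
  1/10 * (nrm w ^+ 2 + nrm s ^+ 2) <= nrm (w ^+ 2 - s ^+ 2).

Lemma sepR (s : C) : 1/50 * nrm s ^+ 2 <= (Im s - Re s) ^+ 2 -> sep dirR s.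
Proof. by move=> H w [t t0 ->]; exact: sep_dirR. Qed.

Lemma sepL (s : C) : 1/50 * nrm s ^+ 2 <= (Im s + Re s) ^+ 2 -> sep dirL s.
Proof. by move=> H w [t t0 ->]; exact: sep_dirL. Qed.

Lemma onray_sector (p w : C) : p = dirR \/ p = dirL -> onray p w -> sector w.
Proof.
by move=> pE [t t0 ->]; rewrite /sector /=; case: pE => ->; rewrite !dirE; split; lra.
Qed.

Lemma J_rbound (p s : C) (F : C -> C) (M : R) : s != 0 -> sep p s ->
  (forall w, onray p w -> nrm (F w) <= M) ->
  rbound (fun w => F w * ker w s) p (nrm s) (20 * M).
Proof.
move=> s0 ps FM; rewrite (_ : 20 * M = 2 / (1/10) * M); last by field.
by apply: rbound_ker => //; lra.
Qed.

(** 80 = 4 * 20, with 4 from [ray_bound] and 20 = 2 / (1/10) from [ker_bound]. Independence of [s]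
    keeps the extension bounded up to the boundary. *)
Lemma J_bound (p s : C) (F : C -> C) (M : R) : 0 <= M -> s != 0 -> sep p s ->
  (forall w, onray p w -> nrm (F w) <= M) -> nrm (J p s F) <= 80 * M.
Proof.
move=> M0 s0 ps FM; have M20 : 0 <= 20 * M by rewrite mulr_ge0.
have := rbound_raylim (nrm_gt0 s0) M20 (J_rbound s0 ps FM); rewrite /J; lra.
Qed.

(** Both the density and the pole may move with [y]; the lower bound [a0] on the pole keeps the
    integrands bounded along the ray. *)
Lemma J_diff {V : normedModType C} (Phi : C -> V -> C) (nu : V -> C) (p : C) (x : V)
    (r a0 M : R) : 0 < r -> 0 < a0 -> 0 <= M ->
  (forall w y, onray p w -> nrm (y - x) < r -> differentiable (Phi w) y) ->
  (forall w y, onray p w -> nrm (y - x) < r -> nrm (Phi w y) <= M) ->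
  (forall y, nrm (y - x) < r ->
    [/\ differentiable nu y, a0 <= nrm (nu y) & sep p (nu y)]) ->
  differentiable (fun y => J p (nu y) (fun w => Phi w y)) x.
Proof.
move=> r0 a00 M0 Pd PM nuP.
apply: (raylim_diff (h := fun w y => Phi w y * ker w (nu y)) (r := r) (a0 := a0)
  (a := fun y => nrm (nu y)) (B := 20 * M)) => //.
- by rewrite mulr_ge0.
- move=> w y pw yr; have [dn an sn] := nuP y yr.
  apply: difM; first exact: Pd.
  have n2 : differentiable (fun y => nu y ^+ 2) y by apply: difM.
  apply: dif_div; first by apply: difM => //; exact: dif_cst.
    by apply: difB => //; exact: dif_cst.
  apply/eqP => H; have := sn w pw; rewrite H nrm0.
  have n0 : 0 < nrm (nu y) by lra.
  by have := sqr_ge0 (nrm w); have := exprn_gt0 2 n0; lra.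
- by move=> y yr; have [_ an _] := nuP y yr.
- move=> y yr; have [_ an sn] := nuP y yr; apply: J_rbound => //.
    by apply/eqP => H; move: an; rewrite H nrm0; lra.
  by move=> w pw; exact: PM.
Qed.

End J_theory.

Section extension.
Context {R : realType} {X : completeNormedModType (CC R)}.
Local Notation C := (CC R).
Local Notation Re := complex.Re.
Local Notation Im := complex.Im.
Variable e : nat -> X.
Hypothesis e_basis : schauder_basis e.
Hypothesis e_norm : normalized e.
Variables (zc : nat -> C) (eps : R) (k : nat) (F : X -> C) (M : R).
Hypothesis eps0 : 0 < eps.
Local Notation U := (nbd e zc eps).
Hypothesis Fd : forall x, U k.+1 x -> differentiable F x.
Hypothesis FM : forall x, U k.+1 x -> nrm (F x) <= M.
Hypothesis M0 : 0 <= M.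

(** At distance [d] or more from [zc k] the right side dominates the sum of the bounds on [G] and
    [F], so only points near [zc k] matter. *)
Lemma lip_from_near (G : X -> C) (B c d : R) : 0 <= B -> 0 <= c -> 0 < d ->
  (forall x, U k x -> nrm (G x) <= B) ->
  (forall x, U k.+1 x -> nrm (coef e k x - zc k) < d ->
     nrm (G x - F x) <= c * nrm (coef e k x - zc k)) ->
  exists2 c' : R, 0 <= c' & forall x, U k.+1 x ->
    nrm (G x - F x) <= c' * nrm (coef e k x - zc k).
Proof.
move=> B0 c0 d0 GB near; have BM : 0 <= (B + M) / d.
  by rewrite divr_ge0 ?addr_ge0// ltW.
exists (c + (B + M) / d) => [|x Ux]; first by rewrite addr_ge0.
have x0 := nrm_ge0 (coef e k x - zc k).
rewrite mulrDl; have [xd|xd] := ltP (nrm (coef e k x - zc k)) d.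
  by have := near x Ux xd; have := mulr_ge0 BM x0; lra.
have h1 : B + M <= (B + M) / d * nrm (coef e k x - zc k).
  rewrite mulrAC ler_pdivlMr// ler_wpM2l// addr_ge0//.
have := nrmB (G x) (F x); have := GB x (nbdS Ux); have := FM Ux.
by have := mulr_ge0 c0 x0; lra.
Qed.

(** The error is the variation of [F] in the [k]-th coordinate alone, on a disc around [zc k] where
    [lip_disc] applies. *)
Lemma ext_interior : nrm (zc k) < 1 -> exists2 G : X -> C, bhol (U k) G &
  exists2 c : R, 0 <= c & forall x, U k.+1 x ->
    nrm (G x - F x) <= c * nrm (coef e k x - zc k).
Proof.
move=> z1; have zU x : U k x -> U k.+1 (upd e k (zc k) x).
  by move=> Ux; apply: (nbd_upd e_basis) => //; rewrite subrr nrm0.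
pose G x := F (upd e k (zc k) x).
have GM x : U k x -> nrm (G x) <= M by move=> Ux; exact/FM/zU.
exists G.
  split; last by exists M.
  move=> x Ux; apply: (@differentiable_comp _ _ _ _ (upd e k (zc k)) F); last exact/Fd/zU.
  by apply: (upd_diff e_basis e_norm k (g := fun=> zc k) (f := fun y => y)) => //; exact: dif_cst.
pose d := Num.min eps (1 - nrm (zc k)).
have d0 : 0 < d by rewrite lt_min eps0 subr_gt0.
have de : d <= eps by rewrite ge_min lexx.
have d1 : d <= 1 - nrm (zc k) by rewrite ge_min lexx orbT.
have c0 : 0 <= @lip_cst R * M / d.
  have := @disc_cst_ge0 R => dc; rewrite divr_ge0 ?(ltW d0)// mulr_ge0// /lip_cst; lra.
apply: (lip_from_near M0 c0 d0 GM) => x Ux xd.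
have inU (w : C) : nrm (w - zc k) < d -> U k.+1 (upd e k w x).
  move=> wd; apply: (nbd_upd e_basis); [exact: nbdS Ux| |lra].
  by have := nrm_rev w (zc k); lra.
have := @lip_disc R (fun w => F (upd e k w x)) (zc k) M d d0 _ _ (coef e k x) xd.
rewrite upd_id nrmBC; apply.
- move=> w wd; apply: (@differentiable_comp _ _ _ _ (fun w => upd e k w x) F); last exact/Fd/inU.
  apply: (upd_diff e_basis e_norm k (g := fun w => w) (f := fun=> x)); first exact: dif_id.
  exact: differentiable_cst.
- by move=> w wd; exact/FM/inU.
Qed.

Section boundary.
Hypothesis z1 : nrm (zc k) = 1.

Let tau : R := Num.min eps 1 / 20.

Let tauP : [/\ 0 < tau, 20 * tau <= eps & 20 * tau <= 1].
Proof.
have h : 20 * tau = Num.min eps 1 by rewrite /tau; field.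
have h1 : Num.min eps 1 <= eps by rewrite ge_min lexx.
have h2 : Num.min eps 1 <= 1 by rewrite ge_min lexx orbT.
have h3 : 0 < Num.min eps 1 by rewrite lt_min eps0 ltr01.
by split; rewrite ?h//; lra.
Qed.

Let m := mob (zc k) tau.
Let nu x : C := mobV (zc k) tau (coef e k x).
(** The [k]-th coordinate of [x] is overwritten by [m w], so for [w] in the sector this evaluates
    [F] inside [U k.+1] even when [x] is only in [U k]. *)
Let Phi (w : C) x : C := F (upd e k (m w) x).

Let inU x w : U k x -> sector w -> U k.+1 (upd e k (m w) x).
Proof.
have [t0 t1 t2] := tauP; move=> Ux sw; apply: (nbd_upd e_basis) => //.
  by apply: mob_lt1 => //; case: sw.
exact: mob_near.
Qed.

Let xk1 x : U k x -> nrm (coef e k x) < 1.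
Proof. by case=> /polydiscP. Qed.

Let nuI x : U k x -> 0 < Im (nu x).
Proof. by have [t0 _ _] := tauP; move=> /xk1; exact: mobV_Im. Qed.

Let m_nu x : U k x -> m (nu x) = coef e k x.
Proof. by have [t0 _ _] := tauP; move=> /xk1; exact: mobVK. Qed.

Let Phi_nu x : U k x -> Phi (nu x) x = F x.
Proof. by move=> Ux; rewrite /Phi m_nu// upd_id. Qed.

Let nu_dif x : U k x -> differentiable nu x.
Proof.
have [t0 _ _] := tauP; move=> /xk1 x1.
apply: (@differentiable_comp _ _ _ _ (coef e k) (mobV (zc k) tau)).
  exact: coef_diff.
exact: mobV_dif.
Qed.

Let Phi_difx x w : U k x -> sector w -> differentiable (Phi w) x.
Proof.
move=> Ux sw; apply: (@differentiable_comp _ _ _ _ (upd e k (m w)) F); last exact/Fd/inU.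
by apply: (upd_diff e_basis e_norm k (g := fun=> m w) (f := fun y => y)) => //; exact: dif_cst.
Qed.

Let Phi_difw x w : U k x -> sector w -> differentiable (Phi^~ x) w.
Proof.
have [t0 _ _] := tauP; move=> Ux sw.
apply: (@differentiable_comp _ _ _ _ (fun w => upd e k (m w) x) F); last exact/Fd/inU.
apply: (upd_diff e_basis e_norm k (g := m) (f := fun=> x)); last exact: differentiable_cst.
by apply: mob_dif => //; case: sw.
Qed.

Let PhiM x w : U k x -> sector w -> nrm (Phi w x) <= M.
Proof. by move=> Ux sw; exact/FM/inU. Qed.

Let JR x := J dirR (nu x) (Phi^~ x).
Let JL x := J dirL (nu x) (Phi^~ x).
Let K0 x := J dirL 1 (Phi^~ x).
Let c : C := 2 * Jcst.

Let formula x : U k x -> middle (nu x) -> JL x - JR x = c * F x.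
Proof.
move=> Ux mx; rewrite /JL /JR (@sector_formula _ (Phi^~ x) M (nu x)) ?Phi_nu//.
- by move=> w; exact: Phi_difw.
- by move=> w; exact: PhiM.
Qed.

Let sep1 (s : C) : nrm (s - 1) < 1/4 -> s != 0 /\ sep dirL s.
Proof.
move=> s1; have := Re_le_nrm (s - 1); have := Im_le_nrm (s - 1).
have [R1 I1] : Re (1 : C) = 1 /\ Im (1 : C) = 0 by [].
rewrite ReB ImB R1 I1 subr0 !ler_norml => /andP[i1 i2] /andP[r1 r2]; split.
  apply/eqP => s0.
  by move: s1; rewrite s0 sub0r nrmN nrm1; lra.
apply: sepL; rewrite nrm2E; nra.
Qed.

Let G x : C := c^-1 * ((if 0 <= Re (nu x) then c * F x - JL x else - JR x) + K0 x).

Let near_nu x (P : C -> Prop) (d : R) : U k x -> 0 < d ->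
  (forall s, nrm (s - nu x) < d -> P s) ->
  exists2 r : R, 0 < r & forall y, nrm (y - x) < r -> U k y /\ P (nu y).
Proof.
move=> Ux d0 HP; have [r1 r10 H1] := nbd_open e_basis e_norm Ux.
have /cont_nrmP/(_ d d0)[r2 r20 H2] := differentiable_continuous (nu_dif Ux).
exists (Num.min r1 r2) => [|y]; first by rewrite lt_min r10.
by rewrite lt_min => /andP[/H1 Uy /H2 /HP].
Qed.

(* In the half-plane coordinate nu, where zc k sits at 1, Cauchy's formula reads
   c * F = JL - JR between the two rays. G is -JR / c, continued across dirR as
   F - JL / c; the constant K0 / c makes G - F vanish at nu = 1. *)
Lemma ext_boundary : exists2 G : X -> C, bhol (U k) G &
  exists2 c : R, 0 <= c & forall x, U k.+1 x ->
    nrm (G x - F x) <= c * nrm (coef e k x - zc k).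
Proof.
have [t0 t1 t2] := tauP.
have c0 : c != 0 by rewrite mulf_neq0 ?Jcst_neq0// pnatr_eq0.
have nc : 0 < nrm c := nrm_gt0 c0.
have oR w : onray dirR w -> sector w by exact: (onray_sector (or_introl erefl)).
have oL w : onray dirL w -> sector w by exact: (onray_sector (or_intror erefl)).
have nn x : U k x -> nu x != 0 by move=> /nuI; exact: Imgt0_neq0.
have d11 : nrm ((1 : C) - 1) < 1/4 by rewrite subrr nrm0; lra.
have [one0 one_sep] := sep1 d11.
(* Where Im + 4 Re > 0 the pole is clear of [dirL] and lies in the sector; where Im - 4 Re > 0 it is
   clear of [dirR]. The two regions overlap inside [middle], where both expressions for [G] agree by
   [formula]. *)
have gL x : U k x -> 0 < Im (nu x) + 4 * Re (nu x) -> sep dirL (nu x).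
  move=> Ux h; have := nuI Ux => i0; apply: sepL; rewrite nrm2E.
  by move: h i0; move: (Re (nu x)) (Im (nu x)) => a b; nra.
have gR x : U k x -> 0 < Im (nu x) - 4 * Re (nu x) -> sep dirR (nu x).
  move=> Ux h; have := nuI Ux => i0; apply: sepR; rewrite nrm2E.
  by move: h i0; move: (Re (nu x)) (Im (nu x)) => a b; nra.
have inUS x : U k x -> 0 < Im (nu x) + 4 * Re (nu x) -> U k.+1 x.
  move=> Ux h; rewrite -[x](upd_id e k x) -(m_nu Ux); apply: inU => //.
  by have := nuI Ux; split=> //; lra.
have K0b x : U k x -> nrm (K0 x) <= 80 * M.
  by move=> Ux; apply: J_bound => // w /oL; exact: PhiM.
have JLb x : U k x -> 0 < Im (nu x) + 4 * Re (nu x) -> nrm (JL x) <= 80 * M.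
  by move=> Ux h; apply: J_bound; rewrite ?nn//; [exact: gL|move=> w /oL; exact: PhiM].
have JRb x : U k x -> 0 < Im (nu x) - 4 * Re (nu x) -> nrm (JR x) <= 80 * M.
  by move=> Ux h; apply: J_bound; rewrite ?nn//; [exact: gR|move=> w /oR; exact: PhiM].
pose B := (nrm c)^-1 * (nrm c * M + 160 * M).
have B0 : 0 <= B.
  by rewrite mulr_ge0 ?invr_ge0 ?(ltW nc)// addr_ge0 ?mulr_ge0 ?(ltW nc).
have GB x : U k x -> nrm (G x) <= B.
  move=> Ux; rewrite /G nrmM nrmV; apply: ler_wpM2l; first by rewrite invr_ge0 (ltW nc).
  apply: (le_trans (nrmD _ _)).
  have -> : nrm c * M + 160 * M = nrm c * M + 80 * M + 80 * M by ring.
  apply: lerD; last exact: K0b.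
  have h2 := nuI Ux; case: ifPn => [r0|].
    have h4 : 0 < Im (nu x) + 4 * Re (nu x) by move: (Re _) (Im _) r0 h2 => a b *; lra.
    apply: (le_trans (nrmB _ _)); apply: lerD; last exact: JLb.
    by rewrite nrmM; apply: ler_wpM2l; [exact: ltW nc|exact/FM/inUS].
  rewrite -ltNge nrmN => r0.
  have h4 : 0 < Im (nu x) - 4 * Re (nu x) by move: (Re _) (Im _) r0 h2 => a b *; lra.
  by apply: (le_trans (JRb x Ux h4)); rewrite lerDr; exact: mulr_ge0 (ltW nc) M0.
exists G.
  split; last by exists B.
  move=> x Ux; have i0 := nuI Ux; have n0 := nrm_gt0 (nn x Ux).
  (* [sg] is 4 or -4 according to the region; the divisor 5 is 1 + 4, the largest change of Im + sg
     Re per unit distance. *)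
  have near_gen (sg : R) : `|sg| <= 4 -> 0 < Im (nu x) + sg * Re (nu x) ->
      exists2 r : R, 0 < r & forall y, nrm (y - x) < r -> U k y /\
        (nrm (nu x) / 2 <= nrm (nu y) /\ 0 < Im (nu y) + sg * Re (nu y)).
    move=> sg4 h; set t := Im (nu x) + sg * Re (nu x) in h.
    apply: (@near_nu x (fun s => nrm (nu x) / 2 <= nrm s /\ 0 < Im s + sg * Re s)
      (Num.min (nrm (nu x) / 2) (t / 5)) Ux).
      by rewrite lt_min !divr_gt0.
    move=> s; rewrite lt_min => /andP[s1 s2]; split.
      by have := nrm_rev (nu x) s; rewrite (nrmBC (nu x)); lra.
    have := Re_le_nrm (s - nu x); have := Im_le_nrm (s - nu x).
    rewrite ReB ImB => h1 h2; have := ler_norm (sg * (Re (nu x) - Re s)).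
    rewrite normrM (distrC (Re (nu x))) => h3; move: h1; rewrite ler_norml => /andP[h1 _].
    have h4 : `|sg| * `|Re s - Re (nu x)| <= 4 * nrm (s - nu x).
      by rewrite ler_pM ?normr_ge0.
    rewrite /t in s2 *; lra.
  have K0d : differentiable K0 x.
    have [r r0 H] := nbd_open e_basis e_norm Ux.
    apply: (J_diff (nu := fun=> 1) r0 ltr01 M0).
    - by move=> w y /oL sw /H Uy; exact: Phi_difx.
    - by move=> w y /oL sw /H Uy; exact: PhiM.
    - by move=> y yr; split; rewrite ?nrm1//; exact: dif_cst.
  have [r0|r0] := leP 0 (Re (nu x)).
    have h : 0 < Im (nu x) + 4 * Re (nu x) by lra.
    have sg4 : `|4| <= 4 :> R by rewrite ger0_norm.
    have [r rp H] := near_gen 4 sg4 h.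
    apply: (near_diff (G := fun y => c^-1 * ((c * F y - JL y) + K0 y))).
      exists r => // y /H[Uy [_ hy]]; rewrite /G; case: ifPn => //.
      rewrite -ltNge => ry; congr (_ * (_ + _)); rewrite -formula//; first by ring.
      by split; [exact: nuI|rewrite ltr0_norm//; lra].
    apply: difM; first exact: dif_cst.
    apply: difD; last exact: K0d.
    apply: difB.
      by apply: difM; [exact: dif_cst|exact/Fd/inUS].
    have n2 : 0 < nrm (nu x) / 2 by rewrite divr_gt0.
    apply: (J_diff rp n2 M0).
    - by move=> w y /oL sw /H[Uy _]; exact: Phi_difx.
    - by move=> w y /oL sw /H[Uy _]; exact: PhiM.
    - by move=> y /H[Uy [ny hy]]; split; [exact: nu_dif|exact: ny|exact: gL].
  have h : 0 < Im (nu x) + (-4) * Re (nu x) by lra.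
  have sg4 : `|-4| <= 4 :> R by rewrite normrN ger0_norm.
  have [r rp H] := near_gen (-4) sg4 h.
  apply: (near_diff (G := fun y => c^-1 * (- JR y + K0 y))).
    exists r => // y /H[Uy [_ hy]]; rewrite /G; case: ifPn => // ry.
    congr (_ * (_ + _)); rewrite -formula//; first by ring.
    by split; [exact: nuI|rewrite ger0_norm//; lra].
  apply: difM; first exact: dif_cst.
  apply: difD; last exact: K0d.
  apply: (@differentiableN _ _ _ JR).
  have n2 : 0 < nrm (nu x) / 2 by rewrite divr_gt0.
  apply: (J_diff rp n2 M0).
  - by move=> w y /oR sw /H[Uy _]; exact: Phi_difx.
  - by move=> w y /oR sw /H[Uy _]; exact: PhiM.
  - by move=> y /H[Uy [ny hy]]; split; [exact: nu_dif|exact: ny|apply: gR => //; lra].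
have lc0 : 0 <= @lip_cst R by have := @disc_cst_ge0 R; rewrite /lip_cst; lra.
have d0 : 0 < tau / 8 by lra.
pose L := (nrm c)^-1 * (@lip_cst R * (80 * M) / (1/4) * (2 / tau)).
have L0 : 0 <= L.
  have q1 : 0 <= @lip_cst R * (80 * M) by rewrite mulr_ge0// mulr_ge0.
  have q2 : 0 <= 1/4 :> R by rewrite divr_ge0.
  have q3 : 0 <= 2 / tau by rewrite divr_ge0// ltW.
  apply: mulr_ge0; first by rewrite invr_ge0 ltW.
  by apply: mulr_ge0 => //; apply: divr_ge0.
apply: (lip_from_near B0 L0 d0 GB) => x Ux xd; have Ux' := nbdS Ux.
have h1 : nrm (nu x - 1) <= 2 / tau * nrm (coef e k x - zc k).
  by apply: mobV_near => //; [exact: xk1|lra].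
have h2 : nrm (nu x - 1) < 1/4.
  apply: (le_lt_trans h1); rewrite mulrAC ltr_pdivrMr//; lra.
have rx : 0 <= Re (nu x).
  have := Re_le_nrm (nu x - 1); have R1 : Re (1 : C) = 1 by [].
  by rewrite ReB R1 ler_norml => /andP[? _]; lra.
(* With the density [Phi^~ x] fixed, [JL x] and [K0 x] differ only in the pole, [nu x] against 1, so
   [lip_disc] in the pole variable gives the estimate. *)
have -> : G x - F x = - c^-1 * (JL x - K0 x).
  by rewrite /G rx; field.
rewrite nrmM nrmN nrmV /L -[X in _ <= X]mulrA; apply: ler_wpM2l.
  by rewrite invr_ge0 ltW.
apply: (@le_trans _ _ (@lip_cst R * (80 * M) / (1/4) * nrm (nu x - 1))); last first.
  have q1 : 0 <= @lip_cst R * (80 * M) by rewrite mulr_ge0// mulr_ge0.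
  have q2 : 0 <= 1/4 :> R by rewrite divr_ge0.
  by rewrite -[X in _ <= X]mulrA; apply: ler_wpM2l => //; apply: divr_ge0.
have q0 : 0 < 1/4 :> R by lra.
apply: (@lip_disc R (fun s => J dirL s (Phi^~ x)) 1 (80 * M) (1/4) q0) => //.
- move=> s s1; have r0 : 0 < 1/4 - nrm (s - 1) by lra.
  apply: (J_diff (Phi := fun w _ => Phi w x) (nu := fun s => s) (a0 := 1/2) r0 _ M0).
  + lra.
  + by move=> w y _ _; exact: dif_cst.
  + by move=> w y /oL sw _; exact: PhiM.
  + move=> y ys; have y1 : nrm (y - 1) < 1/4 by have := nrm_tri s y 1; lra.
    split; [exact: dif_id| |exact: (sep1 y1).2].
    by have := nrm_rev (1 : C) y; rewrite nrm1 (nrmBC (1 : C) y); lra.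
- move=> s s1; have [s0 ss] := sep1 s1.
  by apply: J_bound => // w /oL; exact: PhiM.
Qed.

End boundary.

End extension.

(** * Division by a coordinate *)

Section division.
Context {R : realType}.
Local Notation C := (CC R).

(** Both increments are compared with the derivative at [c]. The error is quadratic in the steps, so
    a sum over n nodes with steps of order 1/n still tends to 0. *)
Lemma quot_disc (g : C -> C) (c : C) (M rho : R) (s t : C) : 0 < rho ->
  (forall w, nrm (w - c) < rho -> differentiable g w) ->
  (forall w, nrm (w - c) < rho -> nrm (g w) <= M) ->
  t != 0 -> nrm s <= rho / 32 -> nrm t <= rho / 32 ->
  nrm (g (c + s) - g c - s * ((g (c + t) - g c) / t)) <=
    @disc_cst R * M / rho ^+ 2 * (nrm s * (nrm s + nrm t)).
Proof.
move=> r0 gd gM t0 sr tr.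
have sh (v : C) : nrm v < rho -> nrm (v + c - c) < rho by rewrite addrK.
have [||D DP] := @taylor_disc R (fun v => g (v + c)) M rho r0.
- move=> w wr; apply: (@differentiable_comp _ _ _ _ (fun v => v + c) g); last exact/gd/sh.
  by apply: difD; [exact: dif_id|exact: dif_cst].
- by move=> w wr; exact/gM/sh.
have nt : 0 < nrm t := nrm_gt0 t0.
have hs := DP s sr; have ht := DP t tr; rewrite add0r in hs ht.
rewrite (_ : _ - _ = (g (s + c) - g c - D * s) - s * ((g (t + c) - g c - D * t) / t)); last first.
  by rewrite (addrC c s) (addrC c t); field.
apply: (le_trans (nrmB _ _)); rewrite !nrmM nrmV.
have h1 : nrm (g (t + c) - g c - D * t) / nrm t <= @disc_cst R * M / rho ^+ 2 * nrm t.
  rewrite ler_pdivrMr//; apply: (le_trans ht); rewrite le_eqVlt; apply/orP; left.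
  by apply/eqP; field; rewrite gt_eqF.
have h2 := ler_wpM2l (nrm_ge0 s) h1.
have h3 : @disc_cst R * M * (nrm s / rho) ^+ 2 = @disc_cst R * M / rho ^+ 2 * (nrm s * nrm s).
  by field; rewrite gt_eqF.
rewrite h3 in hs; rewrite mulrDr mulrDr; apply: lerD => //.
by apply: (le_trans h2); rewrite mulrCA.
Qed.

Lemma nrm_sum n (F : 'I_n -> C) :
  nrm (\sum_(j < n) F j) <= \sum_(j < n) nrm (F j).
Proof.
elim/big_ind2 : _ => [|x a y b xa yb|//]; first by rewrite nrm0.
by apply: (le_trans (nrmD _ _)); exact: lerD.
Qed.

End division.

Section division_theorem.
Context {R : realType} {X : completeNormedModType (CC R)}.
Local Notation C := (CC R).
Variable e : nat -> X.
Hypothesis e_basis : schauder_basis e.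
Hypothesis e_norm : normalized e.
Variables (k : nat) (zk : C) (u : X -> C) (M : R).
Hypothesis z1 : nrm zk < 1.
Hypothesis ud : forall x, polydisc e x -> differentiable u x.
Hypothesis uM : forall x, polydisc e x -> nrm (u x) <= M.
Hypothesis uz : forall x, polydisc e x -> u (upd e k zk x) = 0.

Let b (x : X) : C := coef e k x - zk.
(** Discs of radius [32 * rho] around points within [rho] of [zk] stay in the unit disc, and on them
    the Taylor estimate covers increments up to [rho]. *)
Let rho : R := (1 - nrm zk) / 64.
Let t n : C := (rho / n.+1%:R)%:C%C.
Let node n j (x : X) : C := zk + j%:R * (b x / n.+1%:R).
(* q n is a Riemann sum, over the segment from zk to coef e k x, of difference
   quotients of step t n; its ultralimit is u x / b x. *)
Let quot n j x : C :=
  (u (upd e k (node n j x + t n) x) - u (upd e k (node n j x) x)) / t n.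
Let q n x : C := n.+1%:R^-1 * \sum_(j < n.+1) quot n j x.

Let rho0 : 0 < rho. Proof. by move: z1; rewrite /rho; lra. Qed.

Let nrm_t n : nrm (t n) = rho / n.+1%:R.
Proof. by rewrite nrmR ger0_norm// divr_ge0// ltW. Qed.

Let t_neq0 n : t n != 0.
Proof.
apply/eqP => t0; have := nrm_t n; rewrite t0 nrm0 => h.
have : 0 < rho / n.+1%:R :> R by rewrite divr_gt0.
by rewrite -h ltxx.
Qed.

Let inv1 n : n.+1%:R^-1 <= 1 :> R.
Proof. by rewrite invf_le1// ler1n. Qed.

Let t_rho n : nrm (t n) <= rho.
Proof. by rewrite nrm_t ler_piMr// ltW. Qed.

Let node_le n j x : (j <= n.+1)%N -> nrm (b x) < rho -> nrm (node n j x) < nrm zk + rho.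
Proof.
move=> jn bx; apply: (le_lt_trans (nrmD _ _)); rewrite ltrD2l; apply: le_lt_trans bx.
rewrite nrmM nrmM nrmV !nrm_nat mulrCA ler_piMr ?nrm_ge0//.
by rewrite ler_pdivrMr// mul1r ler_nat.
Qed.

Let in_polydisc x (w : C) : polydisc e x -> nrm w < 1 -> polydisc e (upd e k w x).
Proof.
move=> /polydiscP xD w1; apply/polydiscP => j; rewrite (coef_upd e_basis).
by case: eqP.
Qed.

Let slice_dif x (w : C) : polydisc e x -> nrm w < 1 ->
  differentiable (fun w => u (upd e k w x)) w.
Proof.
move=> xD w1; apply: (@differentiable_comp _ _ _ _ (fun w => upd e k w x) u).
  apply: (upd_diff e_basis e_norm k (g := fun w => w) (f := fun=> x)); first exact: dif_id.
  exact: differentiable_cst.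
exact/ud/in_polydisc.
Qed.

Let slice_disc x n j (w : C) : polydisc e x -> nrm (b x) < rho -> (j <= n.+1)%N ->
  nrm (w - node n j x) < 32 * rho -> nrm w < 1.
Proof.
move=> xD bx jn wn; have := nrm_rev w (node n j x); have := node_le jn bx.
by move: wn z1; rewrite /rho; lra.
Qed.

Let rho32 : 0 < 32 * rho. Proof. by rewrite mulr_gt0. Qed.

Let L : R := @lip_cst R * M / (32 * rho).

Let quot_bound n j x : polydisc e x -> nrm (b x) < rho -> (j <= n.+1)%N ->
  nrm (quot n j x) <= L.
Proof.
move=> xD bx jn; rewrite /quot nrmM nrmV ler_pdivrMr ?nrm_gt0//.
have := @lip_disc R (fun w => u (upd e k w x)) (node n j x) M (32 * rho) rho32 _ _
  (node n j x + t n).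
rewrite addrC addKr; apply.
- by move=> w /(slice_disc xD bx jn); exact: slice_dif.
- by move=> w /(slice_disc xD bx jn) w1; exact/uM/in_polydisc.
- by have := t_rho n; move: rho0; lra.
Qed.

Let q_bound n x : polydisc e x -> nrm (b x) < rho -> nrm (q n x) <= L.
Proof.
move=> xD bx; rewrite /q nrmM nrmV nrm_nat ler_pdivrMl//.
apply: (le_trans (nrm_sum (fun j : 'I_n.+1 => quot n j x))); rewrite mulr_natl -[X in _ *+ X]card_ord -sumr_const.
by apply: ler_sum => j _; apply: quot_bound => //; exact: ltnW.
Qed.

Let K : R := @disc_cst R * M / (32 * rho) ^+ 2.

(** [u x] telescopes over the nodes because [u] vanishes where the coordinate is [zk]. The factor
    [nrm (b x)] is kept so that the error can afterwards be divided by [b x]. *)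
Let q_error n x : polydisc e x -> nrm (b x) < rho ->
  nrm (u x - b x * q n x) <= K * nrm (b x) * (2 * rho) / n.+1%:R.
Proof.
move=> xD bx; have b0 := nrm_ge0 (b x); have n0 : 0 < n.+1%:R :> R by [].
have nC : (n.+1%:R : C) != 0 by rewrite pnatr_eq0.
set s : C := b x / n.+1%:R.
have ns : nrm s = nrm (b x) / n.+1%:R by rewrite nrmM nrmV nrm_nat.
have nodeS j : node n j.+1 x = node n j x + s.
  by rewrite /node -/s -natr1 mulrDl mul1r addrA.
have tel : u x = \sum_(j < n.+1) (u (upd e k (node n j x + s) x) - u (upd e k (node n j x) x)).
  rewrite -(big_mkord xpredT (fun j => u (upd e k (node n j x + s) x) - u (upd e k (node n j x) x))).
  under eq_bigr => j _ do rewrite -nodeS.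
  rewrite telescope_sumr// {2}/node mul0r addr0 uz// subr0 /node.
  by rewrite mulrCA divff// mulr1 /b addrC subrK upd_id.
have -> : b x * q n x = \sum_(j < n.+1) s * quot n j x.
  by rewrite /q mulrA mulr_sumr.
rewrite [in u x]tel -sumrB; apply: (le_trans (nrm_sum _)).
have st : nrm s * (nrm s + nrm (t n)) <= nrm (b x) / n.+1%:R * (2 * rho / n.+1%:R).
  rewrite ns; apply: ler_wpM2l; first by rewrite divr_ge0.
  by rewrite nrm_t -mulrDl ler_pM2r ?invr_gt0//; lra.
have K0 : 0 <= K.
  have M0 := le_trans (nrm_ge0 _) (uM xD).
  by rewrite divr_ge0 ?exprn_ge0 ?(ltW rho32)// mulr_ge0// disc_cst_ge0.
rewrite [X in _ <= X](_ : _ =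
    \sum_(j < n.+1) K * (nrm (b x) / n.+1%:R * (2 * rho / n.+1%:R))); last first.
  by rewrite sumr_const card_ord -mulr_natl; field; rewrite gt_eqF.
apply: ler_sum => j _; apply: le_trans (ler_wpM2l K0 st).
have jn : (j <= n.+1)%N := ltnW (ltn_ord j).
apply: (@quot_disc R (fun w => u (upd e k w x)) (node n j x) M (32 * rho)) => //.
- by move=> w /(slice_disc xD bx jn); exact: slice_dif.
- by move=> w /(slice_disc xD bx jn) w1; exact/uM/in_polydisc.
- rewrite ns mulrAC divff ?mul1r; last by rewrite pnatr_eq0.
  by apply: le_trans (ltW bx); rewrite ler_piMr.
- by rewrite mulrAC divff ?mul1r ?pnatr_eq0.
Qed.

Let q_dif n x : polydisc e x -> nrm (b x) < rho -> differentiable (q n) x.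
Proof.
move=> xD bx; have bd : differentiable b x.
  by apply: difB; [exact: coef_diff|exact: dif_cst].
have ndd j : differentiable (node n j) x.
  apply: difD; first exact: dif_cst.
  by apply: difM; [exact: dif_cst|apply: difM => //; exact: dif_cst].
apply: difM; first exact: dif_cst.
apply: (dif_sum (F := fun j y => quot n j y)) => j.
have jn : (j <= n.+1)%N := ltnW (ltn_ord j).
have sl (g : X -> C) : differentiable g x -> nrm (g x - node n j x) < 32 * rho ->
    differentiable (fun y => u (upd e k (g y) y)) x.
  move=> gd /(slice_disc xD bx jn) g1.
  apply: (@differentiable_comp _ _ _ _ (fun y => upd e k (g y) y) u).
    by apply: (upd_diff e_basis e_norm k (g := g) (f := fun y => y)).
  exact/ud/in_polydisc.
apply: difM; last exact: dif_cst.
apply: difB; apply: sl.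
- by apply: difD; [exact: ndd|exact: dif_cst].
- by rewrite addrC addKr; have := t_rho n; move: rho0; lra.
- exact: ndd.
- by rewrite subrr nrm0.
Qed.

(** Near the zero set of [b] the quotient is the ultralimit of [q], elsewhere it is [u / b]. The two
    agree wherever [b] does not vanish, so around every point one of them gives
    differentiability. *)
Lemma division : exists2 h : X -> C, bhol (polydisc e) h &
  forall x, polydisc e x -> u x = (coef e k x - zk) * h x.
Proof.
pose h x := if nrm (b x) < rho then ulim Uoo (q^~ x) else u x / b x.
have h_off x : polydisc e x -> b x != 0 -> h x = u x / b x.
  move=> xD b0; rewrite /h; case: ifPn => // bx.
  apply: ulim_unique => d d0; have nb := nrm_gt0 b0.
  pose A := K * (2 * rho); apply: (@Uoo_ge (Num.truncn (A / d)).+1) => n nA /=.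
  have An : A / d < n.+1%:R by rewrite (lt_le_trans (truncnS_gt _))// ler_nat ltnW.
  have -> : q n x - u x / b x = - (u x - b x * q n x) / b x by field.
  rewrite nrmM nrmN nrmV ltr_pdivrMr//; apply: (le_lt_trans (q_error n xD bx)).
  rewrite ltr_pdivrMr// [X in X < _](_ : _ = A * nrm (b x)); last by rewrite /A; ring.
  by rewrite [X in _ < X]mulrAC ltr_pM2r// mulrC -ltr_pdivrMr.
exists h.
  split; last first.
    exists (Num.max L (M / rho)) => x xD; rewrite /h; case: ifPn => [bx|].
      by rewrite le_max ulim_nrm// => n; exact: q_bound.
    rewrite -leNgt => bx; have b0 : 0 < nrm (b x) by move: rho0; lra.
    rewrite le_max; apply/orP; right; rewrite nrmM nrmV.
    have M0 := le_trans (nrm_ge0 _) (uM xD).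
    by apply: ler_pM; rewrite ?invr_ge0 ?nrm_ge0 ?uM// lef_pV2.
  move=> x xD; have bd : differentiable b x.
    by apply: difB; [exact: coef_diff|exact: dif_cst].
  have [r1 r10 H1] : exists2 r : R, 0 < r & forall y, nrm (y - x) < r -> polydisc e y.
    have xD0 : nbd e (fun=> 0) 1 0 x by rewrite nbd0.
    have [r r0 H] := nbd_open e_basis e_norm xD0.
    by exists r; [exact: r0|move=> y /H; exact: nbd_polydisc].
  have near (d : R) : 0 < d -> exists2 r : R, 0 < r & forall y, nrm (y - x) < r ->
      polydisc e y /\ nrm (b y - b x) < d.
    move=> d0; have /cont_nrmP/(_ d d0)[r2 r20 H2] := differentiable_continuous bd.
    exists (Num.min r1 r2) => [|y]; first by rewrite lt_min r10.
    by rewrite lt_min => /andP[/H1 Dy /H2].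
  have [bx|bx] := ltP (nrm (b x)) rho.
    have [r r0 H] : exists2 r : R, 0 < r & forall y, nrm (y - x) < r ->
        polydisc e y /\ nrm (b y) < rho.
      have d0 : 0 < rho - nrm (b x) by rewrite subr_gt0.
      have [r r0 H] := near _ d0; exists r; first exact: r0.
      move=> y /H[Dy by']; split; first exact: Dy.
      by move: (le_lt_trans (nrm_rev (b y) (b x)) by'); rewrite ltrD2r.
    apply: (near_diff (G := fun y => ulim Uoo (q^~ y))).
      by exists r; [exact: r0|move=> y /H[Dy by']; rewrite /h by'].
    apply: (ulim_diff (r := r) (M := L) r0) => n y /H[Dy by']; first exact: q_dif.
    exact: q_bound.
  have nb : 0 < nrm (b x) by move: rho0; lra.
  have b0 : b x != 0 by apply/eqP => b0; rewrite b0 nrm0 ltxx in nb.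
  have [r r0 H] := near _ nb.
  apply: (near_diff (G := fun y => u y / b y)).
    exists r; first exact: r0.
    move=> y /H[Dy by']; apply: h_off; first exact: Dy.
    apply/eqP => y0.
    by rewrite y0 sub0r nrmN ltxx in by'.
  by apply: dif_div; [exact: ud|exact: bd|exact: b0].
move=> x xD; have [b0|b0] := eqVneq (b x) 0; last by rewrite h_off// mulrC divfK.
rewrite -/(b x) b0 mul0r -(uz xD); congr u.
by move/eqP: b0; rewrite subr_eq0 => /eqP <-; rewrite upd_id.
Qed.

End division_theorem.

(** * Approximate inverses on the whole polydisc *)

Section approximate_inverse.
Context {R : realType} {X : completeNormedModType (CC R)}.
Local Notation C := (CC R).
Variable e : nat -> X.
Hypothesis e_basis : schauder_basis e.
Hypothesis e_norm : normalized e.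
Variables (zc : nat -> C) (eps : R).
Hypothesis eps0 : 0 < eps.
Hypothesis z1 : forall k, nrm (zc k) <= 1.
Local Notation U := (nbd e zc eps).

Definition dist n (x : X) : R := \sum_(j < n) nrm (coef e j x - zc j).

Lemma dist_ge0 n x : 0 <= dist n x.
Proof. by apply: sumr_ge0 => j _; exact: nrm_ge0. Qed.

(** The last coordinate is released first. Its error is estimated on [U n.+1], which lies in [U n],
    where the induction estimates the errors of the others. *)
Lemma extension n (F : X -> C) : bhol (U n) F -> exists2 G : X -> C, bhol (polydisc e) G &
  exists2 c : R, 0 <= c & forall x, U n x -> nrm (G x - F x) <= c * dist n x.
Proof.
elim: n F => [|n IH] F [Fd [M FM]].
  exists F; first by rewrite nbd0 in Fd FM; split=> //; exists M.
  by exists 0 => // x _; rewrite subrr nrm0 mul0r.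
have [G1 G1b [c c0 G1F]] : exists2 G : X -> C, bhol (U n) G &
    exists2 c : R, 0 <= c & forall x, U n.+1 x ->
      nrm (G x - F x) <= c * nrm (coef e n x - zc n).
  have FM' x : U n.+1 x -> nrm (F x) <= Num.max M 0 by move=> /FM; rewrite le_max => ->.
  have M0 : 0 <= Num.max M 0 by rewrite le_max lexx orbT.
  have := z1 n; rewrite le_eqVlt => /orP[/eqP zn|zn].
    exact: (ext_boundary e_basis e_norm eps0 Fd FM' M0 zn).
  exact: (ext_interior e_basis e_norm eps0 Fd FM' M0 zn).
have [G Gb [d d0 GG1]] := IH G1 G1b; exists G => //.
exists (c + d) => [|x Ux]; first exact: addr_ge0.
apply: (le_trans (nrm_tri (G1 x) _ _)).
rewrite /dist big_ord_recr /= -/(dist n x); have h := dist_ge0 n x.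
have h1 := GG1 x (nbdS Ux); have h2 := G1F x Ux; have h3 := mulr_ge0 c0 h.
have h4 := mulr_ge0 d0 (nrm_ge0 (coef e n x - zc n)); lra.
Qed.

(** On [U n] the error is F times the difference between G and 1/F. Off [U n] some coordinate is
    [eps] away from its target, so [dist] is at least [eps] and boundedness suffices. *)
Lemma approximate_inverse n (F : X -> C) (delta : R) : 0 < delta ->
  bhol (polydisc e) F -> (forall x, U n x -> delta <= nrm (F x)) ->
  exists2 G : X -> C, bhol (polydisc e) G & exists2 c : R, 0 <= c &
    forall x, polydisc e x -> nrm (1 - F x * G x) <= c * dist n x.
Proof.
move=> de [Fd [M FM]] Fde.
have F0 x : U n x -> F x != 0.
  by move=> /Fde h; apply/eqP => F0; move: h; rewrite F0 nrm0; lra.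
have [|G [Gd [B GB]] [c c0 GF]] := @extension n (fun x => (F x)^-1).
  split=> [x Ux|]; first by apply: difV; [exact/Fd/(nbd_polydisc Ux)|exact: F0].
  exists delta^-1 => x Ux; rewrite nrmV lef_pV2 ?Fde// posrE.
  exact: lt_le_trans (Fde x Ux).
exists G; first by split=> //; exists B.
have d0 := dist_ge0 n; pose M' := Num.max M 0; pose B' := Num.max B 0.
have M0 : 0 <= M' by rewrite le_max lexx orbT.
have B0 : 0 <= B' by rewrite le_max lexx orbT.
have FM' x : polydisc e x -> nrm (F x) <= M' by move=> /FM; rewrite le_max => ->.
have GB' x : polydisc e x -> nrm (G x) <= B' by move=> /GB; rewrite le_max => ->.
have q0 : 0 <= (1 + M' * B') / eps by rewrite divr_ge0 ?(ltW eps0)// addr_ge0// mulr_ge0.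
exists (M' * c + (1 + M' * B') / eps) => [|x xD]; first by rewrite addr_ge0// mulr_ge0.
rewrite mulrDl; have [Ux|Ux] := pselect (U n x).
  apply: (@le_trans _ _ (M' * c * dist n x)); last by rewrite lerDl mulr_ge0.
  rewrite (_ : 1 - F x * G x = - (F x * (G x - (F x)^-1))); last by field; exact: F0.
  by rewrite nrmN nrmM -mulrA; apply: ler_pM; rewrite ?nrm_ge0 ?FM' ?GF.
have far : eps <= dist n x.
  rewrite leNgt; apply/negP => h; apply: Ux; split=> // j jn; apply: le_lt_trans h.
  rewrite /dist (bigD1 (Ordinal jn))//= lerDl; apply: sumr_ge0 => i _; exact: nrm_ge0.
apply: (@le_trans _ _ ((1 + M' * B') / eps * dist n x)); last first.
  by rewrite lerDr !mulr_ge0.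
apply: (@le_trans _ _ (1 + M' * B')).
  apply: (le_trans (nrmB _ _)); rewrite nrm1 lerD2l nrmM.
  by apply: ler_pM; rewrite ?nrm_ge0 ?FM' ?GB'.
rewrite mulrAC ler_pdivlMr// ler_wpM2l// addr_ge0// mulr_ge0//.
Qed.

End approximate_inverse.

(** * Characters *)

Section characters.
Context {R : realType} {X : completeNormedModType (CC R)}.
Local Notation C := (CC R).
Variable e : nat -> X.
Hypothesis e_basis : schauder_basis e.
Hypothesis e_norm : normalized e.
Local Notation D := (polydisc e).
Local Notation H := (Hinf e).
Local Notation Re := complex.Re.
Local Notation Im := complex.Im.

Lemma hinf_bhol (f : H) : exists2 F : X -> C, bhol D F & forall x : D, f x = F (val x).
Proof.
have /bounded_holoP[[F fF Fd] [M fM]] := hinf_subproof f; exists F => //; split=> //.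
exists (complex.Re M) => x xD; have := fM (exist _ x (mem_set xD)).
by rewrite fF /= nrmE lecE => /andP[].
Qed.

Lemma bhol_hinf (F : X -> C) : bhol D F -> exists f : H, forall x : D, f x = F (val x).
Proof.
move=> [Fd [M FM]].
have fP : (fun x : D => F (val x)) \in @bounded_holo R X e.
  apply/bounded_holoP; split; first by exists F.
  exists M%:C%C => x; rewrite nrmE lecR; apply: FM; exact: set_valP.
by exists (MkHinf fP).
Qed.

Lemma geometric_small (q d : R) : 0 <= q -> q < 1 -> 0 < d -> exists n : nat, q ^+ n < d.
Proof.
move=> q0 q1 d0; have q1' : `|q| < 1 by rewrite ger0_norm.
have /cvgrPdist_lt/(_ d d0)[n _ nP] := cvg_expr q1'.
by exists n; have := nP n (leqnn n); rewrite sub0r normrN ger0_norm// exprn_ge0.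
Qed.

Lemma hinfX (f : H) n x : (f ^+ n) x = f x ^+ n.
Proof. by elim: n => [|n IH] //; rewrite !exprS -IH. Qed.

Variable phi : spectrum e.

Lemma char1 : phi 1 = 1.
Proof.
have [f f0] := character_neq0 phi; have := characterM phi 1 f.
by rewrite mul1r -[X in X = _]mul1r => /(mulIf f0) <-.
Qed.

Lemma charX (f : H) n : phi (f ^+ n) = phi f ^+ n.
Proof.
elim: n => [|n IH]; first by rewrite !expr0 char1.
by rewrite !exprS characterM IH.
Qed.

(** Continuity applied to f^n gives |phi f|^n <= k' B^n, and letting n grow removes the constant
    k'. *)
Lemma char_le (f : H) (B : R) : 0 <= B -> (forall x, nrm (f x) <= B) -> nrm (phi f) <= B.
Proof.
move=> B0 fB; rewrite leNgt; apply/negP => Ba; set a := nrm (phi f) in Ba.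
have a0 : 0 < a by exact: le_lt_trans Ba.
have [k k0 kP] := linear_lipschitz (@dual_continuous _ _ phi).
have [k' k'0 kE] := posC k0.
have key n : a ^+ n <= k' * B ^+ n.
  rewrite /a -nrmX -charX -lecR -nrmE; apply: (le_trans (kP _)).
  rewrite kE rmorphM /= ler_pM2l ?ltcR// hinf_normE.
  apply: sup_norm_le => [|x]; first by rewrite ler0c exprn_ge0.
  by rewrite hinfX nrmE lecR nrmX lerXn2r// nnegrE nrm_ge0.
have q1 : B / a < 1 by rewrite ltr_pdivrMr// mul1r.
have q0 : 0 <= B / a by rewrite divr_ge0// ltW.
have i0 : 0 < k'^-1 by rewrite invr_gt0.
have [n nP] := geometric_small q0 q1 i0.
have := key n; rewrite leNgt => /negP; apply.
by move: nP; rewrite expr_div_n ltr_pdivrMr ?exprn_gt0// ltr_pdivlMl.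
Qed.

(** With w = x/z this is the parallelogram identity |1 + w|^2 + |1 - w|^2 = 2 + 2|w|^2 <= 4. *)
Lemma peak_sqr (z x : C) : nrm z = 1 -> nrm x < 1 ->
  nrm ((1 + z^-1 * x) / 2) ^+ 2 <= 1 - nrm (x - z) ^+ 2 / 4.
Proof.
move=> z1 x1; have z0 : z != 0 by apply/eqP => z0; move: z1; rewrite z0 nrm0; lra.
have [w wx w1] : exists2 w : C, x = z * w & nrm w < 1.
  by exists (z^-1 * x); rewrite ?mulVKf// nrmM nrmV z1 invr1 mul1r.
rewrite wx mulKf// (_ : z * w - z = z * (w - 1)); last by ring.
have [R1 I1] : Re (1 : C) = 1 /\ Im (1 : C) = 0 by [].
rewrite !nrmM nrmV z1 mul1r nrm_nat exprMn !nrm_sqr ReB ImB ReD ImD R1 I1.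
have w2 : nrm w ^+ 2 <= 1 by rewrite expr_le1 ?nrm_ge0// ltW.
rewrite nrm_sqr in w2; rewrite exprVn (_ : 2 ^+ 2 = 4 :> R); last by rewrite -natrX.
by move: (Re w) (Im w) w2 => a b; rewrite !expr2 => *; lra.
Qed.

Variable c : nat -> H.
Hypothesis cE : forall k (x : D), c k x = coef e k (val x).
Local Notation zc := (fun k => phi (c k)).

Lemma val_nrm k (x : D) : nrm (coef e k (val x)) < 1.
Proof. by have /polydiscP := set_valP x. Qed.

Lemma zc_le1 k : nrm (zc k) <= 1.
Proof. by apply: char_le => // x; rewrite cE ltW// val_nrm. Qed.

(** The change made by freezing vanishes where the coordinate is [zc k], hence is divisible by
    [c k - zc k], which [phi] sends to 0. *)
Lemma char_freeze k (v : H) : nrm (zc k) < 1 ->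
  exists2 w : H, phi w = phi v & forall x : D, exists2 y : D,
    val y = upd e k (zc k) (val x) & w x = v y.
Proof.
move=> z1; have [V [Vd [M VM]] vV] := hinf_bhol v.
have inD x : D x -> D (upd e k (zc k) x).
  move=> /polydiscP xD; apply/polydiscP => j; rewrite (coef_upd e_basis).
  by case: eqP.
have W : bhol D (fun x => V (upd e k (zc k) x)).
  split=> [x xD|]; last by exists M => x /inD /VM.
  apply: (@differentiable_comp _ _ _ _ (upd e k (zc k)) V); last exact/Vd/inD.
  by apply: (upd_diff e_basis e_norm k (g := fun=> zc k) (f := fun y => y)) => //; exact: dif_cst.
have [w wE] := bhol_hinf W; exists w; last first.
  by move=> x; exists (SigSub (mem_set (inD _ (set_valP x)))); rewrite // vV wE.
have [|||h hb hE] := @division R X e e_basis e_norm k (zc k)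
    (fun x => V x - V (upd e k (zc k) x)) (M + M) z1.
- by move=> x xD; apply: difB; [exact: Vd|exact: W.1].
- move=> x xD; apply: (le_trans (nrmB _ _)); apply: lerD; first exact: VM xD.
  exact: VM (inD x xD).
- move=> x xD; set y := upd e k (zc k) x; have yk : coef e k y = zc k.
    by rewrite (coef_upd e_basis) eqxx.
  by rewrite -yk upd_id subrr.
have [g gE] := bhol_hinf hb.
have E : v - w = (c k - (phi (c k) : C) *: (1 : H)) * g.
  apply: val_inj; apply/funext => x.
  transitivity (v x - w x) => //; rewrite vV wE hE; last exact: set_valP.
  transitivity ((c k x - zc k * 1) * g x) => //.
  by rewrite mulr1 cE gE.
apply/eqP; rewrite eq_sym -subr_eq0 -linearB E characterM linearB linearZ /= char1.
by rewrite [_ *: _]mulr1 subrr mul0r.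
Qed.

Lemma damped_bound (B K a t b s : R) : 0 <= B -> 0 <= K -> 0 <= a -> 0 <= b -> b <= 1 ->
  t * b <= s -> (B + K * a + K * t) * b <= B + K * s + K * a.
Proof.
move=> B0 K0 a0 b0 b1 tb; have h1 := ler_wpM2l K0 tb.
have h2 : (B + K * a) * b <= B + K * a by rewrite ler_piMr// addr_ge0// mulr_ge0.
lra.
Qed.

(* For |zc n| < 1 the last coordinate is frozen at zc n, which phi does not see;
   for |zc n| = 1, v is multiplied by powers of a function peaking at zc n. *)
Lemma char_dist n (v : H) (B K : R) : 0 <= B -> 0 <= K ->
  (forall x : D, nrm (v x) <= B + K * dist e zc n (val x)) -> nrm (phi v) <= B.
Proof.
elim: n v B => [|n IH] v B B0 K0 vB.
  by apply: char_le => // x; have := vB x; rewrite /dist big_ord0 mulr0 addr0.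
have distS x : dist e zc n.+1 x = dist e zc n x + nrm (coef e n x - zc n).
  by rewrite /dist big_ord_recr.
have := zc_le1 n; rewrite le_eqVlt => /orP[/eqP z1|z1]; last first.
  have [w <- wP] := char_freeze v z1; apply: IH => // x.
  have [y yE ->] := wP x; have := vB y.
  rewrite distS yE (coef_upd e_basis) eqxx subrr nrm0 addr0; congr (_ <= _ + _ * _).
  apply: eq_bigr => j _; rewrite (coef_upd e_basis).
  by rewrite ltn_eqF.
pose p : H := (2^-1 : C) *: (1 + (phi (c n))^-1 *: c n).
have z0 : phi (c n) != 0 by apply/eqP => z0; move: z1; rewrite z0 nrm0; lra.
have pE (x : D) : p x = (1 + (phi (c n))^-1 * coef e n (val x)) / 2.
  transitivity (2^-1 * (1 + (phi (c n))^-1 * c n x)) => //.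
  by rewrite cE mulrC.
have phip : phi p = 1.
  rewrite linearZ linearD linearZ /= char1.
  rewrite [_ *: phi _]mulVf// [_ *: _]mulrC divff//.
clearbody p; apply/ler_addgt0Pl => d d0.
have K1 : 0 < K + 1 by rewrite ltr_wpDl.
have [s s0 Ks] : exists2 s : R, 0 < s & K * s <= d.
  exists (d / (K + 1)); first by rewrite divr_gt0.
  rewrite mulrA ler_pdivrMr// mulrC ler_wpM2l ?(ltW d0)//.
  by rewrite lerDl.
(* The bound of [peak_sqr] at distance [s] from the peak; the maximum with 0 covers [s > 2]. *)
pose q := Num.max 0 (1 - s ^+ 2 / 4).
have q1 : q < 1 by rewrite gt_max ltr01 ltrBlDr ltrDl divr_gt0// exprn_gt0.
have q0 : 0 <= q by rewrite le_max lexx.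
(* Distances [t] are at most 2, so q^m < s/2 brings [t] times the damping factor below [s] where t >
   s; where t <= s the factor is at most 1. *)
have [m mP] := @geometric_small q (s / 2) q0 q1 (divr_gt0 s0 (ltr0n _ 2)).
have -> : phi v = phi (v * (p ^+ 2) ^+ m).
  by rewrite characterM !charX phip !expr1n mulr1.
rewrite addrC; apply: (le_trans _ (lerD (lexx B) Ks)); apply: IH => //.
  by rewrite addr_ge0// mulr_ge0// ltW.
move=> x; have -> : (v * (p ^+ 2) ^+ m) x = v x * (p x ^+ 2) ^+ m.
  by transitivity (v x * ((p ^+ 2) ^+ m) x) => //; rewrite !hinfX.
have x1 := val_nrm n x; have h := peak_sqr z1 x1; rewrite -pE in h.
set t := nrm (coef e n (val x) - phi (c n)) in h *.
have t0 : 0 <= t by exact: nrm_ge0.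
have p0 : 0 <= nrm (p x) ^+ 2 by rewrite exprn_ge0// nrm_ge0.
have p1 : nrm (p x) ^+ 2 <= 1.
  by apply: (le_trans h); rewrite gerBl divr_ge0// exprn_ge0.
have pm : (nrm (p x) ^+ 2) ^+ m <= 1 by rewrite exprn_ile1.
have pm0 : 0 <= (nrm (p x) ^+ 2) ^+ m by rewrite exprn_ge0.
have ts : t * (nrm (p x) ^+ 2) ^+ m <= s.
  have [ts|ts] := leP t s; first by apply: le_trans ts; rewrite ler_piMr.
  have t2 : t <= 1 + 1.
    by apply: (le_trans (nrmB _ _)); apply: lerD; [exact: ltW x1|rewrite z1].
  have h1 : (nrm (p x) ^+ 2) ^+ m <= q ^+ m.
    apply: lerXn2r; rewrite ?nnegrE// le_max; apply/orP; right; apply: (le_trans h).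
    by rewrite lerD2l lerN2 ler_pM2r ?invr_gt0// lerXn2r ?nnegrE// ltW.
  apply: le_trans (ler_pM t0 pm0 t2 h1) _; rewrite (_ : 1 + 1 = 2)//.
  by rewrite -ler_pdivlMl// mulrC ltW.
rewrite nrmM !nrmX; have vx := vB x; rewrite distS -/t in vx.
have dx := dist_ge0 e zc n (val x).
apply: (le_trans (ler_wpM2r pm0 vx)); rewrite mulrDr addrA.
exact: damped_bound B0 K0 dx pm0 pm ts.
Qed.

Lemma char_neq0_of_lower_bound (f : H) (eps delta : R) n : 0 < eps -> 0 < delta ->
  (forall x : D, nbd e zc eps n (val x) -> delta <= nrm (f x)) -> phi f != 0.
Proof.
move=> eps0 d0 fd; have [F Fb fF] := hinf_bhol f.
have [|G Gb [K K0 GP]] := @approximate_inverse R X e e_basis e_norm zc eps eps0 zc_le1 n F delta d0 Fb.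
  move=> x Ux; have := fd (SigSub (mem_set (nbd_polydisc Ux))) Ux.
  by rewrite fF.
have [g gE] := bhol_hinf Gb.
have : nrm (phi (1 - f * g)) <= 0.
  apply: (char_dist (n := n) (lexx _) K0) => x; rewrite add0r.
  have -> : (1 - f * g) x = 1 - F (val x) * G (val x) by rewrite -fF -gE.
  exact/GP/set_valP.
rewrite linearB characterM char1 => h; apply/eqP => f0; move: h.
by rewrite f0 mul0r subr0 nrm1 ler10.
Qed.

End characters.

(** * Nets and the weak-star topology *)

Lemma dual_cvgP {K : numFieldType} {V : normedModType K} (F : set_system (dual V))
    (z : dual V) : Filter F ->
  F --> z <-> forall v, (fun u : dual V => u v) @ F --> z v.
Proof.
move=> FF; pose i (u : dual V) : {ptws V -> K} := u; split=> [Fz v A zA|Fz A].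
  have ci : {for z, continuous i} by exact: initial_continuous.
  exact: (Fz _ (ci _ (@proj_continuous _ (fun=> K) v (i z) A zA))).
rewrite nbhsE => -[_ [[W oW <-]] /= Wz sA]; apply: filterS sA _.
have : i @ F --> (i z : {ptws V -> K}).
  apply/pointwise_cvgP => v; exact: Fz v.
by apply; apply: open_nbhs_nbhs.
Qed.

Lemma dual_eq {K : numFieldType} {V : normedModType K} (u v : dual V) :
  (forall x, u x = v x) -> u = v.
Proof.
case: u v => [[u [[ua] [us]]] uc] [[v [[va] [vs]]] vc] /= /funext uv.
move: va vs vc; case: _ / uv => va vs.
rewrite (Prop_irrelevance va ua) (Prop_irrelevance vs us) => vc.
by rewrite (Prop_irrelevance uc vc).
Qed.

Lemma nrm_cvgP {R : realType} {I : Type} (F : set_system I) (u : I -> CC R) (l : CC R) :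
  Filter F ->
  u @ F --> l <-> forall d : R, 0 < d -> F [set i | nrm (u i - l) < d].
Proof.
move=> FF; split=> [ul d d0|ul].
  have := ul [set w | nrm (w - l) < d]; apply.
  by apply/nbhs_nrm; exists d.
move=> A lA; have [d d0 dA] := (nbhs_nrm l A).1 lA.
change (F (u @^-1` A)); apply: filterS (ul d d0) => i ui; exact: dA.
Qed.

Lemma tails_filter {I : Type} (le : I -> I -> Prop) : directed le -> ProperFilter (tails le).
Proof.
move=> [[i0] refl trans dir]; apply: Build_ProperFilter_ex.
  by move=> A [i iA]; exists i; apply: iA.
split; first by exists i0.
- move=> A B [i iA] [j jB]; have [k [ik jk]] := dir i j; exists k => m km.
  by split; [apply/iA/(trans _ k)|apply/jB/(trans _ k)].
- by move=> A B AB [i iA]; exists i => j /iA/AB.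
Qed.

(** * Functionals bounded on the polydisc *)

Section cluster.
Context {R : realType} {X : completeNormedModType (CC R)}.
Local Notation C := (CC R).
Variable e : nat -> X.
Hypothesis e_basis : schauder_basis e.
Hypothesis e_norm : normalized e.
Local Notation D := (polydisc e).
Local Notation H := (Hinf e).

Lemma coord_hinf : exists c : nat -> H, forall k (x : D), c k x = coef e k (val x).
Proof.
have P k : exists f : H, forall x : D, f x = coef e k (val x).
  apply: bhol_hinf; split=> [x _|]; first exact: coef_diff.
  by exists 1 => x /polydiscP xD; exact/ltW/xD.
by have [c cP] := choice P; exists c.
Qed.

Lemma dual_psum (u : dual X) a n : u (psum e a n) = \sum_(j < n) a j * u (e j).
Proof. by rewrite linear_sum; apply: eq_bigr => j _; rewrite linearZ. Qed.

(** [u] is tested on the vector whose j-th coordinate is r times the phase that makes [u] positive;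
    it lies in the polydisc for r < 1 and gives r times the sum. Where [u (e j)] is 0, division by 0
    yields the coordinate 0. *)
Lemma sum_dual_le (u : dual X) (M : R) n : (forall x, D x -> nrm (u x) <= M) ->
  \sum_(j < n) nrm (u (e j)) <= M.
Proof.
move=> uM; set S := \sum_(j < n) _; have S0 : 0 <= S by apply: sumr_ge0 => j _; exact: nrm_ge0.
pose s (r : R) j : C := if (j < n)%N then (r * nrm (u (e j)))%:C%C / u (e j) else 0.
have sE (r : R) j : coef e j (psum e (s r) n) = s r j.
  apply: (coef_uniq e_basis); apply/expansionP => d d0; exists n => m nm.
  rewrite /psum -(subnKC nm) big_split_ord /= addrC addrK big1 ?nrm0// => i _.
  by rewrite /s ltnNge leq_addr scale0r.
have sle (r : R) : 0 <= r -> r < 1 -> r * S <= M.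
  move=> r0 r1; have xD : D (psum e (s r) n).
    apply/polydiscP => j; rewrite sE /s.
    case: ifP => _; rewrite ?nrm0// nrmM nrmV nrmR ger0_norm ?mulr_ge0 ?nrm_ge0//.
    have [->|z0] := eqVneq (nrm (u (e j))) 0; first by rewrite mulr0 mul0r.
    by rewrite mulfK.
  have := uM _ xD; rewrite dual_psum (_ : \sum_(j < n) _ = (r * S)%:C%C).
    by rewrite nrmR ger0_norm// mulr_ge0.
  rewrite /S mulr_sumr rmorph_sum; apply: eq_bigr => j _; rewrite /s ltn_ord.
  have [z0|z0] := eqVneq (u (e j)) 0; first by rewrite z0 nrm0 !mulr0.
  by rewrite divfK.
rewrite leNgt; apply/negP => MS.
have M0 : 0 <= M by have := sle 0 (lexx _) ltr01; rewrite mul0r.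
have S1 : 0 < S by exact: le_lt_trans MS.
have r0 : 0 <= (M / S + 1) / 2 by rewrite divr_ge0// addr_ge0// divr_ge0.
have MS1 : M / S < 1 by rewrite ltr_pdivrMr// mul1r.
have r1 : (M / S + 1) / 2 < 1 by move: MS1; move: (M / S) => a *; lra.
have := sle _ r0 r1; rewrite (_ : (M / S + 1) / 2 * S = (M + S) / 2); first by lra.
by field; rewrite gt_eqF.
Qed.

(* By sum_dual_le, X^# is l_1: its elements are norm limits of finite combinations
   of the coefficient functionals. *)
Lemma sharp_approx (u : dual X) (M d : R) : (forall x, D x -> nrm (u x) <= M) -> 0 < d ->
  exists N, forall x, D x -> nrm (u x - \sum_(j < N) coef e j x * u (e j)) <= d.
Proof.
move=> uM d0; pose S n := \sum_(j < n) nrm (u (e j)).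
have SM n : S n <= M by exact: sum_dual_le.
(* The partial sums are bounded by [M]; if they could always grow by more than [d], iterating would
   exceed [M]. *)
have [N NP] : exists N, forall n, S n <= S N + d.
  apply: contrapT => nN.
  have st n : exists m, S n + d < S m.
    apply: contrapT => nm; apply: nN; exists n => m; rewrite leNgt; apply/negP => h.
    by apply: nm; exists m.
  have [g gP] := choice st.
  have it k : k%:R * d <= S (iter k g 0%N).
    elim: k => [|k IH]; first by rewrite mul0r sumr_ge0// => j _; exact: nrm_ge0.
    have /= := gP (iter k g 0%N); rewrite -natr1; lra.
  have [k kP] : exists k : nat, M / d < k%:R.
    by exists (Num.truncn (M / d)).+1; exact: truncnS_gt.
  have := it k; have := SM (iter k g 0%N); move: kP; rewrite ltr_pdivrMr//; lra.
exists N => x xD; have x1 := (polydiscP e x).1 xD.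
have [K K0 KP] := linear_lipschitz (@dual_continuous _ _ u).
have [K' K'0 KE] := posC K0.
apply/ler_addgt0Pl => t t0; have tK : 0 < t / K' by rewrite divr_gt0.
have [n nP] := (expansionP _ _ _).1 (@coefP _ _ _ e_basis x) _ tK.
have := nP (n + N)%N (leq_addr _ _); rewrite nrmBC; set y := psum _ _ _ => yx.
have h1 : nrm (u x - u y) <= t.
  rewrite -linearB -lecR -nrmE; apply: (le_trans (KP _)).
  rewrite KE nrmE -rmorphM lecR; move: yx; rewrite ltr_pdivlMr// => yx.
  by apply: ltW; rewrite mulrC.
have h2 : nrm (u y - \sum_(j < N) coef e j x * u (e j)) <= d.
  rewrite /y dual_psum (addnC n) big_split_ord /= [X in nrm X]addrC addKr.
  apply: (le_trans (nrm_sum _)); have := NP (N + n)%N; rewrite /S big_split_ord /= lerD2l.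
  apply: le_trans; apply: ler_sum => j _; rewrite nrmM ler_piMl ?nrm_ge0//.
  exact/ltW/x1.
by apply: (le_trans (nrm_tri (u y) _ _)); apply: lerD.
Qed.

End cluster.

(** * The two inclusions *)

Section cluster_value_theorem.
Context {R : realType} {X : completeNormedModType (CC R)}.
Local Notation C := (CC R).
Variable e : nat -> X.
Local Notation D := (polydisc e).
Local Notation H := (Hinf e).

Lemma nrm_sup_norm (g : H) x : nrm (g x) <= sup_norm g.
Proof. by rewrite -lecR -nrmE; exact: ler_sup_norm. Qed.

Lemma hinf_sum n (g : 'I_n -> H) x : (\sum_(j < n) g j) x = \sum_(j < n) g j x.
Proof. exact: (big_morph (fun h : H => h x)). Qed.

Lemma ultralimit_character {I : Type} (U : set_system I) {UU : UltraFilter U} (x : I -> D) :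
  exists phi : spectrum e, forall g : H, phi g = ulim U (fun i => g (x i)).
Proof.
pose p (g : H) : C := ulim U (fun i => g (x i)).
have bd (g : H) i : nrm (g (x i)) <= sup_norm g by exact: nrm_sup_norm.
have pl : linear p by move=> a g h; rewrite /p -(ulimL a (bd g) (bd h)).
pose pM := GRing.isLinear.Build _ _ _ _ _ pl.
pose L : {linear H -> C} := HB.pack p pM.
have Lc : continuous L.
  apply/linear_bounded_continuous/linear_boundedP.
  exists 1; split=> [|r r1 g]; first exact: real1.
  have gL : `|p g| <= `|g| by rewrite nrmE hinf_normE lecR; exact: ulim_nrm (bd g).
  by apply: (le_trans gL); apply: ler_peMl (ltW r1); exact: normr_ge0.
have LM : {morph (Dual Lc) : f g / f * g} by move=> f g; exact: ulimM (bd f) (bd g).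
have L0 : exists f, Dual Lc f != 0.
  exists (1 : H); have -> : Dual Lc 1 = ulim U (fun=> (1 : C)) by [].
  by rewrite ulim_cst oner_neq0.
by exists (Character LM L0).
Qed.

Lemma cluster_subset (f : H) z : cluster_set f z `<=` gelfand f @` fiber z.
Proof.
move=> l [I [le [x [dir xz fl]]]]; have TF := tails_filter dir.
have [U [UU TU]] := ultraFilterLemma TF.
have [phi phiE] := ultralimit_character x.
exists phi; last first.
  rewrite /gelfand phiE; apply: ulim_unique => d d0; apply: TU.
  exact: (nrm_cvgP _ _ _).1 fl d d0.
apply: dual_eq => psi; rewrite -[LHS]/(phi (val psi)) phiE.
apply: ulim_unique => d d0; apply: TU.
have /dual_cvgP/(_ psi)/nrm_cvgP := xz; exact.
Qed.

Hypothesis e_basis : schauder_basis e.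
Hypothesis e_norm : normalized e.

(** Otherwise [f - phi f] would be bounded below on a neighbourhood of this kind, and [phi] could
    not send it to 0. *)
Lemma approximating_point (phi : spectrum e) (c : nat -> H) (f : H) n (d : R) :
  (forall k (x : D), c k x = coef e k (val x)) -> 0 < d ->
  exists x : D, nrm (f x - phi f) < d /\
    forall j, (j < n)%N -> nrm (c j x - phi (c j)) < d.
Proof.
move=> cE d0; apply: contrapT => none.
pose g : H := f - (phi f : C) *: (1 : H).
have gE (x : D) : g x = f x - phi f.
  by rewrite -[X in _ - X]mulr1.
have gd (x : D) : nbd e (fun k => phi (c k)) d n (val x) -> d <= nrm (g x).
  move=> [_ xn]; rewrite leNgt; apply/negP => gx; apply: none; exists x.
  by split=> [|j jn]; rewrite -?gE ?cE ?xn.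
have := char_neq0_of_lower_bound e_basis e_norm cE d0 d0 gd.
by rewrite linearB linearZ /= char1 [_ *: (1 : C)]mulr1 subrr eqxx.
Qed.

(** A sequence serves as the net: countably many coordinates govern the topology, up to the
    approximation in [sharp_approx]. *)
Lemma cluster_superset (f : H) z : gelfand f @` fiber z `<=` cluster_set f z.
Proof.
move=> _ [phi phiz <-]; have [c cE] := coord_hinf e_basis e_norm.
have [x xP] : exists x : nat -> D, forall n, nrm (f (x n) - phi f) < n.+1%:R^-1 /\
    forall j, (j < n)%N -> nrm (c j (x n) - phi (c j)) < n.+1%:R^-1.
  have inv0 n : 0 < n.+1%:R^-1 :> R by rewrite invr_gt0.
  have [x xP] := choice (fun n => approximating_point phi f n cE (inv0 n)).
  by exists x.
pose le (m n : nat) : Prop := (m <= n)%N.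
have dir : directed le.
  split=> [||i j k|i j]; [exact: (inhabits 0%N)|by move=> i; exact: leqnn|exact: leq_trans|].
  by exists (maxn i j); rewrite /le leq_maxl leq_maxr.
have TF := tails_filter dir.
have inv_small (d : R) : 0 < d -> exists N, forall n, (N <= n)%N -> n.+1%:R^-1 < d.
  move=> d0; exists (Num.truncn d^-1) => n Nn; rewrite invf_plt ?posrE//.
  by apply: lt_le_trans (truncnS_gt _) _; rewrite ler_nat ltnS.
exists nat, le, x; split=> //; last first.
  apply/nrm_cvgP => d d0; have [N NP] := inv_small d d0; exists N => n /NP.
  exact: lt_trans (xP n).1.
rewrite -phiz; apply/dual_cvgP => psi; apply/nrm_cvgP => d d0.
have /asboolP[u uE] := sharp_subproof psi.
have uM y : D y -> nrm (u y) <= sup_norm (val psi).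
  by move=> yD; rewrite -(uE (SigSub (mem_set yD))); exact: nrm_sup_norm.
(* Three errors of d/4 each: [psi] against [g] at the point, [g] at the point against [phi g], and
   [phi g] against the value of [phi] at [psi]. *)
have d3 : 0 < d / 4 by rewrite divr_gt0.
have [N NP] := sharp_approx e_basis uM d3.
pose g : H := \sum_(j < N) u (e j) *: c j.
have gE y : g y = \sum_(j < N) u (e j) * c j y by rewrite hinf_sum.
have psi_g y : nrm (val psi y - g y) <= d / 4.
  have := NP (val y) (set_valP y); rewrite -uE gE.
  by under eq_bigr => j _ do rewrite -cE mulrC.
have phi_g : nrm (phi (val psi) - phi g) <= d / 4.
  by rewrite -linearB; apply: char_le => [|y]; [exact: ltW|exact: psi_g].
pose K := \sum_(j < N) nrm (u (e j)); have K0 : 0 <= K by apply: sumr_ge0 => j _; exact: nrm_ge0.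
have dK : 0 < d / 4 / (K + 1) by rewrite !divr_gt0// ltr_wpDl.
have [N' N'P] := inv_small _ dK; exists (maxn N N') => n; rewrite /le geq_max => /andP[Nn N'n].
change (nrm (val psi (x n) - phi (val psi)) < d).
have g_phi : nrm (g (x n) - phi g) <= d / 4.
  rewrite gE linear_sum -sumrB; apply: (le_trans (nrm_sum _)).
  apply: (@le_trans _ _ (\sum_(j < N) nrm (u (e j)) * (d / 4 / (K + 1)))).
    apply: ler_sum => j _; rewrite linearZ /= -[_ *: phi _]/(_ * _) -mulrBr nrmM.
    apply: ler_wpM2l; first exact: nrm_ge0.
    apply: ltW; apply: lt_trans (N'P n N'n); apply: (xP n).2.
    exact: leq_trans (ltn_ord j) Nn.
  rewrite -mulr_suml -/K mulrA ler_pdivrMr ?ltr_wpDl// mulrC ler_wpM2l ?(ltW d3)//.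
  by rewrite lerDl.
have h1 := psi_g (x n).
have := nrm_tri (g (x n)) (val psi (x n)) (phi (val psi)).
have := nrm_tri (phi g) (g (x n)) (phi (val psi)).
rewrite (nrmBC (phi g)); lra.
Qed.

End cluster_value_theorem.

Theorem theorem4p12 (R : realType) (X : completeNormedModType (CC R))
    (X_infinite : infinite_dimensional X)
    (e : nat -> X) (e_basis : schauder_basis e) (e_normalized : normalized e)
    (f : Hinf e) (z : dual (Xsharp e)) (z_closure : polydisc_closure e z) :
  cluster_set f z = gelfand f @` fiber z.
Proof.
apply/seteqP; split; first exact: cluster_subset.
exact: cluster_superset.
Qed.
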